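(* For any integer $n\ge 2$, the law of $u_{ij}\in A_o(n)$ (with respect to the Haar functional, for any $i,j\in\{1,\dots,n\}$) has the following properties. (1) The support is $[-2/\sqrt{n+2},\,2/\sqrt{n+2}]$. (2) There are no atoms. (3) The density is analytic. (4) The density of $\sqrt{n+2}\,u_{ij}$ tends uniformly towards the density of the semicircle distribution as $n\to\infty$.
   Context: $A_o(n)$ is the universal unital $C^*$-algebra generated by $n^2$ self-adjoint elements $u_{ij}$ ($1\le i,j\le n$) subject to the relations $uu^t=u^tu=1$, where $u=(u_{ij})$ and $u^t=(u_{ji})$. It is a compact quantum group algebra in the sense of Woronowicz, with comultiplication $\Delta(u_{ij})=\sum_k u_{ik}\otimes u_{kj}$. The Haar functional, denoted $\int$, is the unique state on $A_o(n)$ that is left and right invariant: $(\mathrm{id}\otimes\int)\Delta(a)=(\int\otimes\,\mathrm{id})\Delta(a)=\left(\int a\right)1$ for all $a$. The law of a self-adjoint element $a\in A_o(n)$ is the Borel probability measure $\mu$ on $\mathbb R$ with $\int\phi(a)=\int_{\mathbb R}\phi\,d\mu$ for all continuous $\phi$; ''density'' means the density of this law. The semicircle distribution is the probability measure on $[-2,2]$ with density $\frac{1}{2\pi}\sqrt{4-x^2}$.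
   Formalization: (3) is proved on the open interval |x| < 2/√(n+2) (the density is 0 outside and not analytic at the endpoints), and for n = 2 the point x = 0 is excluded, because there the density is |x| on [-1,1], which is not analytic at 0. *)

(* Defs.v *)
From HB Require Import structures.
From mathcomp Require Import all_boot all_order all_algebra.
From mathcomp Require Import complex.
From mathcomp Require Import all_classical all_reals all_analysis.

Set Implicit Arguments.
Unset Strict Implicit.
Unset Printing Implicit Defensive.

Import Order.TTheory GRing.Theory Num.Theory.
Import numFieldNormedType.Exports.

Local Open Scope classical_set_scope.
Local Open Scope ring_scope.
Local Open Scope complex_scope.

(* Unital C*-algebras. algType imposes 1 != 0, which only excludes the zero
   algebra. The norm is carried by the structure because there is no join of
   rings and normed modules in the hierarchy: numDomainType inherits from both
   and any new join would have to be declared above it. *)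
HB.mixin Record isCStar (R : realType) A of GRing.Algebra R[i] A := {
  star : A -> A ;
  cnorm : A -> R ;
  starD : forall x y : A, star (x + y) = star x + star y ;
  starZ : forall (c : R[i]) (x : A), star (c *: x) = c^* *: star x ;
  starM : forall x y : A, star (x * y) = star y * star x ;
  starK : forall x : A, star (star x) = x ;
  cnorm_eq0 : forall x : A, cnorm x = 0 -> x = 0 ;
  cnormD : forall x y : A, cnorm (x + y) <= cnorm x + cnorm y ;
  cnormZ : forall (c : R[i]) (x : A),
    (cnorm (c *: x))%:C = `|c| * (cnorm x)%:C ;
  cnormM : forall x y : A, cnorm (x * y) <= cnorm x * cnorm y ;
  cnorm_star : forall x : A, cnorm (star x * x) = cnorm x ^+ 2 ;
  cnorm_complete : forall v : nat -> A,
    (forall e : R, 0 < e -> exists N, forall m n, (N <= m)%N -> (N <= n)%N ->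
       cnorm (v m - v n) < e) ->
    exists l : A, forall e : R, 0 < e -> exists N, forall n, (N <= n)%N ->
       cnorm (v n - l) < e
}.

#[short(type="cstarType")]
HB.structure Definition CStar (R : realType) :=
  { A of GRing.Algebra R[i] A & isCStar R A }.

Definition star_hom (R : realType) (A B : cstarType R)
    (f : {lrmorphism A -> B}) : Prop :=
  forall x, f (star x) = star (f x).

Definition Ao_relations (R : realType) n (A : cstarType R) (u : 'M[A]_n) : Prop :=
  [/\ forall i j, star (u i j) = u i j, u *m u^T = 1%:M & u^T *m u = 1%:M].

(* (A, u) is A_o(n) with its generators. *)
Definition is_Ao (R : realType) n (A : cstarType R) (u : 'M[A]_n) : Prop :=
  Ao_relations u /\
  forall (B : cstarType R) (v : 'M[B]_n), Ao_relations v ->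
    exists f : {lrmorphism A -> B},
      [/\ star_hom f, forall i j, f (u i j) = v i j
        & forall g : {lrmorphism A -> B}, star_hom g ->
            (forall i j, g (u i j) = v i j) -> f =1 g].

Section TensorSquare.
Context (R : realType) (A : cstarType R).

Definition lin_indep m (a : 'I_m -> A) : Prop :=
  forall c : 'I_m -> R[i], \sum_k c k *: a k = 0 -> forall k, c k = 0.

Definition tensor_sum (T : cstarType R) (i1 i2 : A -> T) m
  (a b : 'I_m -> A) : T := \sum_k i1 (a k) * i2 (b k).

(* T is a C*-completion of the algebraic tensor product of A with itself,
   where i1 a = a (x) 1 and i2 b = 1 (x) b; the third condition says that the
   canonical map from the algebraic tensor product to T is injective. *)
Definition cstar_tensor (T : cstarType R) (i1 i2 : {lrmorphism A -> T}) : Prop :=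
  [/\ star_hom i1 /\ star_hom i2,
      forall a b, i1 a * i2 b = i2 b * i1 a,
      forall m (a b : 'I_m -> A), lin_indep a ->
        tensor_sum i1 i2 a b = 0 -> forall k, b k = 0
    & forall (t : T) (e : R), 0 < e -> exists m (a b : 'I_m -> A),
        cnorm (t - tensor_sum i1 i2 a b) < e].

(* The minimal (spatial) tensor product: least C*-norm. *)
Definition min_tensor (T : cstarType R) (i1 i2 : {lrmorphism A -> T}) : Prop :=
  cstar_tensor i1 i2 /\
  forall (T' : cstarType R) (j1 j2 : {lrmorphism A -> T'}),
    cstar_tensor j1 j2 ->
    forall m (a b : 'I_m -> A),
      cnorm (tensor_sum i1 i2 a b) <= cnorm (tensor_sum j1 j2 a b).

Definition is_state (h : {scalar A}) : Prop :=
  [/\ h 1 = 1, forall a, 0 <= h (star a * a) & forall a, `|h a| <= (cnorm a)%:C].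

(* E = id (x) h and E = h (x) id, as bounded maps from T to A. *)
Definition right_slice (T : cstarType R) (i1 i2 : {lrmorphism A -> T})
    (h : {scalar A}) (E : {linear T -> A}) : Prop :=
  (exists C : R, forall t, cnorm (E t) <= C * cnorm t) /\ forall a b, E (i1 a * i2 b) = h b *: a.

Definition left_slice (T : cstarType R) (i1 i2 : {lrmorphism A -> T})
    (h : {scalar A}) (E : {linear T -> A}) : Prop :=
  (exists C : R, forall t, cnorm (E t) <= C * cnorm t) /\ forall a b, E (i1 a * i2 b) = h a *: b.

(* Haar functional of A_o(n), generated by the entries of u. *)
Definition is_haar n (u : 'M[A]_n) (h : {scalar A}) : Prop :=
  is_state h /\
  exists (T : cstarType R) (i1 i2 : {lrmorphism A -> T})
      (Delta : {lrmorphism A -> T}),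
    [/\ min_tensor i1 i2, star_hom Delta,
        forall i j, Delta (u i j) = \sum_k i1 (u i k) * i2 (u k j),
        exists2 E : {linear T -> A}, right_slice i1 i2 h E
          & forall a, E (Delta a) = (h a)%:A
      & exists2 E : {linear T -> A}, left_slice i1 i2 h E
          & forall a, E (Delta a) = (h a)%:A].

End TensorSquare.

Section Law.
Context (R : realType).

Definition ccontinuous (phi : R -> R[i]) : Prop :=
  continuous (fun x => complex.Re (phi x)) /\
  continuous (fun x => complex.Im (phi x)).

Definition real_spectrum (A : cstarType R) (a : A) : set R :=
  [set x | ~ exists b : A, b * (a - x%:C%:A) = 1 /\ (a - x%:C%:A) * b = 1].

(* Phi is the continuous functional calculus phi |-> phi(a) of the self-adjoint
   element a: the unital *-homomorphism from C(Sp a) to A that maps the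
   inclusion of Sp a to a. By Tietze, continuous functions on Sp a are
   represented by continuous functions on the line. *)
Definition is_cfc (A : cstarType R) (a : A) (Phi : (R -> R[i]) -> A) : Prop :=
  [/\ (forall phi psi, ccontinuous phi -> ccontinuous psi ->
         (forall x, real_spectrum a x -> phi x = psi x) -> Phi phi = Phi psi),
      (forall c phi psi, ccontinuous phi -> ccontinuous psi ->
         Phi (fun x => c * phi x + psi x) = c *: Phi phi + Phi psi),
      (forall phi psi, ccontinuous phi -> ccontinuous psi ->
         Phi (fun x => phi x * psi x) = Phi phi * Phi psi),
      (forall phi, ccontinuous phi ->
         Phi (fun x => (phi x)^*) = star (Phi phi))
    & Phi (fun=> 1) = 1 /\ Phi (fun x => x%:C) = a].

Definition is_law (A : cstarType R) (h : {scalar A}) (a : A)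
    (mu : probability (measurableTypeR R) R) : Prop :=
  exists2 Phi, is_cfc a Phi &
    forall phi, ccontinuous phi ->
      [/\ mu.-integrable setT (EFin \o (fun x => complex.Re (phi x))),
          mu.-integrable setT (EFin \o (fun x => complex.Im (phi x)))
        & h (Phi phi) = (\int[mu]_x (complex.Re (phi x)))%R
                     +i* (\int[mu]_x (complex.Im (phi x)))%R].

Definition msupport (mu : probability (measurableTypeR R) R) : set R :=
  [set x | forall U : set R, open U -> U x -> (0 < mu U)%E].

(* f is one version of the density of mu with respect to Lebesgue measure. *)
Definition is_density (mu : probability (measurableTypeR R) R)
    (f : R -> R) : Prop :=
  [/\ measurable_fun setT (f : measurableTypeR R -> R), forall x, 0 <= f x
    & forall B : set (measurableTypeR R), measurable B ->
        mu B = (\int[lebesgue_measure]_(x in B) (f x)%:E)%E].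

(* Real analyticity at a point. It fails for the density of the law of an entry
   of u at both endpoints of the support (the density is 0 outside). For n = 2
   it also fails at 0: the density is then |x| on [-1, 1]. *)
Definition analytic_at (f : R -> R) (x : R) : Prop :=
  exists (c : R^nat) (r : R), 0 < r /\
    forall y, `|y - x| < r -> pseries c (y - x) @ \oo --> f y.

(* Num.sqrt vanishes on negative numbers, so this is 0 outside [-2, 2]. *)
Definition semicircle (x : R) : R := Num.sqrt (4 - x ^+ 2) / (2 * pi).

End Law.

(* Main.v *)
(* A concrete family satisfying the relations of A_o(n) acts on the Fock space of
   pairs of traceless tensors of equal length (a tensor is traceless if every
   contraction of adjacent factors vanishes). The universal property of A_o(n)
   and left and right invariance of the Haar functional identify the moments of
   u_ij with vacuum moments in this model, where u_ij is a Jacobi matrix on the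
   tensors e_i^{(x) k} (x) e_j^{(x) k} projected to traceless ones. With
   p + 1/p = n and q = -p its squared weights are tau_k tau_{k+1} / (n + 2), where
   tau_k = (1 - q^k) / (1 + q^k), so that the law has the moments of the density
     (semicircle of radius 2 / sqrt (n + 2)) * sum_s g_s V_{2s} (sqrt (n + 2) x),
   with V_k the Chebyshev polynomials orthonormal for the semicircle law and g_s
   of size p^s. As p < 2/5 for n >= 3, the sum converges geometrically; its
   positivity follows from an expansion in theta (c) = c x^2 / ((1 - c)^2 + c x^2),
   c = q^j, and since g_0 = 1 and p -> 0, the density converges to the semicircle.
   For n = 2 the moments are those of |x| on [-1, 1]. A compactly supported bounded
   density is determined by its moments. *)

Require Import Defs.
From HB Require Import structures.
From mathcomp Require Import all_boot all_order all_algebra.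
From mathcomp Require Import complex.
From mathcomp Require Import all_classical all_reals all_analysis.
From mathcomp Require Import measurable_realfun ring lra.

Set Implicit Arguments.
Unset Strict Implicit.
Unset Printing Implicit Defensive.

Import Order.TTheory GRing.Theory Num.Theory.
Import numFieldNormedType.Exports.

Local Open Scope classical_set_scope.
Local Open Scope ring_scope.
Local Open Scope complex_scope.

(** The Haar functional is known only through its invariance, and the universal property yields a
    map only into an algebra that is already at hand: this is why a Hilbert space and its bounded
    operators are built. On monomials the Haar functional equals the vacuum functional because their
    convolution can be computed twice: invariance returns the former, and the commutation of
    [u^{(x) k}] with the Jones-Wenzl projections returns the latter. The weights tau_k tau_{k+1}
    belong to Rogers' continuous q-ultraspherical polynomials of parameter -q, the Chebyshev
    polynomials have parameter q, and g_s is the constant term of V_{2s} in the former family; hence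
    the product formulas. The bound 2/5 comes from estimating V_{2s} on [-2, 2] by a multiple of
    (5/2)^s. The rate 5/2 lies between 1 + sqrt 2, the rate of the recursion taken in absolute
    value, and 1/p = (3 + sqrt 5)/2 at n = 3; the gap absorbs the perturbation of the argument in
    the proof of analyticity. At n = 2 one has p = 1 and the formulas degenerate. *)

(** * Bounded operators on a Hilbert space *)

(* [rip] is the real part of the inner product. *)
Record hilbert (R : realType) := Hilbert {
  hcar :> lmodType R[i] ;
  rip : hcar -> hcar -> R ;
  ripC : forall x y, rip x y = rip y x ;
  ripDl : forall x y z, rip (x + y) z = rip x z + rip y z ;
  ripZr : forall (r : R) x y, rip (r%:C *: x) y = r * rip x y ;
  ripZ : forall (c : R[i]) x y, rip (c *: x) y = rip x (c^* *: y) ;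
  rip_ge0 : forall x, 0 <= rip x x ;
  rip_eq0 : forall x, rip x x = 0 -> x = 0 ;
  hcomplete : forall v : nat -> hcar,
    (forall e : R, 0 < e -> exists N, forall m n, (N <= m)%N -> (N <= n)%N ->
       rip (v m - v n) (v m - v n) < e) ->
    exists l, forall e : R, 0 < e -> exists N, forall n, (N <= n)%N ->
       rip (v n - l) (v n - l) < e ;
  hnontrivial : exists x : hcar, x != 0
}.

Section HilbertNorm.
Context (R : realType) (E : hilbert R).
Implicit Types x y z : E.

Definition hnorm x : R := Num.sqrt (rip x x).

Lemma hnorm_ge0 x : 0 <= hnorm x. Proof. exact: sqrtr_ge0. Qed.

Lemma hnorm_sqr x : hnorm x ^+ 2 = rip x x.
Proof. by rewrite sqr_sqrtr ?rip_ge0. Qed.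

Lemma ripDr x y z : rip x (y + z) = rip x y + rip x z.
Proof. by rewrite ripC ripDl !(ripC _ x). Qed.

Lemma ripZrr (r : R) x y : rip x (r%:C *: y) = r * rip x y.
Proof. by rewrite ripC ripZr ripC. Qed.

Lemma ripNl x y : rip (- x) y = - rip x y.
Proof.
have := ripZr (-1) x y; rewrite mulN1r => <-.
by rewrite rmorphN rmorph1 scaleN1r.
Qed.

Lemma ripNr x y : rip x (- y) = - rip x y.
Proof. by rewrite ripC ripNl ripC. Qed.

Lemma ripBl x y z : rip (x - y) z = rip x z - rip y z.
Proof. by rewrite ripDl ripNl. Qed.

Lemma ripBr x y z : rip x (y - z) = rip x y - rip x z.
Proof. by rewrite ripDr ripNr. Qed.

Lemma rip0l y : rip 0 y = 0.
Proof. by rewrite -(subrr (0 : E)) ripBl subrr. Qed.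

Lemma rip0r y : rip y 0 = 0.
Proof. by rewrite ripC rip0l. Qed.

Lemma rip_inj x y : (forall z, rip x z = rip y z) -> x = y.
Proof.
move=> xy; apply/eqP; rewrite -subr_eq0; apply/eqP/rip_eq0.
by rewrite ripBl xy subrr.
Qed.

Lemma cauchy_schwarz x y : rip x y <= hnorm x * hnorm y.
Proof.
have [x0|x0] := eqVneq (rip x x) 0.
  by rewrite (rip_eq0 x0) rip0l mulr_ge0 ?hnorm_ge0.
have xp : 0 < rip x x by rewrite lt_neqAle eq_sym x0 rip_ge0.
have : rip x y ^+ 2 <= rip x x * rip y y.
  have := rip_ge0 (y - (rip x y / rip x x)%:C *: x).
  rewrite ripBl !ripBr !ripZr !ripZrr (ripC y x) divfK // => h.
  have : 0 <= rip x x * (rip y y - rip x y / rip x x * rip x y).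
    apply: mulr_ge0; first exact: rip_ge0.
    by move: h; lra.
  by rewrite mulrBr mulrA mulrCA divff // mulr1; lra.
move=> h; apply: le_trans (ler_norm _) _.
by rewrite -sqrtr_sqr /hnorm -sqrtrM ?rip_ge0 // ler_wsqrtr.
Qed.

Lemma norm_rip x y : `|rip x y| <= hnorm x * hnorm y.
Proof.
rewrite ler_norml cauchy_schwarz andbT lerNl -ripNl.
apply: le_trans (cauchy_schwarz _ _) _.
by rewrite /hnorm ripNl ripNr opprK.
Qed.

Lemma hnormN x : hnorm (- x) = hnorm x.
Proof. by rewrite /hnorm ripNl ripNr opprK. Qed.

Lemma hnorm0 : hnorm 0 = 0.
Proof. by rewrite /hnorm rip0l sqrtr0. Qed.

Lemma hnormD x y : hnorm (x + y) <= hnorm x + hnorm y.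
Proof.
rewrite -(@ler_pXn2r _ 2) // ?nnegrE ?addr_ge0 ?hnorm_ge0 //.
rewrite hnorm_sqr ripDl !ripDr sqrrD !hnorm_sqr (ripC y x) mulr2n.
by have := cauchy_schwarz x y; lra.
Qed.

Lemma hnormZ (c : R[i]) x : hnorm (c *: x) = complex.Re `|c| * hnorm x.
Proof.
rewrite /hnorm ripZ scalerA.
have -> : c^* * c = ((complex.Re `|c|) ^+ 2)%:C.
  rewrite normc_def /= sqr_sqrtr ?addr_ge0 ?sqr_ge0 //.
  case: c => a b; apply/eqP; rewrite eq_complex /= !expr2.
  by apply/andP; split; apply/eqP; ring.
rewrite ripZrr sqrtrM ?sqr_ge0 // sqrtr_sqr ger0_norm //.
by rewrite normc_def /= sqrtr_ge0.
Qed.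

Lemma hnorm_eq0 x : hnorm x = 0 -> x = 0.
Proof. by move=> x0; apply: rip_eq0; rewrite -hnorm_sqr x0 expr0n. Qed.

Lemma hnorm_rip_le x (k : R) : 0 <= k ->
  (forall y, rip x y <= k * hnorm y) -> hnorm x <= k.
Proof.
move=> k0 h; have [x0|x0] := eqVneq (hnorm x) 0; first by rewrite x0.
have xp : 0 < hnorm x by rewrite lt_neqAle eq_sym x0 hnorm_ge0.
by have := h x; rewrite -hnorm_sqr expr2 ler_pM2r.
Qed.

Lemma hnorm_complete (v : nat -> E) :
  (forall e : R, 0 < e -> exists N, forall m n, (N <= m)%N -> (N <= n)%N ->
     hnorm (v m - v n) < e) ->
  exists l, forall e : R, 0 < e -> exists N, forall n, (N <= n)%N ->
     hnorm (v n - l) < e.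
Proof.
move=> h; have [|l hl] := @hcomplete R E v.
  move=> e e0; have se0 : 0 < Num.sqrt e by rewrite sqrtr_gt0.
  have [N hN] := h _ se0; exists N => m n Nm Nn.
  by rewrite -ltr_sqrt //; apply: hN.
exists l => e e0; have se0 : 0 < e ^+ 2 by rewrite exprn_gt0.
have [N hN] := hl _ se0; exists N => n Nn.
have := hN n Nn; rewrite -hnorm_sqr ltr_pXn2r // nnegrE ?hnorm_ge0 //.
exact: ltW.
Qed.

End HilbertNorm.
Arguments hnorm {R E} x.

Section BoundedOperators.
Context (R : realType) (E : hilbert R).
Implicit Types x y z : E.

(** An operator carries its adjoint, so that none has to be produced by a representation theorem.
    Additivity follows from the existence of an adjoint; homogeneity is demanded because adjointness
    for [rip], a real part, gives only real linearity. *)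
Definition adjoint_pair (T : (E -> E) * (E -> E)) : Prop :=
  [/\ forall x y, rip (T.1 x) y = rip x (T.2 y),
      forall (c : R[i]) x, T.1 (c *: x) = c *: T.1 x
    & exists k : R, forall x, hnorm (T.1 x) <= k * hnorm x].

Record bop := Bop { bpair :> ((E -> E) * (E -> E))%type ;
                    bpairP : `[< adjoint_pair bpair >] }.
HB.instance Definition _ := [isSub of bop for bpair].
HB.instance Definition _ := gen_eqMixin bop.
HB.instance Definition _ := gen_choiceMixin bop.

Definition app (T : bop) : E -> E := (T : _ * _).1.
Definition adj (T : bop) : E -> E := (T : _ * _).2.

Lemma app_adj (T : bop) x y : rip (app T x) y = rip x (adj T y).
Proof. by case: T => T i; case/asboolP: (i) => h _ _; exact: h. Qed.

Lemma app_bounded (T : bop) :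
  exists2 k : R, 0 <= k & forall x, hnorm (app T x) <= k * hnorm x.
Proof.
case: T => T i; have /asboolP[_ _ [k hk]] := i.
exists `|k| => // x; apply: le_trans (hk x) _.
by rewrite ler_wpM2r ?hnorm_ge0 // ler_norm.
Qed.

(** The adjoint is determined by the operator, since [rip] is nondegenerate. *)
Lemma bop_ext (T U : bop) : app T =1 app U -> T = U.
Proof.
move=> TU; apply: val_inj => /=.
case: T TU => [[T T'] i]; case: U => [[U U'] j]; rewrite /app /= => TU.
congr pair; apply/funext => y; first exact: TU.
apply: rip_inj => z; rewrite !(ripC _ z).
rewrite -[T']/(adj (Bop i)) -[U']/(adj (Bop j)) -!app_adj.
by rewrite /app /= TU.
Qed.

Section AppLinear.
Variable T : bop.
Lemma appD x y : app T (x + y) = app T x + app T y.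
Proof. by apply: rip_inj => z; rewrite ripDl !app_adj ripDl. Qed.
Lemma appZ (c : R[i]) x : app T (c *: x) = c *: app T x.
Proof. by case: T => U i; case/asboolP: (i) => _ h _; exact: h. Qed.
Lemma adjZ (c : R[i]) x : adj T (c *: x) = c *: adj T x.
Proof.
apply: rip_inj => z; rewrite ripC -app_adj ripC ripZ ripC -appZ app_adj.
by rewrite ripC -ripZ ripC.
Qed.
End AppLinear.

Lemma adjoint_pairP (T U : E -> E) :
  (forall x y, rip (T x) y = rip x (U y)) ->
  (forall (c : R[i]) x, T (c *: x) = c *: T x) ->
  (exists k : R, forall x, hnorm (T x) <= k * hnorm x) ->
  `[< adjoint_pair (T, U) >].
Proof. by move=> *; apply/asboolP; split. Qed.

Lemma adj_bounded (T : bop) (k : R) : 0 <= k ->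
  (forall x, hnorm (app T x) <= k * hnorm x) ->
  forall x, hnorm (adj T x) <= k * hnorm x.
Proof.
move=> k0 hk x; apply: hnorm_rip_le => [|y]; first by rewrite mulr_ge0 ?hnorm_ge0.
rewrite ripC -app_adj; apply: le_trans (cauchy_schwarz _ _) _.
by rewrite mulrAC ler_wpM2r ?hnorm_ge0.
Qed.

Fact bop0P : `[< adjoint_pair (fun=> 0, fun=> 0) >].
Proof.
apply: adjoint_pairP => [x y|c x|]; rewrite ?rip0l ?rip0r ?scaler0 //.
by exists 0 => x; rewrite hnorm0 mul0r.
Qed.
Definition bop0 := Bop bop0P.

Fact bopDP (T U : bop) :
  `[< adjoint_pair (fun x => app T x + app U x, fun x => adj T x + adj U x) >].
Proof.
apply: adjoint_pairP => [x y|c x|]; first by rewrite ripDl ripDr !app_adj.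
  by rewrite !appZ scalerDr.
have [k k0 hk] := app_bounded T; have [l l0 hl] := app_bounded U.
by exists (k + l) => x; rewrite mulrDl (le_trans (hnormD _ _)) // lerD.
Qed.
Definition bopD T U := Bop (bopDP T U).

Fact bopNP (T : bop) :
  `[< adjoint_pair (fun x => - app T x, fun x => - adj T x) >].
Proof.
apply: adjoint_pairP => [x y|c x|]; first by rewrite ripNl ripNr app_adj.
  by rewrite appZ scalerN.
by have [k k0 hk] := app_bounded T; exists k => x; rewrite hnormN.
Qed.
Definition bopN T := Bop (bopNP T).

Fact bop1P : `[< adjoint_pair (id, id) >].
Proof. by apply: adjoint_pairP => //; exists 1 => x; rewrite mul1r. Qed.
Definition bop1 := Bop bop1P.

Fact bopMP (T U : bop) :
  `[< adjoint_pair (app T \o app U, adj U \o adj T) >].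
Proof.
apply: adjoint_pairP => [x y|c x|] /=; first by rewrite !app_adj.
  by rewrite !appZ.
have [k k0 hk] := app_bounded T; have [l l0 hl] := app_bounded U.
exists (k * l) => x; apply: le_trans (hk _) _.
by rewrite -mulrA ler_wpM2l.
Qed.
Definition bopM T U := Bop (bopMP T U).

Fact bopZP (c : R[i]) (T : bop) :
  `[< adjoint_pair (fun x => c *: app T x, fun x => c^* *: adj T x) >].
Proof.
apply: adjoint_pairP => [x y|d x|]; first by rewrite ripZ app_adj adjZ.
  by rewrite appZ !scalerA mulrC.
have [k k0 hk] := app_bounded T.
exists (complex.Re `|c| * k) => x; rewrite hnormZ -mulrA ler_wpM2l //.
by rewrite normc_def sqrtr_ge0.
Qed.
Definition bopZ c T := Bop (bopZP c T).

Fact bop_starP (T : bop) : `[< adjoint_pair (adj T, app T) >].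
Proof.
apply: adjoint_pairP => [x y|c x|]; first by rewrite ripC -app_adj ripC.
  exact: adjZ.
have [k k0 hk] := app_bounded T.
by exists k; apply: adj_bounded.
Qed.
Definition bop_star T := Bop (bop_starP T).

Fact bopDA : associative bopD.
Proof. by move=> T U V; apply: bop_ext => x; apply: addrA. Qed.
Fact bopDC : commutative bopD.
Proof. by move=> T U; apply: bop_ext => x; apply: addrC. Qed.
Fact bop0D : left_id bop0 bopD.
Proof. by move=> T; apply: bop_ext => x; apply: add0r. Qed.
Fact bopND : left_inverse bop0 bopN bopD.
Proof. by move=> T; apply: bop_ext => x; apply: addNr. Qed.
HB.instance Definition _ := GRing.isZmodule.Build bop bopDA bopDC bop0D bopND.

Fact bopMA : associative bopM.
Proof. by move=> T U V; apply: bop_ext. Qed.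
Fact bop1M : left_id bop1 bopM.
Proof. by move=> T; apply: bop_ext. Qed.
Fact bopM1 : right_id bop1 bopM.
Proof. by move=> T; apply: bop_ext. Qed.
Fact bopMDl : left_distributive bopM bopD.
Proof. by move=> T U V; apply: bop_ext. Qed.
Fact bopMDr : right_distributive bopM bopD.
Proof. by move=> T U V; apply: bop_ext => x; apply: appD. Qed.
Fact bop1_neq0 : bop1 != 0.
Proof.
have [x x0] := hnontrivial E; apply: contra_neq x0 => /(congr1 app).
by move/(congr1 (@^~ x)).
Qed.
HB.instance Definition _ := GRing.Zmodule_isNzRing.Build bop
  bopMA bop1M bopM1 bopMDl bopMDr bop1_neq0.

Fact bopZA (c d : R[i]) T : bopZ c (bopZ d T) = bopZ (c * d) T.
Proof. by apply: bop_ext => x; apply: scalerA. Qed.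
Fact bop1Z : left_id 1 bopZ.
Proof. by move=> T; apply: bop_ext => x; apply: scale1r. Qed.
Fact bopZDr : right_distributive bopZ +%R.
Proof. by move=> c T U; apply: bop_ext => x; apply: scalerDr. Qed.
Fact bopZDl T : {morph bopZ^~ T : c d / c + d}.
Proof. by move=> c d; apply: bop_ext => x; apply: scalerDl. Qed.
HB.instance Definition _ := GRing.Zmodule_isLmodule.Build R[i] bop
  bopZA bop1Z bopZDr bopZDl.

Fact bopZAl (c : R[i]) (T U : bop) : c *: (T * U) = (c *: T) * U.
Proof. exact: bop_ext. Qed.
HB.instance Definition _ := GRing.Lmodule_isLalgebra.Build R[i] bop bopZAl.
Fact bopZAr (c : R[i]) (T U : bop) : c *: (T * U) = T * (c *: U).
Proof. by apply: bop_ext => x; rewrite /app /= -/(app T _) appZ. Qed.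
HB.instance Definition _ := GRing.Lalgebra_isAlgebra.Build R[i] bop bopZAr.

Definition opnorm (T : bop) : R := sup [set hnorm (app T x) | x in [set x | hnorm x <= 1]].

Lemma opnorm_has_sup T : has_sup [set hnorm (app T x) | x in [set x | hnorm x <= 1]].
Proof.
split; first by exists (hnorm (app T 0)), 0 => //=; rewrite hnorm0.
have [k k0 hk] := app_bounded T.
exists k => _ [x /= x1 <-]; apply: le_trans (hk x) _.
by rewrite ler_piMr.
Qed.

Lemma opnorm_ge0 T : 0 <= opnorm T.
Proof.
apply: le_trans (hnorm_ge0 (app T 0)) _; apply: sup_upper_bound.
  exact: opnorm_has_sup.
by exists 0 => //=; rewrite hnorm0.
Qed.

Lemma opnorm_bound T x : hnorm (app T x) <= opnorm T * hnorm x.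
Proof.
have [x0|x0] := eqVneq (hnorm x) 0.
  rewrite x0 mulr0 (hnorm_eq0 x0) -(scale0r (0 : E)) appZ scale0r hnorm0.
  by [].
have xp : 0 < hnorm x by rewrite lt_neqAle eq_sym x0 hnorm_ge0.
rewrite -ler_pdivrMr //; apply: sup_upper_bound; first exact: opnorm_has_sup.
have nV : complex.Re `|((hnorm x)^-1)%:C| = (hnorm x)^-1.
  by rewrite normc_def /= expr0n addr0 sqrtr_sqr ger0_norm // invr_ge0 hnorm_ge0.
exists (((hnorm x)^-1)%:C *: x) => /=; rewrite ?appZ hnormZ nV ?mulVf //.
by rewrite mulrC.
Qed.

Lemma opnorm_le T (k : R) : 0 <= k ->
  (forall x, hnorm (app T x) <= k * hnorm x) -> opnorm T <= k.
Proof.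
move=> k0 hk; apply: ge_sup => [|_ [x /= x1 <-]].
  by case: (opnorm_has_sup T).
by apply: le_trans (hk x) _; rewrite ler_piMr.
Qed.

Fact opnorm_eq0 T : opnorm T = 0 -> T = 0.
Proof.
move=> T0; apply: bop_ext => x; apply: hnorm_eq0; apply/eqP.
rewrite eq_le hnorm_ge0 andbT; apply: le_trans (opnorm_bound T x) _.
by rewrite T0 mul0r.
Qed.

Fact opnormD T U : opnorm (T + U) <= opnorm T + opnorm U.
Proof.
apply: opnorm_le => [|x]; first by rewrite addr_ge0 ?opnorm_ge0.
by rewrite mulrDl (le_trans (hnormD _ _)) // lerD ?opnorm_bound.
Qed.

Lemma opnormZ_le (c : R[i]) T : opnorm (c *: T) <= complex.Re `|c| * opnorm T.
Proof.
apply: opnorm_le => [|x].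
  by rewrite mulr_ge0 ?opnorm_ge0 // normc_def sqrtr_ge0.
rewrite hnormZ -mulrA ler_wpM2l ?opnorm_bound //.
by rewrite normc_def sqrtr_ge0.
Qed.

Fact opnormZ (c : R[i]) T : (opnorm (c *: T))%:C = `|c| * (opnorm T)%:C.
Proof.
have cE : `|c| = (complex.Re `|c|)%:C by rewrite normc_def.
rewrite cE -[RHS](rmorphM (real_complex R)); congr (_%:C); apply/eqP; rewrite eq_le opnormZ_le andTb.
have [->|c0] := eqVneq c 0; first by rewrite normr0 mul0r opnorm_ge0.
have := opnormZ_le c^-1 (c *: T); rewrite scalerA mulVf // scale1r.
have cp : 0 < complex.Re `|c|.
  by rewrite -ltcR -cE normr_gt0.
have -> : complex.Re `|c^-1| = (complex.Re `|c|)^-1.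
  have rE (d : R[i]) : (complex.Re `|d|)%:C = `|d| by rewrite normc_def.
  by apply: complexI; rewrite [RHS](fmorphV (real_complex R)) !rE normfV.
by rewrite ler_pdivlMl.
Qed.

Fact opnormM T U : opnorm (T * U) <= opnorm T * opnorm U.
Proof.
apply: opnorm_le => [|x]; first by rewrite mulr_ge0 ?opnorm_ge0.
apply: le_trans (opnorm_bound T _) _.
by rewrite -mulrA ler_wpM2l ?opnorm_ge0 ?opnorm_bound.
Qed.

Lemma opnorm_star_le T : opnorm (bop_star T) <= opnorm T.
Proof.
apply: opnorm_le => [|x]; first exact: opnorm_ge0.
by apply: adj_bounded; [exact: opnorm_ge0 | exact: opnorm_bound].
Qed.

Fact opnorm_star T : opnorm (bop_star T * T) = opnorm T ^+ 2.
Proof.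
apply/eqP; rewrite eq_le; apply/andP; split.
  rewrite expr2; apply: le_trans (opnormM _ _) _.
  by rewrite ler_wpM2r ?opnorm_ge0 ?opnorm_star_le.
have s0 := opnorm_ge0 (bop_star T * T).
rewrite -(sqr_sqrtr s0) ler_pXn2r ?nnegrE ?sqrtr_ge0 ?opnorm_ge0 //.
apply: opnorm_le => [|x]; first exact: sqrtr_ge0.
rewrite -(@ler_pXn2r _ 2) ?nnegrE ?mulr_ge0 ?sqrtr_ge0 ?hnorm_ge0 //.
rewrite exprMn (sqr_sqrtr s0) hnorm_sqr app_adj expr2.
apply: le_trans (cauchy_schwarz _ _) _; rewrite mulrC mulrA.
by rewrite ler_wpM2r ?hnorm_ge0 //; apply: (opnorm_bound (bop_star T * T)).
Qed.

Fact opnorm_complete (v : nat -> bop) :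
  (forall e : R, 0 < e -> exists N, forall m n, (N <= m)%N -> (N <= n)%N ->
     opnorm (v m - v n) < e) ->
  exists l : bop, forall e : R, 0 < e -> exists N, forall n, (N <= n)%N ->
     opnorm (v n - l) < e.
Proof.
move=> vC.
have vxC x : forall e : R, 0 < e -> exists N, forall m n, (N <= m)%N ->
    (N <= n)%N -> hnorm (app (v m) x - app (v n) x) < e.
  move=> e e0; have x1 : 0 < hnorm x + 1 by rewrite ltr_wpDl ?hnorm_ge0.
  have [N hN] := vC (e / (hnorm x + 1)) (divr_gt0 e0 x1).
  exists N => m n Nm Nn; have := hN m n Nm Nn; rewrite ltr_pdivlMr //.
  apply: le_lt_trans; apply: le_trans (opnorm_bound (v m - v n) x) _.
  by rewrite ler_wpM2l ?opnorm_ge0 // lerDl.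
have vsC x : forall e : R, 0 < e -> exists N, forall m n, (N <= m)%N ->
    (N <= n)%N -> hnorm (adj (v m) x - adj (v n) x) < e.
  move=> e e0; have x1 : 0 < hnorm x + 1 by rewrite ltr_wpDl ?hnorm_ge0.
  have [N hN] := vC (e / (hnorm x + 1)) (divr_gt0 e0 x1).
  exists N => m n Nm Nn; have := hN m n Nm Nn; rewrite ltr_pdivlMr //.
  apply: le_lt_trans.
  have := @adj_bounded (v m - v n) _ (opnorm_ge0 _) (opnorm_bound _) x.
  move=> h; apply: le_trans h _.
  by rewrite ler_wpM2l ?opnorm_ge0 // lerDl.
(* Pointwise limits of the operators and of their adjoints are taken side by side; the second
   becomes the adjoint of the first. *)
have [T hT] := choice (fun x => hnorm_complete (vxC x)).
have [S hS] := choice (fun x => hnorm_complete (vsC x)).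
have small (a : R) : (forall e : R, 0 < e -> a <= e) -> a <= 0.
  by move=> h; apply/ler_addgt0Pr => e e0; rewrite add0r; apply: h.
(* [N] depends on [e] only: the comparison with [T x] passes through a later index, which may depend
   on [x]. *)
have bnd e : 0 < e -> exists N, forall n x, (N <= n)%N ->
    hnorm (app (v n) x - T x) <= e * hnorm x.
  move=> e0; have [N hN] := vC e e0; exists N => n x Nn.
  apply/ler_addgt0Pr => d d0; have [M hM] := hT x d d0.
  have -> : app (v n) x - T x = app (v n - v (maxn N M)) x +
      (app (v (maxn N M)) x - T x) by rewrite addrA subrK.
  apply: le_trans (hnormD _ _) _; apply: lerD; last first.
    by apply: ltW; apply: hM; rewrite leq_maxr.
  apply: le_trans (opnorm_bound _ _) _; rewrite ler_wpM2r ?hnorm_ge0 //.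
  by apply: ltW; apply: hN; rewrite ?leq_maxl.
have lP : `[< adjoint_pair (T, S) >].
  apply: adjoint_pairP => [x y|c x|].
  - apply/eqP; rewrite -subr_eq0 -normr_le0; apply: small => e e0.
    have x1 : 0 < hnorm x + hnorm y + 1.
      by rewrite ltr_wpDl ?addr_ge0 ?hnorm_ge0.
    have [N hN] := hT x _ (divr_gt0 e0 x1).
    have [M hM] := hS y _ (divr_gt0 e0 x1).
    set n := maxn N M.
    have -> : rip (T x) y - rip x (S y) =
        - rip (app (v n) x - T x) y + rip x (adj (v n) y - S y).
      by rewrite ripBl ripBr app_adj; ring.
    apply: le_trans (ler_normD _ _) _; rewrite normrN.
    apply: (@le_trans _ _ (e / (hnorm x + hnorm y + 1) * hnorm y +
                          hnorm x * (e / (hnorm x + hnorm y + 1)))).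
      apply: lerD; apply: le_trans (norm_rip _ _) _.
        by rewrite ler_wpM2r ?hnorm_ge0 // ltW // hN // leq_maxl.
      by rewrite ler_wpM2l ?hnorm_ge0 // ltW // hM // leq_maxr.
    rewrite (mulrC (e / _)) -mulrDl mulrA ler_pdivrMr // mulrC ler_pM2l //.
    by rewrite [hnorm y + _]addrC lerDl.
  - apply/eqP; rewrite -subr_eq0; apply/eqP/hnorm_eq0/eqP.
    rewrite eq_le hnorm_ge0 andbT; apply: small => e e0.
    have cp : 0 < complex.Re `|c| + 1.
      by rewrite ltr_wpDl // normc_def sqrtr_ge0.
    have [N hN] := hT (c *: x) (e / 2) (divr_gt0 e0 (ltr0Sn _ _)).
    have [M hM] := hT x (e / 2 / (complex.Re `|c| + 1))
       (divr_gt0 (divr_gt0 e0 (ltr0Sn _ _)) cp).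
    set n := maxn N M.
    have -> : T (c *: x) - c *: T x = - (app (v n) (c *: x) - T (c *: x)) +
        c *: (app (v n) x - T x).
      by rewrite appZ scalerBr opprB addrA subrK.
    apply: le_trans (hnormD _ _) _; rewrite hnormN hnormZ [e in _ <= e]splitr.
    apply: lerD; first by rewrite ltW // hN // leq_maxl.
    have /ltW := hM n (leq_maxr _ _); rewrite ler_pdivlMr // mulrC.
    by apply: le_trans; rewrite ler_wpM2r ?hnorm_ge0 // lerDl.
  - have [N hN] := bnd 1 ltr01; exists (opnorm (v N) + 1) => x.
    have -> : T x = app (v N) x - (app (v N) x - T x).
      by rewrite opprB addrC subrK.
    apply: le_trans (hnormD _ _) _; rewrite hnormN mulrDl lerD ?opnorm_bound //.
    exact: hN.
exists (Bop lP) => e e0; have [N hN] := bnd (e / 2) (divr_gt0 e0 (ltr0Sn _ _)).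
exists N => n Nn; apply: (@le_lt_trans _ _ (e / 2)); last first.
  by rewrite ltr_pdivrMr // mulr_natr mulr2n ltrDl.
apply: opnorm_le => [|x]; first by rewrite divr_ge0 // ltW.
exact: hN.
Qed.

Fact bop_starD (T U : bop) : bop_star (T + U) = bop_star T + bop_star U.
Proof. exact: bop_ext. Qed.
Fact bop_starZ (c : R[i]) (T : bop) : bop_star (c *: T) = c^* *: bop_star T.
Proof. exact: bop_ext. Qed.
Fact bop_starM (T U : bop) : bop_star (T * U) = bop_star U * bop_star T.
Proof. exact: bop_ext. Qed.
Fact bop_starK (T : bop) : bop_star (bop_star T) = T.
Proof. exact: bop_ext. Qed.

HB.instance Definition _ := isCStar.Build R bop bop_starD bop_starZ bop_starM
  bop_starK opnorm_eq0 opnormD opnormZ opnormM opnorm_star opnorm_complete.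

End BoundedOperators.

(** * Square-summable functions satisfying linear equations *)

Lemma real_complete (R : realType) (v : nat -> R) :
  (forall e : R, 0 < e -> exists N, forall m n, (N <= m)%N -> (N <= n)%N ->
     `|v m - v n| < e) ->
  exists l : R, v @ \oo --> l.
Proof.
move=> h; suff vc : cvg (v @ \oo) by exists (lim (v @ \oo)).
apply/cauchy_cvgP/cauchy_ballP => e e0.
have [N hN] := h e e0.
pose V := v @` [set n | (N <= n)%N]; exists (V, V) => /=.
  by split; exists N => // n /= nN; exists n.
by move=> [_ _] [/= [m mN <-] [n nN <-]]; apply: hN.
Qed.

Lemma cvg_sumr (R : realType) (T I : Type) (F : set_system T) (FF : Filter F)
    (r : seq I) (f : I -> T -> R) (l : I -> R) :
  (forall i, f i @ F --> l i) ->
  (fun n => \sum_(i <- r) f i n) @ F --> \sum_(i <- r) l i.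
Proof.
move=> h; elim: r => [|i r IHr].
  by rewrite big_nil; under eq_fun do rewrite big_nil; apply: cvg_cst.
by rewrite big_cons; under eq_fun do rewrite big_cons; apply: cvgD.
Qed.

Section SquareSummable.
Context (R : realType) (X : eqType) (S : nat -> seq X) (Eq : set (seq X)).
Local Notation C := R[i].
Implicit Types f g : X -> C.

Definition rdot (a b : C) : R :=
  complex.Re a * complex.Re b + complex.Im a * complex.Im b.

Definition l2part (K : nat) f g : R :=
  \sum_(k < K) \sum_(x <- S k) rdot (f x) (g x).

(** [S k] lists the points of level k, and each list in [Eq] is a set of points over which the
    values add up to 0. Such finite equations survive pointwise limits, so the solution space is
    complete without any orthogonal projection. *)
Definition l2sub f : Prop :=
  (forall s, Eq s -> \sum_(x <- s) f x = 0) /\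
  exists M : R, forall K, l2part K f f <= M.

Lemma l2partD K f f' g : l2part K (f + f') g = l2part K f g + l2part K f' g.
Proof.
rewrite /l2part -big_split; apply: eq_bigr => k _; rewrite -big_split.
by apply: eq_bigr => x _; rewrite /rdot !fctE !raddfD !mulrDl addrACA.
Qed.

Lemma l2partC K f g : l2part K f g = l2part K g f.
Proof.
apply: eq_bigr => k _; apply: eq_bigr => x _.
by rewrite /rdot mulrC [X in _ + X]mulrC.
Qed.

Lemma l2partZr K (r : R) f g : l2part K (r%:C *: f) g = r * l2part K f g.
Proof.
rewrite /l2part mulr_sumr; apply: eq_bigr => k _.
rewrite mulr_sumr; apply: eq_bigr => x _; rewrite /rdot !fctE.
by case: (f x) => a b; rewrite /= !mul0r subr0 addr0 mulrDr !mulrA.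
Qed.

Lemma l2partZ K (c : C) f g : l2part K (c *: f) g = l2part K f (c^* *: g).
Proof.
apply: eq_bigr => k _; apply: eq_bigr => x _; rewrite /rdot !fctE.
by case: (f x) (g x) c => a b [a' b'] [a'' b'']; rewrite /=; ring.
Qed.

Lemma rdot_ge0 a : 0 <= rdot a a.
Proof. by rewrite addr_ge0 // -expr2 sqr_ge0. Qed.

Lemma l2part_ge0 K f : 0 <= l2part K f f.
Proof. by apply: sumr_ge0 => k _; apply: sumr_ge0 => x _; apply: rdot_ge0. Qed.

Lemma l2part_nd f : {homo (fun K => l2part K f f) : m n / (m <= n)%N >-> m <= n}.
Proof.
apply: homo_leq => [//|m n p|K]; first exact: le_trans.
rewrite /l2part big_ord_recr /= lerDl.
by apply: sumr_ge0 => x _; apply: rdot_ge0.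
Qed.

Lemma l2partB K f g : l2part K (f + g) (f + g) + l2part K (f - g) (f - g) =
  2 * (l2part K f f + l2part K g g).
Proof.
have -> : f - g = f + (-1)%:C *: g by rewrite rmorphN1 scaleN1r.
rewrite !l2partD !(l2partC K _ (_ + _)) !l2partD !l2partZr.
by rewrite !(l2partC K _ (_ *: _)) !l2partZr (l2partC K g f); ring.
Qed.

Definition l2pred : {pred X -> C} := fun f => `[< l2sub f >].

Fact l2sub_closed : submod_closed l2pred.
Proof.
split; first apply/asboolP; first split => [s _|].
- by rewrite big1.
- exists 0 => K; rewrite /l2part big1 // => k _; rewrite big1 // => x _.
  by rewrite /rdot /= !mul0r addr0.
move=> c f g /asboolP[ef [M hM]] /asboolP[eg [N hN]]; apply/asboolP; split.
  move=> s Es; rewrite big_split /= eg // addr0.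
  transitivity (c * \sum_(x <- s) f x).
    by rewrite mulr_sumr.
  by rewrite ef // mulr0.
exists (2 * ((complex.Re `|c|) ^+ 2 * M + N)) => K.
apply: (@le_trans _ _ (2 * (l2part K (c *: f) (c *: f) + l2part K g g))).
  by rewrite -l2partB lerDl l2part_ge0.
rewrite ler_pM2l // lerD //.
have -> : l2part K (c *: f) (c *: f) = (complex.Re `|c|) ^+ 2 * l2part K f f.
  rewrite l2partZ scalerA -l2partZr [RHS]l2partC; congr (l2part _ _ (_ *: _)).
  rewrite normc_def /= sqr_sqrtr ?addr_ge0 ?sqr_ge0 //.
  case: c => a b; apply/eqP; rewrite eq_complex /= !expr2.
  by apply/andP; split; apply/eqP; ring.
by rewrite ler_wpM2l // sqr_ge0.
Qed.

Record l2 := L2 { l2fun :> X -> C ; l2P : l2fun \in l2pred }.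
HB.instance Definition _ := [isSub of l2 for l2fun].
HB.instance Definition _ := gen_eqMixin l2.
HB.instance Definition _ := gen_choiceMixin l2.
HB.instance Definition _ := GRing.isSubmodClosed.Build _ _
  l2pred l2sub_closed.
HB.instance Definition _ := [SubChoice_isSubLmodule of l2 by <:].

End SquareSummable.

Section Hilbert.
Context (R : realType) (X : eqType) (S : nat -> seq X) (Eq : set (seq X)).
Hypothesis cover : forall x, Eq [:: x] \/ exists k, x \in S k.
Hypothesis nontriv : exists2 f : X -> R[i], l2sub S Eq f & exists x, f x != 0.
Local Notation C := R[i].
Local Notation E := (l2 R S Eq).
Implicit Types f g h : E.
Local Notation part f g := (fun K => l2part S K f g).

Definition l2rip f g : R := lim (part f g @ \oo).

Lemma l2_eq f (s : seq X) : Eq s -> \sum_(x <- s) f x = 0.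
Proof. by case: f => f i /=; have /asboolP[h _] := i; apply: h. Qed.

Lemma l2_cvg_diag f : cvg (part f f @ \oo).
Proof.
case: f => f i /=; have /asboolP[_ [M hM]] := i.
apply: nondecreasing_is_cvgn; first exact: l2part_nd.
by exists M => _ [K _ <-].
Qed.

(** Polarization: the diagonal partial sums converge, being monotone and bounded. *)
Lemma l2_cvg f g : part f g @ \oo --> l2rip f g.
Proof.
suff : cvg (part f g @ \oo) by [].
have -> : part f g = (fun K => 2^-1 * (l2part S K (f + g) (f + g) -
    l2part S K f f - l2part S K g g)).
  apply/funext => K /=; rewrite l2partD !(l2partC _ K _ (_ + _)) !l2partD.
  by rewrite (l2partC _ K g f); field.
apply: is_cvgM; first exact: is_cvg_cst.
apply: is_cvgB; last exact: l2_cvg_diag.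
apply: is_cvgB; last exact: l2_cvg_diag.
exact: (@l2_cvg_diag (f + g)).
Qed.

Lemma l2ripC f g : l2rip f g = l2rip g f.
Proof.
rewrite /l2rip; suff -> : part f g = part g f by [].
by apply/funext => K; apply: l2partC.
Qed.

Lemma l2ripDl f g h : l2rip (f + g) h = l2rip f h + l2rip g h.
Proof.
apply/cvg_lim => //.
have -> : part (f + g) h = part f h \+ part g h.
  by apply/funext => K; rewrite /= l2partD.
by apply: cvgD; apply: l2_cvg.
Qed.

Lemma l2ripZr (r : R) f g : l2rip (r%:C *: f) g = r * l2rip f g.
Proof.
apply/cvg_lim => //.
have -> : part (r%:C *: f) g = fun K => r * l2part S K f g.
  by apply/funext => K; rewrite /= l2partZr.
by apply: cvgMl_tmp; apply: l2_cvg.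
Qed.

Lemma l2ripZ (c : C) f g : l2rip (c *: f) g = l2rip f (c^* *: g).
Proof.
rewrite /l2rip; suff -> : part (c *: f) g = part f (c^* *: g) by [].
by apply/funext => K; apply: l2partZ.
Qed.

Lemma l2part_le f K : l2part S K f f <= l2rip f f.
Proof.
apply: nondecreasing_cvgn_le; first exact: l2part_nd.
exact: l2_cvg_diag.
Qed.

Lemma l2rip_ge0 f : 0 <= l2rip f f.
Proof. by apply: le_trans (l2part_le f 0); apply: l2part_ge0. Qed.

Lemma rdot_le f k x : x \in S k -> rdot (f x) (f x) <= l2rip f f.
Proof.
move=> xk; apply: le_trans (l2part_le f k.+1).
rewrite /l2part big_ord_recr /=; apply: ler_wpDl.
  by apply: sumr_ge0 => j _; apply: sumr_ge0 => y _; apply: rdot_ge0.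
rewrite (big_rem x) //= lerDl; apply: sumr_ge0 => y _; apply: rdot_ge0.
Qed.

Lemma rdot_eq0 (a : C) : rdot a a <= 0 -> a = 0.
Proof.
case: a => a b; rewrite /rdot /= => h.
have := sqr_ge0 a; have := sqr_ge0 b; rewrite !expr2 => hb ha.
have /eqP : a * a = 0 by apply/eqP; rewrite eq_le; apply/andP; split; lra.
have /eqP : b * b = 0 by apply/eqP; rewrite eq_le; apply/andP; split; lra.
by rewrite !mulf_eq0 !orbb => /eqP -> /eqP ->.
Qed.

Lemma l2rip_eq0 f : l2rip f f = 0 -> f = 0.
Proof.
move=> f0; apply: val_inj; apply/funext => x /=.
have [/l2_eq|[k xk]] := cover x; first by move=> /(_ f); rewrite big_seq1.
by apply: rdot_eq0; rewrite -f0 (rdot_le _ xk).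
Qed.

Lemma l2_ext f g : (f : X -> C) =1 g -> f = g.
Proof. by move=> fg; apply: val_inj; apply/funext. Qed.

Lemma norm_Re_rdot (a : C) (e : R) : 0 <= e -> rdot a a < e ^+ 2 -> `|complex.Re a| < e.
Proof.
case: a => a b; rewrite /rdot /= => e0 h; rewrite -sqrtr_sqr -(ger0_norm e0) -sqrtr_sqr.
have := sqr_ge0 b; rewrite ltr_sqrt ?exprn_gt0 // ?lt_neqAle.
  by rewrite !expr2 in h *; lra.
rewrite e0 andbT eq_sym; apply: contraTneq h => ->.
by rewrite -leNgt expr0n addr_ge0 // -expr2 sqr_ge0.
Qed.

Lemma norm_Im_rdot (a : C) (e : R) : 0 <= e -> rdot a a < e ^+ 2 -> `|complex.Im a| < e.
Proof.
move=> e0 h; apply: (@norm_Re_rdot (complex.Im a +i* complex.Re a)) => //.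
by rewrite /rdot /= addrC.
Qed.

Fact l2_complete (v : nat -> E) :
  (forall e : R, 0 < e -> exists N, forall m n, (N <= m)%N -> (N <= n)%N ->
     l2rip (v m - v n) (v m - v n) < e) ->
  exists l : E, forall e : R, 0 < e -> exists N, forall n, (N <= n)%N ->
     l2rip (v n - l) (v n - l) < e.
Proof.
move=> vC.
have ptC x : forall e : R, 0 < e -> exists N, forall m n, (N <= m)%N ->
    (N <= n)%N -> rdot (v m x - v n x) (v m x - v n x) < e ^+ 2.
  move=> e e0; have [/l2_eq h|[k xk]] := cover x.
    exists 0%N => m n _ _.
    have v0 p : v p x = 0 by have := h (v p); rewrite big_seq1.
    by rewrite !v0 subrr /rdot /= !mul0r addr0 exprn_gt0.
  have [N hN] := vC (e ^+ 2) (exprn_gt0 _ e0); exists N => m n Nm Nn.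
  exact: le_lt_trans (@rdot_le (v m - v n) _ _ xk) (hN m n Nm Nn).
have ReC x : exists l : R, (fun n => complex.Re (v n x)) @ \oo --> l.
  apply: real_complete => e e0; have [N hN] := ptC x e e0.
  by exists N => m n Nm Nn; rewrite -raddfB; apply: norm_Re_rdot (ltW e0) _; apply: hN.
have ImC x : exists l : R, (fun n => complex.Im (v n x)) @ \oo --> l.
  apply: real_complete => e e0; have [N hN] := ptC x e e0.
  by exists N => m n Nm Nn; rewrite -raddfB; apply: norm_Im_rdot (ltW e0) _; apply: hN.
have [a ha] := choice ReC; have [b hb] := choice ImC.
pose l : X -> C := fun x => a x +i* b x.
have l2lim (g : X -> C) K : (fun n => l2part S K (g - v n) (g - v n)) @ \oo -->
    l2part S K (g - l) (g - l).
  apply: cvg_sumr => k; apply: cvg_sumr => x; rewrite /rdot.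
  have hRe : (fun n => complex.Re ((g - v n) x)) @ \oo --> complex.Re ((g - l) x).
    rewrite [X in _ --> X](_ : _ = complex.Re (g x) - a x); last by rewrite raddfB.
    under eq_fun do rewrite raddfB.
    exact: (cvgB (cvg_cst _) (ha x)).
  have hIm : (fun n => complex.Im ((g - v n) x)) @ \oo --> complex.Im ((g - l) x).
    rewrite [X in _ --> X](_ : _ = complex.Im (g x) - b x); last by rewrite raddfB.
    under eq_fun do rewrite raddfB.
    exact: (cvgB (cvg_cst _) (hb x)).
  by apply: cvgD; apply: cvgM; assumption.
(* For fixed [K] the other index tends to infinity in the Cauchy estimate for truncated sums; the
   resulting bound is uniform in [K]. *)
have far e : 0 < e -> exists N, forall n K, (N <= n)%N ->
    l2part S K ((v n : X -> C) - l) ((v n : X -> C) - l) <= e.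
  move=> e0; have [N hN] := vC e e0; exists N => n K Nn.
  apply: (cvgr_to_le (l2lim (v n) K)).
  exists N => // m /= Nm; apply: le_trans (ltW (hN n m Nn Nm)).
  exact: (@l2part_le (v n - v m) K).
have lP : `[< l2sub S Eq l >].
  apply/asboolP; split => [s Es|].
    have sum0 (F : {additive C -> R}) (c : X -> R) :
        (forall x, (fun n => F (v n x)) @ \oo --> c x) -> \sum_(x <- s) c x = 0.
      move=> Fc; have : (fun n => \sum_(x <- s) F (v n x)) @ \oo --> \sum_(x <- s) c x.
        exact: cvg_sumr.
      under eq_fun do rewrite -raddf_sum l2_eq // raddf0.
      by move=> /(cvg_lim (@Rhausdorff R)) <-; rewrite lim_cst.
    apply/eqP; rewrite eq_complex !raddf_sum /= (sum0 (@complex.Re R)) //.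
    by rewrite (sum0 (@complex.Im R)) // eqxx.
  have [N hN] := far 1 ltr01.
  exists (2 * (l2rip (v N) (v N) + 1)) => K.
  have -> : l = (v N : X -> C) - ((v N : X -> C) - l) by rewrite opprB addrC subrK.
  apply: (@le_trans _ _ (2 * (l2part S K (v N) (v N) +
      l2part S K ((v N : X -> C) - l) ((v N : X -> C) - l)))).
    by rewrite -l2partB lerDr l2part_ge0.
  by rewrite ler_pM2l // lerD ?l2part_le // hN.
exists (L2 lP) => e e0; have [N hN] := far (e / 2) (divr_gt0 e0 (ltr0Sn _ _)).
exists N => n Nn; apply: (@le_lt_trans _ _ (e / 2)); last first.
  by rewrite ltr_pdivrMr // mulr_natr mulr2n ltrDl.
have h := @l2_cvg (v n - L2 lP) (v n - L2 lP).
apply: (cvgr_to_le h); apply: nearW => K; exact: hN.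
Qed.

Definition l2hilbert : hilbert R.
Proof.
apply: (@Hilbert R E l2rip l2ripC l2ripDl l2ripZr l2ripZ l2rip_ge0 l2rip_eq0 l2_complete).
have [f fP [x fx]] := nontriv; exists (L2 (asboolT fP)).
by apply: contraNneq fx => /(congr1 (fun g : E => g x)) /= ->.
Defined.

End Hilbert.

(** * Creation operators on traceless tensors *)

Section Creation.
Context (K : comNzRingType) (W : lmodType K) (n : nat) (c : nat -> K).
Local Notation word := (seq 'I_n).
Implicit Types (i j l : 'I_n) (w v : word) (xi eta : word -> W).

(* A function on words of length k is a tensor in V^{(x) k}. On the range of the
   Jones-Wenzl projection P_k, [up i xi] is P_{k+1} (e_i (x) xi): Wenzl's
   recursion e_l^* P_{k+1} (e_i (x) xi) = delta_il xi - c_k P_k (e_l (x) e_i^* xi)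
   determines it letter by letter. *)
Fixpoint up i xi w : W :=
  if w is l :: w' then
    (if l == i then xi w' else 0) - c (size w') *: up l (fun v => xi (i :: v)) w'
  else 0.

Lemma up_ext i xi eta w :
  (forall v, (size v).+1 = size w -> xi v = eta v) -> up i xi w = up i eta w.
Proof.
elim: w i xi eta => //= l w IHw i xi eta h; rewrite h //; congr (_ - _ *: _).
by apply: IHw => v sv; apply: h; rewrite /= sv.
Qed.

Lemma up0 i w : up i (fun=> 0) w = 0.
Proof.
elim: w i => //= l w IHw i.
by rewrite if_same IHw scaler0 subr0.
Qed.

Lemma upD i xi eta w : up i (fun v => xi v + eta v) w = up i xi w + up i eta w.
Proof.
elim: w i xi eta => /= [|l w IHw] i xi eta; first by rewrite addr0.
rewrite IHw scalerDr opprD addrACA; congr (_ + _).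
by case: ifP; rewrite ?addr0.
Qed.

Lemma up_sum (I : Type) (r : seq I) i (F : I -> word -> W) w :
  up i (fun v => \sum_(a <- r) F a v) w = \sum_(a <- r) up i (F a) w.
Proof.
elim: r => [|a r IHr]; last rewrite big_cons -IHr -upD.
  by rewrite [RHS]big_nil -[RHS](up0 i w); apply: up_ext => v _; rewrite big_nil.
by apply: up_ext => v _; rewrite big_cons.
Qed.

Lemma upZ i (a : K) xi w : up i (fun v => a *: xi v) w = a *: up i xi w.
Proof.
elim: w i xi => /= [|l w IHw] i xi; first by rewrite scaler0.
rewrite IHw scalerBr !scalerA (mulrC a); congr (_ - _).
by case: ifP; rewrite ?scaler0.
Qed.

Lemma sum_if_eq i (F : 'I_n -> W) : \sum_l (if i == l then F l else 0) = F i.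
Proof. by rewrite -big_mkcond; apply: big_pred1 => l; rewrite eq_sym. Qed.

Definition traceless xi :=
  forall w v, \sum_j xi (w ++ j :: j :: v) = 0.

Lemma traceless_cons i xi : traceless xi -> traceless (fun w => xi (i :: w)).
Proof. by move=> h w v; apply: (h (i :: w)). Qed.

Lemma traceless_head xi v : traceless xi -> \sum_j xi (j :: j :: v) = 0.
Proof. by move=> h; apply: (h [::]). Qed.

(** The corrections in the recursion add up to a creation applied to a contraction of [eta], hence
    to 0. The empty word is excluded because [up] vanishes there. *)
Lemma sum_up_down eta w : traceless eta -> w != [::] ->
  \sum_l up l (fun v => eta (l :: v)) w = eta w.
Proof.
case: w => // m w etaT _ /=; rewrite sumrB sum_if_eq -scaler_sumr.
rewrite -(up_sum _ m (fun l v => eta (l :: l :: v))).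
rewrite (_ : up m _ w = 0) ?scaler0 ?subr0 // -[RHS](up0 m w).
by apply: up_ext => v _; apply: traceless_head.
Qed.

Hypothesis c0 : c 0%N = 0.
Hypothesis cS : forall k, c k.+1 * (n%:R - c k) = 1.

Lemma sum_down_up eta w : traceless eta ->
  \sum_l up l eta (l :: w) = (n%:R - c (size w)) *: eta w.
Proof.
move=> etaT /=; rewrite sumrB; under eq_bigr do rewrite eqxx.
rewrite sumr_const card_ord -scaler_nat scalerBl; congr (_ - _).
rewrite -scaler_sumr; case: w => [|m w]; first by rewrite c0 !scale0r.
by rewrite sum_up_down.
Qed.

(** The double creation inserts the trace vector, the sum of the e_l (x) e_l, which the Jones-Wenzl
    projection annihilates; in the recursion this is the cancellation [cS]. *)
Lemma sum_up_up eta w : traceless eta -> \sum_l up l (up l eta) w = 0.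
Proof.
case: w => [|m w] etaT; first by rewrite big1.
rewrite /= sumrB sum_if_eq -scaler_sumr.
rewrite -(up_sum _ m (fun l v => up l eta (l :: v))).
case: w => [|m' w]; first by rewrite /= scaler0 subrr.
rewrite [X in _ - _ *: X](@up_ext m _ (fun v => (n%:R - c (size w)) *: eta v)); last first.
  by move=> v [<-]; exact: sum_down_up.
by rewrite upZ scalerA cS scale1r subrr.
Qed.

(** At the head the two terms of the recursion cancel by [cS]; a contraction further to the right
    acts on each term separately. *)
Lemma traceless_up i xi : traceless xi -> traceless (up i xi).
Proof.
move=> xiT w; elim: w i xi xiT => [|l w IHw] i xi xiT v.
  rewrite /= sumrB -(sum_if_eq i (fun j => xi (j :: v))).
  under [X in X - _]eq_bigr do rewrite eq_sym.
  apply/eqP; rewrite subr_eq0; apply/eqP.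
  rewrite sum_if_eq -scaler_sumr.
  rewrite -[\sum_j _]/(\sum_j up j (fun v0 => xi (i :: v0)) (j :: v)).
  by rewrite sum_down_up ?scalerA ?cS ?scale1r //; apply: traceless_cons.
rewrite /= sumrB; under [X in _ - X]eq_bigr do rewrite size_cat /=.
rewrite -scaler_sumr IHw ?scaler0 ?subr0; last exact: traceless_cons.
by case: (l == i); [apply: xiT | rewrite big1].
Qed.

End Creation.

Section Adjoint.
Context (K : comNzRingType) (n : nat) (c : nat -> K).
Local Notation word := (seq 'I_n).
Implicit Types (i j l : 'I_n) (w v : word) (xi eta : word -> K^o).

Fixpoint words k : seq word :=
  if k is k'.+1 then [seq i :: w | i <- index_enum 'I_n, w <- words k']
  else [:: [::]].

Lemma size_words k w : (w \in words k) = (size w == k).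
Proof.
elim: k w => [|k IHk] [|l w] //=.
  by apply/negbTE/negP => /allpairsP[[? ?] []].
rewrite eqSS -IHk; apply/allpairsP/idP => [[[l' w'] /= [_ h [_ ->]]] //|h].
by exists (l, w); split => //=; rewrite mem_index_enum.
Qed.

Lemma big_words (V : nmodType) k (F : word -> V) :
  \sum_(w <- words k.+1) F w = \sum_i \sum_(w <- words k) F (i :: w).
Proof. by rewrite /= big_allpairs_dep. Qed.

Lemma up_adjoint k i xi eta : traceless eta ->
  \sum_(w <- words k.+1) up c i xi w * eta w =
  \sum_(w <- words k) xi w * eta (i :: w).
Proof.
elim: k i xi eta => [|k IHk] i xi eta etaT.
  rewrite big_words /= [RHS]big_seq1.
  under eq_bigr do rewrite big_seq1 /= scaler0 subr0.
  under eq_bigr => l _ do rewrite eq_sym (fun_if ( *%R^~ _)) mul0r.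
  by rewrite (sum_if_eq i (fun l => xi [::] * eta [:: l] : K^o)).
rewrite big_words.
transitivity (\sum_l (\sum_(w <- words k.+1) (if i == l then xi w * eta (l :: w) else 0)
  - c k.+1 * \sum_(w <- words k.+1) up c l (fun v => xi (i :: v)) w * eta (l :: w))).
  apply: eq_bigr => l _; rewrite mulr_sumr -sumrB big_seq [RHS]big_seq.
  apply: eq_bigr => w; rewrite size_words => /eqP sw.
  rewrite [up _ _ _ _]/= mulrBl sw eq_sym mulrA; congr (_ - _).
  by case: ifP; rewrite ?mul0r.
rewrite sumrB exchange_big /=; under eq_bigr do rewrite (sum_if_eq i (fun l => xi _ * eta (l :: _) : K^o)).
rewrite -mulr_sumr.
rewrite [X in _ - _ * X](eq_bigr (fun l =>
    \sum_(w <- words k) xi (i :: w) * eta (l :: l :: w))); last first.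
  by move=> l _; apply: IHk; apply: traceless_cons.
rewrite [X in _ - _ * X]exchange_big [X in _ - _ * X]big1 ?mulr0 ?subr0 // => w _.
by rewrite -mulr_sumr traceless_head ?mulr0.
Qed.

End Adjoint.

(** * A model of the relations on a Fock space *)

Section Jacobi.
Context (R : realType) (n : nat).

(* [cfac k] is [k]_q / [k+1]_q for the q-numbers with [2]_q = n. *)
Fixpoint cfac k : R := if k is k'.+1 then (n%:R - cfac k')^-1 else 0.

Hypothesis n2 : (2 <= n)%N.

Lemma cfac_itv k : 0 <= cfac k <= 1.
Proof.
have n2R : 2 <= n%:R :> R by rewrite ler_nat.
elim: k => [|k /andP[k0 k1]] /=; first by rewrite lexx ler01.
have h : 1 <= n%:R - cfac k by lra.
by rewrite invr_ge0 invf_le1 ?h ?andbT; lra.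
Qed.

Lemma cfac_ge0 k : 0 <= cfac k. Proof. by have /andP[] := cfac_itv k. Qed.

Lemma cfac_sub_neq0 k : n%:R - cfac k != 0.
Proof.
have n2R : 2 <= n%:R :> R by rewrite ler_nat.
by have := cfac_itv k => h; apply: lt0r_neq0; lra.
Qed.

Lemma cfacS k : cfac k.+1 * (n%:R - cfac k) = 1.
Proof. by rewrite /= mulVf // cfac_sub_neq0. Qed.

End Jacobi.

Section FockModel.
Context (R : realType) (n : nat).
Hypothesis n2 : (2 <= n)%N.
Local Notation C := R[i].
Local Notation word := (seq 'I_n).
Implicit Types (i j l : 'I_n) (w v : word).

Definition cC k : C := (cfac R n k)%:C.
(** Weight of the step between levels k and k+1. Its square c_{k+1} = 1 / (n - c_k), the ratio of
    the dimensions of the traceless tensors of lengths k and k+1, is what the orthogonality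
    relations require. *)
Definition aC k : C := (Num.sqrt (cfac R n k.+1))%:C.
Local Notation up := (@up C C^o n cC).
Local Notation traceless := (@traceless C C^o n).

Lemma cC0 : cC 0 = 0. Proof. by []. Qed.

Lemma cCS k : cC k.+1 * (n%:R - cC k) = 1.
Proof.
by rewrite /cC -(rmorph_nat (real_complex R)) -rmorphB -rmorphM cfacS.
Qed.

Lemma aC_sqr k : aC k * aC k = cC k.+1.
Proof. by rewrite /aC -rmorphM -expr2 sqr_sqrtr // cfac_ge0. Qed.

Lemma up_up_comm i j (F : word -> word -> C) w w' :
  up i (fun v => up j (F v) w') w = up j (fun v' => up i (F^~ v') w) w'.
Proof.
elim: w i F => [|l w IHw] i F /=; first by rewrite up0.
rewrite IHw -[- _]mulN1r -[-1 * _]/(-1 *: _ : C^o) -!upZ.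
rewrite (_ : (if _ then _ else _) =
    up j (fun v' => if l == i then F w v' else 0) w').
  by rewrite -upD; apply: up_ext => v' _; rewrite scaleN1r.
by case: ifP => _ //; rewrite up0.
Qed.

Definition up2 i j (F : word -> word -> C) w w' : C :=
  up i (fun v => up j (F v) w') w.

(** The generator u_ij: creation in both legs plus its adjoint, the removal of both first letters.
    On the empty word the truncated index [(size w).-1] is harmless because [up2] vanishes there. *)
Definition genf i j (F : word -> word -> C) w w' : C :=
  aC (size w).-1 * up2 i j F w w' + aC (size w) * F (i :: w) (j :: w').

Definition bitraceless (F : word -> word -> C) :=
  [/\ forall w w', size w != size w' -> F w w' = 0,
      forall w', traceless (F^~ w')
    & forall w, traceless (F w)].

Lemma up2_ext i j F G w w' :
  (forall v v', (size v).+1 = size w -> (size v').+1 = size w' -> F v v' = G v v') ->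
  up2 i j F w w' = up2 i j G w w'.
Proof. by move=> h; apply: up_ext => v sv; apply: up_ext => v' sv'; apply: h. Qed.

Lemma up2_tr i j F w w' : up2 i j F w w' = up2 j i (fun v' v => F v v') w' w.
Proof. exact: up_up_comm. Qed.

Lemma up2D i j F G w w' :
  up2 i j (fun v v' => F v v' + G v v') w w' = up2 i j F w w' + up2 i j G w w'.
Proof. by rewrite -upD; apply: up_ext => v _; rewrite -upD. Qed.

Lemma up2Z i j (a : C) F w w' :
  up2 i j (fun v v' => a * F v v') w w' = a * up2 i j F w w'.
Proof.
rewrite /up2 -[RHS]/(a *: _ : C^o) -upZ; apply: up_ext => v _.
by rewrite -upZ.
Qed.

Lemma up2_size i j F w w' : bitraceless F -> size w != size w' -> up2 i j F w w' = 0.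
Proof.
move=> [F0 _ _] ww'; rewrite -[RHS](up0 C^o cC i w); apply: up_ext => v sv.
rewrite -[RHS](up0 C^o cC j w'); apply: up_ext => v' sv'.
by apply: F0; apply: contraNneq ww'; rewrite -sv -sv' => ->.
Qed.

Lemma up2_traceless i j F w : bitraceless F -> traceless (up2 i j F w).
Proof.
move=> [_ _ FT] v v'; rewrite -up_sum -[RHS](up0 C^o cC i w).
apply: up_ext => u _.
exact: (traceless_up cC0 cCS j (FT u) v v').
Qed.

Lemma bitraceless_tr F : bitraceless F -> bitraceless (fun v v' => F v' v).
Proof. by move=> [F0 F1 F2]; split => // w w' h; apply: F0; rewrite eq_sym. Qed.

Lemma genf_tr i j F w w' : size w = size w' ->
  genf i j F w w' = genf j i (fun v v' => F v' v) w' w.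
Proof. by move=> sw; rewrite /genf up2_tr sw. Qed.

Lemma genf_bitraceless i j F : bitraceless F -> bitraceless (genf i j F).
Proof.
move=> FT; have sz w w' : size w != size w' -> genf i j F w w' = 0.
  move=> h; rewrite /genf up2_size // mulr0 add0r.
  by have [F0 _ _] := FT; rewrite F0 ?mulr0.
have half i' j' G w : bitraceless G -> traceless (genf i' j' G w).
  move=> GT v v'; rewrite big_split /= -!mulr_sumr.
  rewrite [\sum_l _](up2_traceless i' j' w GT) mulr0 add0r.
  by have [_ _ G2] := GT; rewrite (G2 (i' :: w) (j' :: v)) mulr0.
split => // [w' v v'|w]; last exact: half.
have [e|e] := eqVneq (size (v ++ i :: i :: v')) (size w').
  rewrite -[RHS](half j i _ w' (bitraceless_tr FT) v v').
  by apply: eq_bigr => l _; apply: genf_tr; rewrite -e !size_cat.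
by rewrite big1 // => l _; apply: sz; move: e; rewrite !size_cat.
Qed.

Lemma genf_ext i j F G w w' :
  F =2 G -> genf i j F w w' = genf i j G w w'.
Proof. by move=> FG; rewrite /genf FG; congr (_ * _ + _); apply: up2_ext. Qed.

(** Of the four products, double creation vanishes by [sum_up_up] and double removal by
    tracelessness. Removal after creation gives the wanted term minus c_k times a creation after a
    removal, because [aC k] squared cancels the factor n - c_k of [sum_down_up]; creation after
    removal, weighted by [aC k.-1] squared, restores what was subtracted. *)
Lemma genf_relation i j F : bitraceless F ->
  forall w w', \sum_l genf i l (genf j l F) w w' = if i == j then F w w' else 0.
Proof.
move=> FT w w'; have [sw|sw] := eqVneq (size w) (size w'); last first.
  have [F0 _ _] := FT; rewrite big1 ?F0 ?if_same // => l _.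
  by have [-> //] := genf_bitraceless i l (genf_bitraceless j l FT).
have [F0 F1 F2] := FT.
transitivity (\sum_l (aC (size w).-1 * (aC (size w).-2 * up2 i l (up2 j l F) w w' +
    aC (size w).-1 * up2 i l (fun v v' => F (j :: v) (l :: v')) w w')) +
  \sum_l (aC (size w) * (aC (size w) * up2 j l F (i :: w) (l :: w') +
    aC (size w).+1 * F (j :: i :: w) (l :: l :: w')))).
  rewrite -big_split; apply: eq_bigr => l _; congr (_ * _ + _).
  by rewrite -!up2Z -up2D; apply: up2_ext => v v' <-.
rewrite -!mulr_sumr !big_split -!mulr_sumr /=.
have -> : \sum_l up2 i l (up2 j l F) w w' = 0.
  rewrite /up2 -up_sum -[RHS](up0 C^o cC i w); apply: up_ext => v _.
  under eq_bigr => l _ do rewrite -up_up_comm.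
  rewrite -up_sum -[RHS](up0 C^o cC j v); apply: up_ext => u _.
  exact: (sum_up_up cC0 cCS w' (F2 u)).
have -> : \sum_l F (j :: i :: w) (l :: l :: w') = 0.
  exact: (traceless_head w' (F2 _)).
have -> : \sum_l up2 j l F (i :: w) (l :: w') = (n%:R - cC (size w)) *
    ((if i == j then F w w' else 0) - cC (size w) * up i (fun v => F (j :: v) w') w).
  rewrite /up2 -up_sum (@up_ext _ _ _ _ _ _ (fun v => (n%:R - cC (size w)) *: (F v w' : C^o))).
    by rewrite upZ.
  by move=> v _; rewrite sw; apply: (sum_down_up cC0 w' (F2 v)).
rewrite mulr0 add0r mulr0 addr0 [aC (size w) * (_ * _)]mulrA [aC (size w) * _ * _]mulrA aC_sqr cCS mul1r.
have -> : aC (size w).-1 * (aC (size w).-1 *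
    \sum_l up2 i l (fun v v' => F (j :: v) (l :: v')) w w') =
    cC (size w) * up i (fun v => F (j :: v) w') w.
  case: w sw => [|m w] sw; first by rewrite /up2 /= big1 ?mulr0.
  rewrite mulrA aC_sqr; congr (_ * _); rewrite /up2 -up_sum.
  apply: up_ext => v _; rewrite (sum_up_down cC (F2 (j :: v))) //.
  by case: w' sw.
by rewrite addrC subrK.
Qed.

(** The exchange of the two legs turns this relation into [genf_relation]. *)
Lemma genf_relation' i j F : bitraceless F ->
  forall w w', \sum_l genf l i (genf l j F) w w' = if i == j then F w w' else 0.
Proof.
move=> FT w w'; rewrite -(genf_relation i j (bitraceless_tr FT) w' w).
have sz l := genf_bitraceless l j FT.
have [sw|sw] := eqVneq (size w) (size w'); last first.
  apply: eq_bigr => l _.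
  have [-> //] := genf_bitraceless l i (sz l).
  have [-> //] := genf_bitraceless i l (genf_bitraceless j l (bitraceless_tr FT)).
  by rewrite eq_sym.
apply: eq_bigr => l _; rewrite genf_tr //; apply: genf_ext => v v'.
have [sv|sv] := eqVneq (size v) (size v'); first by rewrite genf_tr.
have [-> //] := sz l; last by rewrite eq_sym.
by have [-> //] := genf_bitraceless j l (bitraceless_tr FT).
Qed.

End FockModel.

(** * Norm estimates on a single level *)

Section FockSpace.
Context (R : realType) (n : nat).
Hypothesis n2 : (2 <= n)%N.
Local Notation C := R[i].
Local Notation word := (seq 'I_n).
Implicit Types (i j l : 'I_n) (w v : word).
Local Notation cC := (@cC R n).
Local Notation aC := (@aC R n).
Local Notation up := (@up C C^o n cC).
Local Notation traceless := (@traceless C C^o n).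
Local Notation words := (@words n).

Lemma rdotE (a b : C) : rdot a b = complex.Re (a * b^*).
Proof. by case: a b => a a' [b b']; rewrite /rdot /= mulrN opprK. Qed.

Lemma traceless_conj xi : traceless xi -> traceless (fun v => (xi v)^*).
Proof. by move=> h w v; rewrite -rmorph_sum h; apply: conjc0. Qed.

Lemma up_rdot k i (xi eta : word -> C) : traceless eta ->
  \sum_(w <- words k.+1) rdot (up i xi w) (eta w) =
  \sum_(w <- words k) rdot (xi w) (eta (i :: w)).
Proof.
move=> etaT; under eq_bigr do rewrite rdotE; under [RHS]eq_bigr do rewrite rdotE.
rewrite -!raddf_sum; congr complex.Re.
exact: (up_adjoint cC k i xi (traceless_conj etaT)).
Qed.

(** Adjointness turns the squared norm of [up i xi] into that of [xi] minus c_k times the pairing of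
    [xi] with the creation of its own removal; a second use of adjointness shows this pairing to be
    a squared norm. *)
Lemma up_contraction k i (xi : word -> C) : traceless xi ->
  \sum_(w <- words k.+1) rdot (up i xi w) (up i xi w) <=
  \sum_(w <- words k) rdot (xi w) (xi w).
Proof.
move=> xiT; have uT := traceless_up (@cC0 R n) (@cCS R n n2) i xiT.
rewrite up_rdot //.
rewrite (eq_big_seq (fun w => rdot (xi w) (xi w) -
    cfac R n k * rdot (xi w) (up i (fun v => xi (i :: v)) w))); last first.
  move=> w; rewrite size_words /= eqxx => /eqP ->.
  rewrite /rdot raddfB raddfB -[cC k *: _]/(cC k * _).
  by case: (up _ _ _) => a b /=; rewrite !mul0r subr0 addr0; ring.
rewrite sumrB gerBl -mulr_sumr mulr_ge0 ?cfac_ge0 //.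
case: k => [|k]; first by rewrite big_seq1 /rdot /= !mulr0 addr0.
under eq_bigr do rewrite /rdot mulrC [X in _ + X]mulrC -/(rdot _ _).
by rewrite up_rdot //; apply: sumr_ge0 => w _; apply: rdot_ge0.
Qed.

Definition lev k (f g : word -> word -> C) : R :=
  \sum_(w <- words k) \sum_(w' <- words k) rdot (f w w') (g w w').

Lemma lev_ge0 k f : 0 <= lev k f f.
Proof. by apply: sumr_ge0 => w _; apply: sumr_ge0 => w' _; apply: rdot_ge0. Qed.

Local Notation up2 := (@up2 R n).
Local Notation genf := (@genf R n).
Local Notation bitraceless := (@bitraceless R n).

Lemma lev_up2 k i j f g : bitraceless g ->
  lev k.+1 (up2 i j f) g = lev k f (fun w w' => g (i :: w) (j :: w')).
Proof.
move=> [_ g1 g2]; rewrite /lev exchange_big /=.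
under eq_bigr => w' _ do rewrite (up_rdot k i _ (g1 w')).
rewrite exchange_big /=; apply: eq_bigr => w _.
exact: up_rdot (g2 (i :: w)).
Qed.

Lemma lev_up2_le k i j f : bitraceless f ->
  lev k.+1 (up2 i j f) (up2 i j f) <= lev k f f.
Proof.
move=> fT; have [_ f1 f2] := fT.
rewrite /lev exchange_big /=.
apply: (@le_trans _ _ (\sum_(w' <- words k.+1) \sum_(w <- words k)
    rdot (up j (f w) w') (up j (f w) w'))).
  apply: ler_sum => w' _; apply: up_contraction => v v'.
  rewrite -up_sum -[RHS](up0 C^o cC j w'); apply: up_ext => u _.
  exact: f1.
rewrite exchange_big /=; apply: ler_sum => w _.
exact: up_contraction.
Qed.

Lemma lev_shift k i j f :
  lev k (fun w w' => f (i :: w) (j :: w')) (fun w w' => f (i :: w) (j :: w')) <=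
  lev k.+1 f f.
Proof.
rewrite /lev big_words (bigD1 i) //=; apply: ler_wpDr.
  apply: sumr_ge0 => l _; apply: sumr_ge0 => w _; apply: sumr_ge0 => w' _.
  exact: rdot_ge0.
apply: ler_sum => w _; rewrite -/(words k.+1) big_words (bigD1 j) //= lerDl.
by apply: sumr_ge0 => l _; apply: sumr_ge0 => w' _; apply: rdot_ge0.
Qed.

End FockSpace.

(** * The Fock space and the self-adjoint action of the generators *)

Section FockOperators.
Context (R : realType) (n : nat).
Hypothesis n2 : (2 <= n)%N.
Local Notation C := R[i].
Local Notation word := (seq 'I_n).
Implicit Types (i j l : 'I_n) (w v : word).
Local Notation words := (@words n).
Local Notation genf := (@genf R n).
Local Notation up2 := (@up2 R n).

Definition fock_pts k : seq (word * word) :=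
  [seq (w, w') | w <- words k, w' <- words k].

(** [bitraceless] as linear equations. The singletons kill the pairs of words of different lengths,
    which are exactly the points that lie on no level. *)
Definition fock_eqs : set (seq (word * word)) := [set s |
  [\/ (exists2 x : word * word, size x.1 != size x.2 & s = [:: x]),
      (exists w v w', s = [seq (w ++ j :: j :: v, w') | j <- index_enum 'I_n])
    | (exists w v w', s = [seq (w', w ++ j :: j :: v) | j <- index_enum 'I_n])]].

Lemma fock_bitraceless (f : word * word -> C) :
  (forall s, fock_eqs s -> \sum_(x <- s) f x = 0) <->
  bitraceless (fun w w' => f (w, w')).
Proof.
split=> [h|[f0 f1 f2] s].
  split=> [w w' ww'|w' w v|w' w v].
  - have := h [:: (w, w')]; rewrite big_seq1; apply.
    by apply: Or31; exists (w, w').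
  - rewrite -[RHS](h [seq (w ++ j :: j :: v, w') | j <- index_enum 'I_n]) ?big_map //.
    by apply: Or32; exists w, v, w'.
  - rewrite -[RHS](h [seq (w', w ++ j :: j :: v) | j <- index_enum 'I_n]) ?big_map //.
    by apply: Or33; exists w, v, w'.
case=> [[[w w'] /= ww' ->]|[w [v [w' ->]]]|[w [v [w' ->]]]].
- by rewrite big_seq1; apply: f0.
- by rewrite big_map; apply: f1.
- by rewrite big_map; apply: f2.
Qed.

Lemma fock_cover (x : word * word) :
  fock_eqs [:: x] \/ exists k, x \in fock_pts k.
Proof.
case: x => w w'; have [e|e] := eqVneq (size w) (size w'); last first.
  by left; apply: Or31; exists (w, w').
right; exists (size w); apply/allpairsP; exists (w, w') => /=.
by rewrite !size_words e eqxx.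
Qed.

Definition vacuum_fun (x : word * word) : C := (x == ([::], [::]))%:R.

Lemma l2part_lev K (f g : word * word -> C) :
  l2part fock_pts K f g =
  \sum_(k < K) lev k (fun w w' => f (w, w')) (fun w w' => g (w, w')).
Proof. by apply: eq_bigr => k _; rewrite big_allpairs. Qed.

Lemma vacuum_l2 : l2sub fock_pts fock_eqs vacuum_fun.
Proof.
split.
  apply/fock_bitraceless; split=> [w w' ww'|w' w v|w' w v].
  - by rewrite /vacuum_fun; case: eqP => // -[e1 e2]; rewrite e1 e2 eqxx in ww'.
  - by rewrite big1 // => j _; rewrite /vacuum_fun xpair_eqE; case: w.
  - by rewrite big1 // => j _; rewrite /vacuum_fun xpair_eqE andbC; case: w.
exists 1 => K; rewrite l2part_lev; case: K => [|K]; first by rewrite big_ord0 ler01.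
rewrite big_ord_recl big1 ?addr0 => [|k _].
  by rewrite /lev !big_seq1 /rdot /vacuum_fun eqxx /= mul0r addr0 mulr1.
rewrite /lev big_seq big1 // => w; rewrite size_words => /eqP sw.
rewrite big1 // => w' _; rewrite /rdot /vacuum_fun xpair_eqE.
by case: w sw => //= *; rewrite !mul0r addr0.
Qed.

Lemma vacuum_nontriv :
  exists2 f, l2sub fock_pts fock_eqs f & exists x, f x != 0 :> C.
Proof.
exists vacuum_fun; first exact: vacuum_l2.
by exists ([::], [::]); rewrite /vacuum_fun eqxx oner_neq0.
Qed.

Definition fock : hilbert R := l2hilbert fock_cover vacuum_nontriv.
Implicit Types f g : fock.

Definition fval f : word -> word -> C := fun w w' => (f : l2 _ _ _) (w, w').

Lemma fval_inj f g : fval f =2 fval g -> f = g.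
Proof. by move=> h; apply: l2_ext => -[w w']; apply: h. Qed.

Lemma fval_bitraceless f : bitraceless (fval f).
Proof. by apply/fock_bitraceless => s; apply: l2_eq. Qed.

Lemma fval_bounded f : exists M, forall K, \sum_(k < K) lev k (fval f) (fval f) <= M.
Proof.
by exists (l2rip f f) => K; rewrite -l2part_lev; apply: l2part_le.
Qed.

Definition toX (F : word -> word -> C) (x : word * word) := F x.1 x.2.

Lemma fock_mem (F : word -> word -> C) : bitraceless F ->
  (exists M, forall K, \sum_(k < K) lev k F F <= M) ->
  toX F \in l2pred fock_pts fock_eqs.
Proof.
move=> FT [M hM]; apply/asboolP; split; first exact/fock_bitraceless.
by exists M => K; rewrite l2part_lev.
Qed.

Lemma fock_rip f g :
  (fun K => \sum_(k < K) lev k (fval f) (fval g)) @ \oo --> rip f g.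
Proof.
have := @l2_cvg _ _ _ _ (f : l2 _ _ _) g.
by under eq_fun do rewrite l2part_lev.
Qed.

Lemma rdotD_le (a b : C) : rdot (a + b) (a + b) <= 2 * rdot a a + 2 * rdot b b.
Proof.
case: a b => a a' [b b']; rewrite /rdot /=.
have := sqr_ge0 (a - b); have := sqr_ge0 (a' - b'); rewrite !expr2; lra.
Qed.

Lemma levD_le k (F G : word -> word -> C) :
  lev k (fun w w' => F w w' + G w w') (fun w w' => F w w' + G w w') <=
  2 * lev k F F + 2 * lev k G G.
Proof.
rewrite /lev !mulr_sumr -big_split; apply: ler_sum => w _ /=.
by rewrite !mulr_sumr -big_split; apply: ler_sum => w' _; apply: rdotD_le.
Qed.

Definition aR k : R := Num.sqrt (cfac R n k.+1).

Lemma aR_itv k : 0 <= aR k <= 1.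
Proof.
rewrite sqrtr_ge0 /= -sqrtr1 ler_wsqrtr //.
by have /andP[] := cfac_itv R n2 k.+1.
Qed.

Lemma rdotZl (r : R) (a b : C) : rdot (r%:C * a) b = r * rdot a b.
Proof. by case: a b => a a' [b b']; rewrite /rdot /=; ring. Qed.

Lemma rdotZr (r : R) (a b : C) : rdot a (r%:C * b) = r * rdot a b.
Proof. by case: a b => a a' [b b']; rewrite /rdot /=; ring. Qed.

Lemma lev_genf k i j (F G : word -> word -> C) :
  lev k (genf i j F) G = aR k.-1 * lev k (up2 i j F) G +
    aR k * lev k (fun w w' => F (i :: w) (j :: w')) G.
Proof.
rewrite /lev !mulr_sumr -big_split; apply: eq_big_seq => w.
rewrite size_words => /eqP sw; rewrite !mulr_sumr -big_split /=.
apply: eq_bigr => w' _; rewrite /genf sw.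
by rewrite -!rdotZl /rdot !raddfD /= !mulrDl addrACA.
Qed.

Lemma lev_scale_le k (s : word -> R) (F : word -> word -> C) :
  (forall w, 0 <= s w <= 1) ->
  lev k (fun w w' => (s w)%:C * F w w') (fun w w' => (s w)%:C * F w w') <= lev k F F.
Proof.
move=> s01; apply: ler_sum => w _; apply: ler_sum => w' _.
rewrite rdotZl rdotZr mulrA ler_piMl ?rdot_ge0 //.
by have /andP[s0 s1] := s01 w; rewrite mulr_ile1.
Qed.

Lemma lev_genf_le k i j (F : word -> word -> C) : bitraceless F ->
  lev k (genf i j F) (genf i j F) <=
  2 * (if k is k'.+1 then lev k' F F else 0) + 2 * lev k.+1 F F.
Proof.
move=> FT; apply: le_trans (levD_le _ _ _) _; apply: lerD; rewrite ler_pM2l //.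
  apply: le_trans (@lev_scale_le k (fun w => aR (size w).-1) _ _) _.
    by move=> w; apply: aR_itv.
  case: k => [|k]; first by rewrite /lev !big_seq1 /rdot /= !mul0r addr0.
  exact: lev_up2_le.
apply: le_trans (@lev_scale_le k (fun w => aR (size w)) _ _) _.
  by move=> w; apply: aR_itv.
exact: lev_shift.
Qed.

Lemma genf_bounded i j (F : word -> word -> C) (M : R) : bitraceless F ->
  (forall K, \sum_(k < K) lev k F F <= M) ->
  forall K, \sum_(k < K) lev k (genf i j F) (genf i j F) <= 4 * M.
Proof.
move=> FT hM K.
apply: le_trans (ler_sum _ (fun (k : 'I_K) _ => lev_genf_le k i j FT)) _.
rewrite big_split /= -!mulr_sumr.
have -> : 4 * M = 2 * M + 2 * M by ring.
apply: lerD; rewrite ler_pM2l //.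
  case: K => [|K]; first by have := hM 0%N; rewrite !big_ord0.
  by rewrite big_ord_recl add0r; apply: hM.
apply: le_trans (hM K.+1); by rewrite big_ord_recl lerDr; apply: lev_ge0.
Qed.

Fact gen_mem i j f : toX (genf i j (fval f)) \in l2pred fock_pts fock_eqs.
Proof.
have fT := fval_bitraceless f.
apply: fock_mem; first exact: genf_bitraceless.
have [M hM] := fval_bounded f; exists (4 * M); exact: genf_bounded.
Qed.

Definition genH i j f : fock := L2 (gen_mem i j f).

Lemma fval_gen i j f : fval (genH i j f) = genf i j (fval f).
Proof. by []. Qed.

Lemma levC k (F G : word -> word -> C) : lev k F G = lev k G F.
Proof.
apply: eq_bigr => w _; apply: eq_bigr => w' _; rewrite /rdot.
by rewrite mulrC [X in _ + X]mulrC.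
Qed.

Lemma rdot_le_half (a b : C) : `|rdot a b| <= rdot a a + rdot b b.
Proof.
case: a b => a a' [b b']; rewrite /rdot /= ler_norml.
have := sqr_ge0 (a - b); have := sqr_ge0 (a' - b').
have := sqr_ge0 (a + b); have := sqr_ge0 (a' + b').
have := sqr_ge0 a; have := sqr_ge0 b; have := sqr_ge0 a'; have := sqr_ge0 b'.
by rewrite !expr2 => *; apply/andP; split; lra.
Qed.

Lemma lev_cvg0 f : (fun k => lev k (fval f) (fval f)) @ \oo --> (0 : R).
Proof.
have h := @fock_rip f f; rewrite -(subrr (rip f f)).
have h1 : (fun K => \sum_(k < K.+1) lev k (fval f) (fval f)) @ \oo --> rip f f.
  by rewrite -cvg_shiftS in h.
suff -> : (fun k => lev k (fval f) (fval f)) =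
    (fun K => \sum_(k < K.+1) lev k (fval f) (fval f)) \-
    (fun K => \sum_(k < K) lev k (fval f) (fval f)) by apply: cvgB h1 h.
by apply/funext => K /=; rewrite big_ord_recr /= addrAC subrr add0r.
Qed.

(** Creation and removal are adjoint level by level, so the truncated forms of the two sides differ
    only by the coupling of the last level with the next one, which tends to 0. *)
Lemma gen_adjoint i j f g : rip (genH i j f) g = rip f (genH i j g).
Proof.
have cross k (F G : fock) : `|aR k * lev k (fval F) (fun w w' => fval G (i :: w) (j :: w'))| <=
    lev k (fval F) (fval F) + lev k.+1 (fval G) (fval G).
  have /andP[a0 a1] := aR_itv k; rewrite normrM (ger0_norm a0).
  apply: le_trans (ler_piMl (normr_ge0 _) a1) _.
  apply: le_trans (lerD (lexx _) (lev_shift k i j (fval G))).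
  rewrite /lev -big_split; apply: le_trans (ler_norm_sum _ _ _) _.
  apply: ler_sum => w _ /=; rewrite -big_split; apply: le_trans (ler_norm_sum _ _ _) _.
  by apply: ler_sum => w' _; apply: rdot_le_half.
pose A (F G : fock) k := aR k * lev k (fval F) (fun w w' => fval G (i :: w) (j :: w')).
have A0 F G : A F G @ \oo --> (0 : R).
  have hF := lev_cvg0 F; have := lev_cvg0 G; rewrite -cvg_shiftS => hG.
  have hFG : (fun k => lev k (fval F) (fval F) + lev k.+1 (fval G) (fval G)) @ \oo --> (0 : R).
    by rewrite -[X in _ --> X]addr0; apply: (cvgD hF hG).
  have hN : (fun k => - (lev k (fval F) (fval F) + lev k.+1 (fval G) (fval G))) @ \oo --> (0 : R).
    by rewrite -[X in _ --> X]oppr0; apply: (cvgN hFG).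
  apply: (squeeze_cvgr _ hN hFG).
  by apply: nearW => k; rewrite /= -ler_norml cross.
have part F G K : \sum_(k < K.+1) lev k (fval (genH i j F)) (fval G) =
    \sum_(k < K) A F G k + \sum_(k < K.+1) A G F k.
  rewrite big_ord_recl [X in _ = _ + X]big_ord_recl addrCA; congr (_ + _).
    rewrite fval_gen lev_genf /A levC -[RHS]add0r; congr (_ + _).
      by rewrite /lev !big_seq1 /rdot /= !mulr0 addr0 mulr0.
    by rewrite levC.
  rewrite -big_split; apply: eq_bigr => k _.
  rewrite fval_gen lev_genf; congr (_ * _ + _ * _); last exact: levC.
  by rewrite lev_up2 //; apply: fval_bitraceless.
have h1 := @fock_rip (genH i j f) g.
have h2 := @fock_rip (genH i j g) f.
rewrite [rip f _]ripC.
rewrite -cvg_shiftS in h1; rewrite -cvg_shiftS in h2.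
apply/eqP; rewrite -subr_eq0; apply/eqP.
have hA : A g f \- A f g @ \oo --> (0 : R).
  by rewrite -[X in _ --> X](subrr 0); apply: cvgB (A0 g f) (A0 f g).
have hB : (fun K => \sum_(k < K.+1) lev k (fval (genH i j f)) (fval g)) \-
    (fun K => \sum_(k < K.+1) lev k (fval (genH i j g)) (fval f)) @ \oo -->
    rip (genH i j f) g - rip (genH i j g) f by apply: cvgB h1 h2.
apply: (cvg_unique (@Rhausdorff R) hB).
suff -> : (fun K => \sum_(k < K.+1) lev k (fval (genH i j f)) (fval g)) \-
    (fun K => \sum_(k < K.+1) lev k (fval (genH i j g)) (fval f)) =
    A g f \- A f g by exact: hA.
apply/funext => K /=.
by rewrite !part [X in _ - (_ + X)]big_ord_recr /= [X in _ + X - _]big_ord_recr /=; ring.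
Qed.

End FockOperators.

(* Moments of the Jacobi matrix with zero diagonal and squared off-diagonal
   entries w 1, w 2, ...: entry (0, k) of its m-th power, up to normalization. *)
Fixpoint jmom (K : pzRingType) (w : nat -> K) m k : K :=
  if m is m'.+1 then jmom w m' k.+1 + w k * jmom w m' k.-1 else (k == 0%N)%:R.

(** * The relations as operators, and vacuum moments of one generator *)

Section FockGenerators.
Context (R : realType) (n : nat).
Hypothesis n2 : (2 <= n)%N.
Local Notation C := R[i].
Local Notation word := (seq 'I_n).
Implicit Types (i j l : 'I_n) (w v : word).
Local Notation genf := (@genf R n).
Local Notation up2 := (@up2 R n).
Local Notation H := (fock R n).
Local Notation fval := (@fval R n).
Local Notation genH := (@genH R n n2).
Local Notation aC := (@aC R n).
Local Notation cC := (@cC R n).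
Local Notation cf := (cfac R n).

Lemma genfD i j F G w w' :
  genf i j (fun v v' => F v v' + G v v') w w' = genf i j F w w' + genf i j G w w'.
Proof. by rewrite /genf up2D !mulrDr addrACA. Qed.

Lemma genfZ i j (a : C) F w w' :
  genf i j (fun v v' => a * F v v') w w' = a * genf i j F w w'.
Proof. by rewrite /genf up2Z mulrDr !mulrA !(mulrC a). Qed.

Fact gen_pairP i j : `[< adjoint_pair (genH i j, genH i j) >].
Proof.
apply: adjoint_pairP => [f g|c f|]; first exact: gen_adjoint.
  by apply: fval_inj => w w'; rewrite !fval_gen; apply: genfZ.
exists 2 => f; rewrite -(@ler_pXn2r _ 2) ?nnegrE ?mulr_ge0 ?hnorm_ge0 //.
rewrite exprMn !hnorm_sqr.
have -> : 2 ^+ 2 = 4 :> R by rewrite expr2; ring.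
have h := @fock_rip R n (genH i j f) (genH i j f).
apply: (cvgr_to_le h); apply: nearW => K; rewrite !fval_gen.
apply: genf_bounded => //; first exact: fval_bitraceless.
by move=> {}K; rewrite -l2part_lev; apply: (@l2part_le R _ _ _ f).
Qed.

Definition genB i j : bop H := Bop (gen_pairP i j).

Lemma app_sum (I : Type) (r : seq I) (F : I -> bop H) x :
  app (\sum_(a <- r) F a) x = \sum_(a <- r) app (F a) x.
Proof. by elim/big_rec2: _ => // a y T _ <-. Qed.

Lemma fval_sum (I : Type) (r : seq I) (F : I -> H) w w' :
  fval (\sum_(a <- r) F a) w w' = \sum_(a <- r) fval (F a) w w'.
Proof. by elim/big_rec2: _ => // a y T _ <-. Qed.

Lemma genB_relations : Ao_relations (\matrix_(i, j) genB i j).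
Proof.
have delta (b : bool) f w w' :
    fval (app (b%:R : bop H) f) w w' = if b then fval f w w' else 0.
  by case: b.
split=> [i j||]; first by rewrite mxE; apply: bop_ext.
- apply/matrixP => i j; rewrite !mxE; apply: bop_ext => f; apply: fval_inj => w w'.
  rewrite delta app_sum fval_sum -(genf_relation n2 _ _ (fval_bitraceless f)).
  by apply: eq_bigr => l _; rewrite !mxE.
- apply/matrixP => i j; rewrite !mxE; apply: bop_ext => f; apply: fval_inj => w w'.
  rewrite delta app_sum fval_sum -(genf_relation' n2 _ _ (fval_bitraceless f)).
  by apply: eq_bigr => l _; rewrite !mxE.
Qed.

Definition vacuum : H := L2 (asboolT (vacuum_l2 R n)).

Lemma fval_vacuum w w' : fval vacuum w w' = ((w, w') == ([::], [::]))%:R.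
Proof. by []. Qed.

(** The value at the pair of empty words is the inner product with the vacuum. *)
Definition vstate (T : bop H) : C := fval (app T vacuum) [::] [::].

Section Moments.
Variables i j : 'I_n.

(** The factor that appears when a letter l is removed from the projection of the k-th tensor power
    of e_l; it does not depend on l. *)
Fixpoint rho k : R := if k is k'.+1 then 1 - cf k' * rho k' else 0.

(** One factor [rho] for each leg, and c_k, the squared weight of the step between levels k-1 and
    k. *)
Definition jacobi k : R := cf k * rho k ^+ 2.

(** The k-th tensor power of e_l, projected to traceless tensors. *)
Fixpoint xpow l k : word -> C :=
  if k is k'.+1 then @up C C^o n cC l (xpow l k') else fun w => (w == [::])%:R.

Lemma xpow_size l k w : size w != k -> xpow l k w = 0.
Proof.
elim: k w => [|k IHk] w /=; first by case: w.
move=> sw; rewrite -[RHS](up0 C^o cC l w); apply: up_ext => v sv.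
by apply: IHk; apply: contraNneq sw => <-; rewrite sv.
Qed.

Lemma xpow_down l k w : xpow l k.+1 (l :: w) = (rho k.+1)%:C * xpow l k w.
Proof.
elim: k w => [|k IHk] w.
  rewrite /= eqxx (@up_ext _ _ _ _ _ _ (fun=> 0)) // up0 scaler0 subr0.
  by rewrite mul0r subr0 mul1r.
have [sw|sw] := eqVneq (size w) k.+1; last first.
  rewrite (@xpow_size l k.+1) // mulr0; apply: (@xpow_size l k.+2).
  by rewrite eqSS.
rewrite -[LHS]/((if l == l then xpow l k.+1 w else 0) -
  cC (size w) *: @up C C^o n cC l (fun v => xpow l k.+1 (l :: v)) w) eqxx sw.
rewrite [X in _ - _ *: X](@up_ext _ _ _ _ _ _
    (fun v => (rho k.+1)%:C *: (xpow l k v : C^o))); last first.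
  by move=> v _; apply: IHk.
rewrite upZ -[up _ _ _ _]/(xpow l k.+1 w) scalerA -[_ *: _]/(_ * _).
by rewrite -[X in X - _]mul1r -mulrBl -rmorphM -(rmorph1 (real_complex R)) -rmorphB.
Qed.

(** The product of weights is the normalization in which creation maps [zpow k] to [zpow k.+1] with
    coefficient 1, as [jmom] expects. *)
Definition zpow k w w' : C := (\prod_(l < k) aC l) * (xpow i k w * xpow j k w').

Lemma up2_zpow k w w' : aC k * up2 i j (zpow k) w w' = zpow k.+1 w w'.
Proof.
rewrite /zpow up2Z /up2 big_ord_recr /= mulrA [aC k * _]mulrC; congr (_ * _).
rewrite mulrC -[RHS]/(_ *: _ : C^o) -upZ; apply: up_ext => v _.
by rewrite [LHS](upZ cC j (xpow i k v) (xpow j k : word -> C^o)) [LHS]mulrC.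
Qed.

Lemma genf_zpow k w w' :
  genf i j (zpow k) w w' = zpow k.+1 w w' + (jacobi k)%:C * zpow k.-1 w w'.
Proof.
rewrite /genf; congr (_ + _).
  have [sw|sw] := eqVneq (size w) k.+1; first by rewrite sw up2_zpow.
  rewrite -up2_zpow; suff -> : up2 i j (zpow k) w w' = 0 by rewrite !mulr0.
  rewrite /up2 -[RHS](up0 C^o cC i w); apply: up_ext => v sv.
  rewrite -[RHS](up0 C^o cC j w'); apply: up_ext => v' _.
  rewrite /zpow xpow_size ?mul0r ?mulr0 //.
  by apply: contraNneq sw => <-; rewrite sv.
case: k => [|k]; first by rewrite /zpow /jacobi /= !mulr0 !mul0r.
rewrite /zpow !xpow_down.
have [sw|sw] := eqVneq (size w) k; last first.
  by rewrite (@xpow_size i k) // !(mulr0, mul0r).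
have -> : (jacobi k.+1)%:C = aC k * aC k * ((rho k.+1)%:C * (rho k.+1)%:C).
  by rewrite aC_sqr // /jacobi expr2 !rmorphM.
rewrite sw big_ord_recr; move: (rho k.+1)%:C (aC k) => r a /=; ring.
Qed.

Lemma zpow0 k : zpow k [::] [::] = (k == 0%N)%:R.
Proof.
rewrite /zpow; case: k => [|k]; first by rewrite big_ord0 /= !mulr1.
by rewrite /= !mulr0.
Qed.

Lemma iter_genf_ext m F G : F =2 G -> iter m (genf i j) F =2 iter m (genf i j) G.
Proof.
by move=> FG; elim: m => //= m IHm w w'; apply: genf_ext.
Qed.

Lemma iter_genfD m (F G : word -> word -> C) (a : C) w w' :
  iter m (genf i j) (fun v v' => F v v' + a * G v v') w w' =
  iter m (genf i j) F w w' + a * iter m (genf i j) G w w'.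
Proof.
elim: m w w' => //= m IHm w w'.
by rewrite (genf_ext _ _ _ _ IHm) genfD genfZ.
Qed.

Lemma iter_genf_zpow m k :
  iter m (genf i j) (zpow k) [::] [::] = (jmom jacobi m k)%:C.
Proof.
elim: m k => [|m IHm] k /=; first by rewrite zpow0 rmorph_nat.
rewrite -iterS iterSr (iter_genf_ext _ (genf_zpow k)) iter_genfD !IHm.
by rewrite [RHS](rmorphD (real_complex R)) [X in _ = _ + X](rmorphM (real_complex R)).
Qed.

Lemma vstate_pow m : vstate (genB i j ^+ m) = (jmom jacobi m 0)%:C.
Proof.
rewrite -iter_genf_zpow /vstate.
have -> : fval (app (genB i j ^+ m) vacuum) = iter m (genf i j) (fval vacuum).
  elim: m => //= m <-; rewrite exprS; by [].
apply: iter_genf_ext => w w'; rewrite fval_vacuum /zpow big_ord0 mul1r xpair_eqE.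
by rewrite /= -natrM mulnb.
Qed.

End Moments.
End FockGenerators.

(** * Moments of the Haar functional *)

Section VacuumState.
Context (R : realType) (n : nat).

Lemma app_scale (E : hilbert R) (c : R[i]) (T : bop E) x : app (c *: T) x = c *: app T x.
Proof. exact: erefl. Qed.

Lemma fvalZ (c : R[i]) (f : fock R n) w w' : fval (c *: f) w w' = c * fval f w w'.
Proof. exact: erefl. Qed.

Lemma vstateZ (c : R[i]) (X : bop (fock R n)) : vstate (c *: X) = c * vstate X.
Proof. by rewrite /vstate app_scale fvalZ. Qed.

Lemma vstate1 : vstate (1 : bop (fock R n)) = 1.
Proof. exact: erefl. Qed.

End VacuumState.

Section HaarMoments.
Context (R : realType) (n : nat) (A : cstarType R) (u : 'M[A]_n) (h : {scalar A}).
Hypothesis n2 : (2 <= n)%N.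
Hypothesis Au : is_Ao u.
Hypothesis hu : is_haar u h.
Local Notation C := R[i].
Local Notation word := (seq 'I_n).
Implicit Types (i j l : 'I_n) (w v I J : word).
Local Notation words := (@words n).
Local Notation cC := (@cC R n).

Fixpoint mon (B : nzRingType) (x : 'M[B]_n) I J : B :=
  match I, J with
  | i :: I', j :: J' => x i j * mon x I' J'
  | _, _ => 1
  end.

Lemma mon_morph (B B' : nzRingType) (f : {rmorphism B -> B'}) (x : 'M[B]_n) (y : 'M[B']_n) :
  (forall i j, f (x i j) = y i j) -> forall I J, f (mon x I J) = mon y I J.
Proof.
move=> fxy; elim=> [|i I IHI] [|j J] /=; rewrite ?rmorph1 //.
by rewrite rmorphM fxy IHI.
Qed.

Lemma mon_nseq (B : nzRingType) (x : 'M[B]_n) m i j :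
  mon x (nseq m i) (nseq m j) = x i j ^+ m.
Proof. by elim: m => //= m ->; rewrite exprS. Qed.

Lemma haar_left_invariant m I J : size I = m -> size J = m ->
  \sum_(K <- words m) h (mon u I K) *: mon u K J = (h (mon u I J))%:A.
Proof.
have [_ [T [i1 [i2 [Delta [[[_ comm _ _] _] _ Du _ [E [_ Es] Ei]]]]]]] := hu.
move=> sI sJ; rewrite -Ei.
suff -> : Delta (mon u I J) = \sum_(K <- words m) i1 (mon u I K) * i2 (mon u K J).
  by rewrite raddf_sum; apply: eq_bigr => K _; rewrite -(Es (mon u I K)).
elim: m I J sI sJ => [|m IHm] [|i I] [|j J] //= => [_ _|[sI] [sJ]].
  by rewrite big_seq1 /= !rmorph1 mul1r.
rewrite big_words (_ : Delta (u i j * mon u I J) = Delta (u i j) * Delta (mon u I J)); last exact: rmorphM.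
rewrite Du (IHm _ _ sI sJ) mulr_suml; apply: eq_bigr => k _.
rewrite mulr_sumr; apply: eq_bigr => K _ /=.
by rewrite !rmorphM !mulrA; congr (_ * _); rewrite -!mulrA (comm _ (u k j)).
Qed.

(* The A-valued row vector [xi u^{(x) k}] for the scalar row vector [xi]. *)
Fixpoint coact w (xi : word -> C) : A :=
  if w is l :: w' then \sum_k u k l * coact w' (fun v => xi (k :: v))
  else (xi [::])%:A.

Lemma coact_ext w xi eta : (forall v, size v = size w -> xi v = eta v) ->
  coact w xi = coact w eta.
Proof.
elim: w xi eta => /= [|l w IHw] xi eta e; first by rewrite e.
by apply: eq_bigr => k _; congr (_ * _); apply: IHw => v sv; apply: e; rewrite /= sv.
Qed.

Lemma coactD w xi eta : coact w (fun v => xi v + eta v) = coact w xi + coact w eta.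
Proof.
elim: w xi eta => /= [|l w IHw] xi eta; first by rewrite scalerDl.
by rewrite -big_split; apply: eq_bigr => k _; rewrite IHw mulrDr.
Qed.

Lemma coactZ w (a : C) xi : coact w (fun v => a * xi v) = a *: coact w xi.
Proof.
elim: w xi => /= [|l w IHw] xi; first by rewrite scalerA.
by rewrite scaler_sumr; apply: eq_bigr => k _; rewrite IHw scalerAr.
Qed.

Lemma coact0 w : coact w (fun=> 0) = 0.
Proof.
elim: w => /= [|l w IHw]; first by rewrite scale0r.
by rewrite big1 // => k _; rewrite IHw mulr0.
Qed.

Lemma coact_up2 w j (F : word -> word -> C) w' :
  coact w (fun v => @up C C^o n cC j (F v) w') =
  up cC j (fun v' => coact w (fun v => F v v')) w'.
Proof.
elim: w' j F => [|l w' IHw] j F /=; first exact: coact0.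
rewrite -IHw -scaleN1r scalerA mulN1r -coactZ.
rewrite (_ : (if _ then _ else _) = coact w (fun v => if l == j then F v w' else 0)).
  by rewrite -coactD; apply: coact_ext => v _; rewrite mulNr.
by case: ifP; rewrite ?coact0.
Qed.

Lemma mulr_delta i j (X : A) :
  (1%:M : 'M[A]_n) i j * X = if i == j then X else 0.
Proof. by rewrite mxE; case: eqP; rewrite ?mul1r ?mul0r. Qed.

Lemma rel_row i j (X : A) : \sum_k u i k * (u j k * X) = if i == j then X else 0.
Proof.
have [[_ uu _] _] := Au; rewrite -mulr_delta -uu mxE mulr_suml.
by apply: eq_bigr => k _; rewrite mxE mulrA.
Qed.

Lemma rel_col i j (X : A) : \sum_k u k i * (u k j * X) = if i == j then X else 0.
Proof.
have [[_ _ uu] _] := Au; rewrite -mulr_delta -uu mxE mulr_suml.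
by apply: eq_bigr => k _; rewrite mxE mulrA.
Qed.

Lemma up_mull (a : A) l (xi : word -> A) w :
  a * up cC l xi w = up cC l (fun v => a * xi v) w.
Proof.
elim: w l xi => [|k w IHw] l xi /=; first by rewrite mulr0.
rewrite mulrBr -scalerAr IHw; congr (_ - _).
by case: ifP; rewrite ?mulr0.
Qed.

(** Commutation of [u^{(x) k}] with the Jones-Wenzl projections, in terms of creation operators.
    Both orthogonality relations enter, since the corrections of [up] insert and contract trace
    vectors. *)
Lemma coact_intertwines w i xi :
  \sum_k u i k * up cC k (fun v => coact v xi) w = coact w (@up C C^o n cC i xi).
Proof.
elim: w i xi => [|l w IHw] i xi.
  by rewrite /= scale0r big1 // => k _; rewrite mulr0.
(* Normal form of both sides: the left one reaches it through [rel_row], the right one through the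
   induction hypothesis and [rel_col]. *)
transitivity (u i l * coact w xi - cC (size w) *:
    up cC l (fun v => coact v (fun v' => xi (i :: v'))) w).
  transitivity (\sum_k (u i k * (if l == k then coact w xi else 0)) -
      cC (size w) *: \sum_k up cC l (fun v => u i k * coact (k :: v) xi) w).
    rewrite scaler_sumr -sumrB; apply: eq_bigr => k _.
    rewrite [up _ _ _ _]/= mulrBr -scalerAr; congr (_ - _ *: _).
    exact: up_mull.
  congr (_ - _ *: _).
    rewrite -[RHS](sum_if_eq l (fun k => u i k * coact w xi)).
    by apply: eq_bigr => k _; case: ifP; rewrite ?mulr0.
  rewrite -up_sum; apply: up_ext => v _ /=.
  under eq_bigr do rewrite mulr_sumr; rewrite exchange_big /=.
  under eq_bigr do rewrite rel_row; exact: sum_if_eq.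
rewrite [RHS]/=.
rewrite (eq_bigr (fun k => (if i == k then u k l * coact w xi else 0) -
   cC (size w) *: (u k l * coact w (@up C C^o n cC k (fun v => xi (i :: v)))))); last first.
  move=> k _.
  rewrite (@coact_ext _ _ (fun v => (if i == k then xi v else 0) +
    (- cC (size w)) * @up C C^o n cC k (fun v => xi (i :: v)) v)); last first.
    by move=> v sv; rewrite sv eq_sym mulNr.
  rewrite coactD coactZ mulrDr scaleNr mulrN -scalerAr; congr (_ - _).
  by case: ifP; rewrite ?coact0 ?mulr0.
rewrite sumrB (sum_if_eq i (fun k => u k l * coact w xi)) -scaler_sumr.
congr (_ - _ *: _); symmetry.
under eq_bigr do rewrite -IHw mulr_sumr; rewrite exchange_big /=.
under eq_bigr do rewrite rel_col.
exact: (sum_if_eq l (fun k => up cC k (fun v => coact v (fun v' => xi (i :: v'))) w)).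
Qed.

Local Notation H := (fock R n).
Local Notation gens := (\matrix_(i, j) genB R n2 i j).

Definition monF I J : word -> word -> C := fval (app (mon gens I J) (vacuum R n)).

Lemma monF_cons i j I J : monF (i :: I) (j :: J) = genf i j (monF I J).
Proof. by rewrite /monF /= mxE. Qed.

Lemma up_scale k (xi : word -> C) w (X : A) :
  up cC k (fun v => xi v *: X) w = @up C C^o n cC k xi w *: X.
Proof.
elim: w k xi => [|l w IHw] k xi /=; first by rewrite scale0r.
rewrite IHw scalerBl scalerA; congr (_ - _).
by case: ifP; rewrite ?scale0r.
Qed.

(** Invariance of the vacuum in vector form: translating the row indices of a monomial amounts to
    the coaction on the first leg of the vector that it creates. Creation is compatible with the
    coaction by [coact_intertwines], removal by [rel_row]. *)
Lemma monF_coact m I J : size I = m -> size J = m -> forall w w',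
  \sum_(K <- words m) monF K J w w' *: mon u I K = coact w (fun v => monF I J v w').
Proof.
elim: m I J => [|m IHm] [|i I] [|j J] //= => [_ _|[sI] [sJ]] w w'.
  rewrite big_seq1 /monF /=; case: w => [//|l w] /=.
  have v0 k v : vacuum_fun R (k :: v, w') = 0 by [].
  rewrite v0 scale0r big1 // => k _.
  by rewrite (@coact_ext _ _ (fun=> 0)) ?coact0 ?mulr0.
rewrite big_words.
rewrite (eq_bigr (fun k => aC R n (size w).-1 *: (u i k * up cC k (fun v => coact v
      (fun v' => @up C C^o n cC j (monF I J v') w')) w) +
    aC R n (size w) *: (u i k * coact (k :: w) (fun v => monF I J v (j :: w'))))); last first.
  move=> k _; rewrite -!(IHm _ _ sI sJ).
  rewrite (@up_ext _ _ _ _ _ _ (fun v => \sum_(K <- words m)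
      @up C C^o n cC j (monF K J v) w' *: mon u I K)); last first.
    move=> v _; rewrite coact_up2.
    rewrite (@up_ext _ _ _ _ _ _ (fun v' => \sum_(K <- words m)
      monF K J v v' *: mon u I K)); last by move=> v' _; rewrite (IHm _ _ sI sJ).
    rewrite up_sum; apply: eq_bigr => K _.
    exact: up_scale.
  rewrite up_sum !mulr_sumr !scaler_sumr -big_split; apply: eq_bigr => K _.
  rewrite [mon u _ _]/= monF_cons /genf scalerDl -!scalerA.
  by rewrite up_scale /up2 -!scalerAr.
rewrite big_split -!scaler_sumr coact_intertwines.
rewrite (_ : \sum_k u i k * coact (k :: w) (fun v => monF I J v (j :: w')) =
    coact w (fun v => monF I J (i :: v) (j :: w'))); last first.
  rewrite /=; under eq_bigr do rewrite mulr_sumr; rewrite exchange_big /=.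
  under eq_bigr do rewrite rel_row.
  exact: (sum_if_eq i (fun k => coact w (fun v => monF I J (k :: v) (j :: w')))).
rewrite /= -!coactZ -coactD; apply: coact_ext => v sv.
by rewrite monF_cons /genf sv.
Qed.

(** The sum over K of h (u_IK) Q (K, J) is the convolution of [h] with the vacuum functional [Q].
    Applying [h] to the invariance of the vacuum evaluates it to Q (I, J) ([e1]); applying the
    vacuum to the invariance of [h] evaluates it to h (u_IJ) ([e2]). *)
Theorem haar_moment i j m : h (u i j ^+ m) = (jmom (jacobi R n) m 0)%:C.
Proof.
have [[h1 _ _] _] := hu.
have [f [_ fu _]] := Au.2 _ _ (genB_relations R n2).
pose Q I J := monF I J [::] [::].
have fmon I J : f (mon u I J) = mon gens I J by apply: mon_morph.
pose I := nseq m i; pose J := nseq m j.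
have [sI sJ] : size I = m /\ size J = m by rewrite !size_nseq.
have hQ : h (mon u I J) = Q I J.
  have e1 := congr1 h (monF_coact sI sJ [::] [::]).
  have e2 := congr1 (fun a => vstate (f a)) (haar_left_invariant sI sJ).
  rewrite /= linearZ /= h1 mulr1 in e1; rewrite /Q -e1.
  have vsum (c : word -> C) (X : word -> bop H) :
      vstate (\sum_(K <- words m) c K *: X K) = \sum_(K <- words m) c K * vstate (X K).
    by rewrite {1}/vstate app_sum fval_sum; apply: eq_bigr => K _; exact: vstateZ.
  have v1 (c : C) : vstate (c%:A : bop H) = c by rewrite vstateZ vstate1 mulr1.
  move: e2; rewrite [f (\sum_(K <- words m) _)](_ : _ =
    \sum_(K <- words m) h (mon u I K) *: mon gens K J); last first.
    by rewrite linear_sum; apply: eq_bigr => K _; rewrite -fmon; apply: linearZ.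
  rewrite [f (h _)%:A](_ : _ = (h (mon u I J))%:A); last first.
    by rewrite -(rmorph1 f); apply: linearZ.
  rewrite v1 vsum => <-; rewrite linear_sum; apply: eq_bigr => K _.
  by rewrite [RHS]linearZ /= mulrC.
have -> : u i j ^+ m = mon u I J by rewrite mon_nseq.
by rewrite hQ /Q /monF mon_nseq mxE; apply: vstate_pow.
Qed.

End HaarMoments.

(** * The Jacobi matrix *)

Lemma jmom_scale (K : comPzRingType) (a : K) (w : nat -> K) m k : w 0%N = 0 ->
  jmom (fun k => a ^+ 2 * w k) m k = a ^+ (m + k) * jmom w m k.
Proof.
move=> w0; elim: m k => [|m IHm] [|k] /=; rewrite ?IHm.
- by rewrite expr0 mul1r.
- by rewrite mulr0.
- by rewrite w0 mulr0 !mul0r !addr0 addn1 addn0.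
- rewrite !addnS !addSn !exprS expr0; ring.
Qed.

Lemma jmom_odd (K : pzRingType) (w : nat -> K) m k : w 0%N = 0 ->
  odd (m + k) -> jmom w m k = 0.
Proof.
move=> w0; elim: m k => [|m IHm] [|k] //= mk; rewrite ?w0 ?mul0r ?addr0.
  by apply: IHm; rewrite addnC add1n /=; rewrite addn0 in mk.
rewrite addnS in mk; rewrite !IHm ?mulr0 ?addr0 //; first by move: mk => /=; rewrite negbK.
by rewrite !addnS /=.
Qed.

(* Multiplication by x in the basis dual to the Chebyshev polynomials V_j given
   by V_{j+1} = x V_j - V_{j-1}. *)
Definition cheb_mul (R : nmodType) (g : nat -> R) j : R :=
  g j.+1 + (if j is j'.+1 then g j' else 0).

Lemma iter_cheb_mulD (R : comPzRingType) m (f g : nat -> R) (a : R) j :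
  iter m (@cheb_mul R) (fun k => f k + a * g k) j =
  iter m (@cheb_mul R) f j + a * iter m (@cheb_mul R) g j.
Proof.
elim: m j => //= m IHm [|j]; rewrite /cheb_mul !IHm; first by rewrite !addr0.
by rewrite mulrDr addrACA.
Qed.

Lemma iter_cheb_mul_ext (R : nmodType) m (f g : nat -> R) :
  f =1 g -> iter m (@cheb_mul R) f =1 iter m (@cheb_mul R) g.
Proof.
by move=> fg; elim: m => //= m IHm [|j]; rewrite /cheb_mul !IHm.
Qed.

(** [G k j] stands for the integral of P_k V_j, with P_k the monic orthogonal polynomials of the
    weights [w]. The second hypothesis computes the integral of x P_k V_j through either factor, so
    row 0 gives the moments in the Chebyshev basis. *)
Lemma jmom_cheb (R : comPzRingType) (w : nat -> R) (G : nat -> nat -> R) :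
  (forall k, G k 0%N = (k == 0%N)%:R) ->
  (forall k j, cheb_mul (G k) j = G k.+1 j + w k * G k.-1 j) ->
  forall m k, iter m (@cheb_mul R) (G k) 0%N = jmom w m k.
Proof.
move=> G0 GS; elim=> [|m IHm] k //=.
by rewrite -iterS iterSr (iter_cheb_mul_ext m (GS k)) iter_cheb_mulD !IHm.
Qed.

(** * Weights and Chebyshev coefficients for 0 < p < 1 *)

Section QJacobi.
Context (R : realType) (p : R).
Hypothesis p0 : 0 < p.
Hypothesis p1 : p < 1.
Let q := - p.

Lemma normqX k : `|q ^+ k| = p ^+ k.
Proof. by rewrite normrX normrN gtr0_norm. Qed.

Lemma qX_lt1 k : q ^+ k.+1 < 1.
Proof.
apply: le_lt_trans (ler_norm _) _; rewrite normqX exprn_ilt1 //.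
exact: ltW.
Qed.

Lemma subqX_gt0 k : 0 < 1 - q ^+ k.+1.
Proof. by rewrite subr_gt0 qX_lt1. Qed.

Lemma addqX_gt0 k : 0 < 1 + q ^+ k.
Proof.
case: k => [|k]; first by rewrite expr0 addr_gt0.
have : - q ^+ k.+1 < 1.
  apply: le_lt_trans (ler_norm _) _; rewrite normrN normqX exprn_ilt1 //.
  exact: ltW.
lra.
Qed.

Definition tau k : R := (1 - q ^+ k) / (1 + q ^+ k).

(** The coefficient g_s of the density: the integral of V_{2s} for the law with squared weights
    tau_k tau_{k+1}. *)
Definition cheb_coef s : R :=
  2 * p ^+ s * (1 - p) / ((1 + q ^+ s) * (1 + q ^+ s.+1)).

(** [F k s] is the closed form of the integral of P_k V_{k+2s}, with P_k the monic orthogonal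
    polynomials of the weights [W]. The factors [A], [B] and [D] are quotients of q-shifted
    factorials, as in Rogers' connection formula between the q-ultraspherical families of parameters
    -q and q. *)
Let A s := \prod_(i < s) ((1 + q ^+ i) / (1 - q ^+ i.+1)).
Let B s := \prod_(i < s) ((1 - q ^+ i.+1) / (1 + q ^+ i.+2)).
Let D s := \prod_(i < s) ((1 - q ^+ i.+2) / (1 + q ^+ i.+1)).
Let F k s := D k * p ^+ s * A s * B (k + s)%N.

Lemma F0_cheb_coef s : F 0 s = cheb_coef s.
Proof.
rewrite /F /cheb_coef add0n /D big_ord0 mul1r.
elim: s => [|s IHs].
  rewrite /A /B !big_ord0 !expr0 expr1 /q !mulr1.
  have h := addqX_gt0 1; rewrite expr1 /q in h.
  by field; rewrite ?lt0r_neq0.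
rewrite /A /B !big_ord_recr /= -/(A s) -/(B s).
have -> : p ^+ s.+1 * (A s * ((1 + q ^+ s) / (1 - q ^+ s.+1))) *
    (B s * ((1 - q ^+ s.+1) / (1 + q ^+ s.+2))) =
    (p ^+ s * A s * B s) * p * ((1 + q ^+ s) / (1 + q ^+ s.+2)).
  have h1 := lt0r_neq0 (subqX_gt0 s); have h2 := lt0r_neq0 (addqX_gt0 s.+2).
  by rewrite (exprS p); field; rewrite h1 h2.
rewrite IHs (exprS p).
have h1 := lt0r_neq0 (addqX_gt0 s); have h2 := lt0r_neq0 (addqX_gt0 s.+2).
have h3 := lt0r_neq0 (addqX_gt0 s.+1).
by field; rewrite h1 h2 h3.
Qed.

Let W k := tau k * tau k.+1.

Lemma F_diag k : F k.+1 0 = W k.+1 * F k 0.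
Proof.
rewrite /F !addn0 /D /B !big_ord_recr /= -/(D k) -/(B k) /W /tau.
have h1 := lt0r_neq0 (addqX_gt0 k.+1); have h2 := lt0r_neq0 (addqX_gt0 k.+2).
by field; rewrite h1 h2.
Qed.

Lemma F_step k s : F k s.+1 + F k s = F k.+1 s + W k * (if k is k'.+1 then F k' s.+1 else 0).
Proof.
have h1 := lt0r_neq0 (addqX_gt0 k.+1).
have h3 := lt0r_neq0 (subqX_gt0 s).
have h4 := lt0r_neq0 (addqX_gt0 (k + s).+2).
have AS : A s.+1 = A s * ((1 + q ^+ s) / (1 - q ^+ s.+1)) by rewrite /A big_ord_recr.
have BS : B (k + s).+1 = B (k + s) * ((1 - q ^+ (k + s).+1) / (1 + q ^+ (k + s).+2)).
  by rewrite /B big_ord_recr.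
have DS : D k.+1 = D k * ((1 - q ^+ k.+2) / (1 + q ^+ k.+1)) by rewrite /D big_ord_recr.
(* For [k = 0] both sides vanish, since [tau 0 = 0]; the missing predecessor does not matter. *)
have eq0 : W k * (if k is k'.+1 then F k' s.+1 else 0) =
    D k * p ^+ s.+1 * A s.+1 * B (k + s) * ((1 - q ^+ k) / (1 + q ^+ k.+1)).
  case: k h1 h4 BS DS => [|k] h1 h4 BS DS.
    by rewrite /W /tau !expr0 subrr !mul0r mulr0.
  have -> : D k.+1 = D k * ((1 - q ^+ k.+2) / (1 + q ^+ k.+1)) by rewrite /D big_ord_recr.
  rewrite /F /W /tau addnS -addSn.
  have h5 := lt0r_neq0 (subqX_gt0 k.+1).
  have h6 := lt0r_neq0 (addqX_gt0 k.+1).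
  by field; rewrite h1 h6.
rewrite eq0 /F addSn addnS AS BS DS.
move: h1 h3 h4; rewrite !exprS exprD.
have -> : p = - q by rewrite /q opprK.
move: (D k) (A s) (B (k + s)%N) (q ^+ k) (q ^+ s) ((- q) ^+ s) => d a b x y z h1 h3 h4.
by field; rewrite h1 h3 h4.
Qed.

(** Below the diagonal the integral of P_k V_j vanishes by orthogonality, for the wrong parity by
    symmetry of the law. *)
Let G k j := if (k <= j)%N && ~~ odd (j - k) then F k (j - k)./2 else 0.

Lemma G_out k j : (j < k)%N -> G k j = 0.
Proof. by rewrite /G ltnNge => /negbTE ->. Qed.

Lemma G_odd k j : odd (j + k) -> G k j = 0.
Proof.
by rewrite /G; case: leqP => //= kj; rewrite oddB // -oddD => ->.
Qed.

Lemma G_in k s : G k (k + s.*2) = F k s.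
Proof. by rewrite /G leq_addr addKn odd_double doubleK. Qed.

Lemma G_step k j : cheb_mul (G k) j = G k.+1 j + W k * G k.-1 j.
Proof.
have [kj|kj] := boolP (odd (k + j)); last first.
  rewrite /cheb_mul G_odd; last by rewrite addSn /= addnC.
  rewrite (@G_odd k.+1) ?addnS /= 1?addnC //.
  have -> : (if j is j'.+1 then G k j' else 0) = 0.
    case: j kj => // j kj; apply: G_odd; move: kj.
    by rewrite addnS /= negbK addnC.
  case: k kj => [|k] kj /=; first by rewrite /W /tau expr0 subrr !mul0r addr0.
  rewrite (@G_odd k) ?mulr0 //; move: kj.
  by rewrite addSn /= negbK addnC.
have [jk|kj'] := ltnP j k.
  rewrite (@G_out k.+1) ?add0r; last exact: ltnW.
  have -> : cheb_mul (G k) j = G k j.+1.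
    by rewrite /cheb_mul; case: j jk {kj} => [|j] jk; rewrite ?addr0 // (@G_out k j) ?addr0 // ltnW.
  case: k kj jk => // k kj; rewrite ltnS leq_eqVlt => /predU1P[->|jk].
    have GF m : G m m = F m 0 by rewrite -G_in addn0.
    by rewrite /= !GF F_diag.
  by rewrite !G_out ?mulr0.
have {}kj' : (k < j)%N.
  by rewrite ltn_neqAle kj' andbT; apply: contraTneq kj => ->; rewrite addnn odd_double.
have [s ->] : exists s, j = (k + s.*2).+1.
  exists (j - k.+1)./2; rewrite -addSn -[X in _ = X]addnC.
  have := odd_double_half (j - k.+1); rewrite oddB // oddS.
  rewrite addnC oddD in kj; move: kj; case: (odd j); case: (odd k) => //= _.
    by rewrite add0n => ->; rewrite subnK.
  by rewrite add0n => ->; rewrite subnK.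
have -> : cheb_mul (G k) (k + s.*2).+1 = F k s.+1 + F k s.
  by rewrite /cheb_mul -!G_in doubleS !addnS.
rewrite F_step -addSn G_in; congr (_ + _ * _).
case: k {kj kj'} => [|k] /=; last by rewrite -G_in doubleS addnS addSnnS.
by rewrite G_odd // addn0 add1n /= odd_double.
Qed.

Definition cheb_seq j : R := if odd j then 0 else cheb_coef j./2.

Lemma jmom_tau m : jmom W m 0 = iter m (@cheb_mul R) cheb_seq 0%N.
Proof.
rewrite -(@jmom_cheb R W G); last exact: G_step.
  by apply: iter_cheb_mul_ext => j; rewrite /G /cheb_seq subn0 /= F0_cheb_coef; case: odd.
move=> [|k]; last by rewrite G_out.
by rewrite /G /= /F /D /A /B !big_ord0 expr0 !mulr1.
Qed.

Variable n : nat.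
Hypothesis np : n%:R = p + p^-1.

Lemma cfac_q k : cfac R n k = p * (1 - q ^+ (k.*2)) / (1 - q ^+ k.+1.*2).
Proof.
have pn := lt0r_neq0 p0.
elim: k => [|k IHk] /=; first by rewrite expr0 subrr mulr0 mul0r.
have h1 : 1 - q ^+ k.+1.*2 != 0 by rewrite doubleS lt0r_neq0 // subqX_gt0.
have h2 : 1 - q ^+ k.+2.*2 != 0 by rewrite doubleS lt0r_neq0 // subqX_gt0.
have -> : n%:R - cfac R n k = (1 - q ^+ k.+2.*2) / (p * (1 - q ^+ k.+1.*2)).
  rewrite IHk np; move: h1 h2.
  rewrite !doubleS !exprS /q; move: ((- p) ^+ k.*2) => x h1 h2.
  by field; rewrite pn h1.
by rewrite invf_div.
Qed.

Lemma rho_q k : rho R n k.+1 = (1 - q ^+ k.+2) / ((1 - q) * (1 + q ^+ k.+1)).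
Proof.
have q1 : 1 - q != 0 by rewrite lt0r_neq0 // -[q]expr1 subqX_gt0.
elim: k => [|k IHk].
  have h := lt0r_neq0 (addqX_gt0 1); rewrite expr1 in h.
  by rewrite /= mul0r subr0 expr2 expr1; field; rewrite q1 h.
rewrite [LHS]/= -/(cfac R n k.+1) -/(rho R n k.+1) IHk cfac_q.
have h1 := lt0r_neq0 (addqX_gt0 k.+1); have h2 := lt0r_neq0 (addqX_gt0 k.+2).
have h3 := lt0r_neq0 (subqX_gt0 k.+1).
have dbl m : q ^+ m.*2 = (q ^+ m) * (q ^+ m) by rewrite -addnn exprD.
move: h1 h2 h3; rewrite !dbl !exprS.
have -> : p = - q by rewrite /q opprK.
move: (q ^+ k) => x h1 h2 h3.
have h4 : 1 - q * (q * x) * (q * (q * x)) != 0.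
  have -> : 1 - q * (q * x) * (q * (q * x)) =
     (1 - q * (q * x)) * (1 + q * (q * x)) by ring.
  by rewrite mulf_neq0.
by field; rewrite q1 h1 h2 h4.
Qed.

Lemma jacobi_q k : jacobi R n k = (n%:R + 2)^-1 * W k.
Proof.
have pn := lt0r_neq0 p0.
have q1 : 1 - q != 0 by rewrite lt0r_neq0 // -[q]expr1 subqX_gt0.
have -> : (n%:R + 2)^-1 = p / (1 - q) ^+ 2.
  rewrite np -[RHS]invf_div; congr (_^-1); rewrite /q; by field.
rewrite /jacobi; case: k => [|k].
  by rewrite /= mul0r /W /tau expr0 subrr !mul0r mulr0.
rewrite rho_q cfac_q /W /tau.
have h1 := lt0r_neq0 (addqX_gt0 k.+1); have h2 := lt0r_neq0 (addqX_gt0 k.+2).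
have h3 := lt0r_neq0 (subqX_gt0 k.+1).
have dbl m : q ^+ m.*2 = (q ^+ m) * (q ^+ m) by rewrite -addnn exprD.
move: h1 h2 h3; rewrite !dbl !exprS !expr0.
have -> : p = - q by rewrite /q opprK.
move: (q ^+ k) => x h1 h2 h3.
have h4 : 1 - q * (q * x) * (q * (q * x)) != 0.
  have -> : 1 - q * (q * x) * (q * (q * x)) =
     (1 - q * (q * x)) * (1 + q * (q * x)) by ring.
  by rewrite mulf_neq0.
by field; rewrite q1 h1 h2 h4.
Qed.

End QJacobi.

(** * Weights and moments for n = 2, the degenerate case p = 1 *)

Section JacobiTwo.
Context (R : realType).

Lemma cfac2 k : cfac R 2 k = k%:R / k.+1%:R.
Proof.
elim: k => [|k IHk] /=; first by rewrite mul0r.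
have h1 : k%:R + 1 != 0 :> R by rewrite natr1.
rewrite IHk -[RHS]invf_div -!natr1; congr (_^-1).
by field; rewrite h1.
Qed.

Lemma rho2 k : rho R 2 k = (k.+1)./2%:R / k%:R.
Proof.
elim: k => [|k IHk] /=; first by rewrite invr0 mulr0.
rewrite IHk cfac2.
case: k {IHk} => [|k]; first by rewrite /= !mul0r subr0 divff.
have e : (k.+2)./2%:R + (k.+3)./2%:R = k.+2%:R :> R.
  rewrite -natrD; congr (_%:R); rewrite -[k.+3./2]/(uphalf k.+2) addnC.
  by rewrite -[RHS](odd_double_half k.+2) uphalf_half -addnn addnA.
rewrite [X in _ - X](_ : _ = (k.+2)./2%:R / k.+2%:R); last first.
  have h : k.+1%:R != 0 :> R by []; have h' : k.+2%:R != 0 :> R by [].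
  move: (k.+1%:R) h (k.+2%:R) h' (k.+2)./2%:R => x hx y hy z.
  by field; rewrite hx hy.
have h' : k.+2%:R != 0 :> R by [].
by apply: (mulIf h'); rewrite mulrBl mul1r !divfK // -e addrAC subrr add0r.
Qed.

Lemma jacobi2_even l : jacobi R 2 l.*2 = l%:R / (2 * (l.*2.+1)%:R).
Proof.
rewrite /jacobi cfac2 rho2 /= uphalf_double.
have h : l.*2.+1%:R != 0 :> R by [].
case: l h => [|l] h; first by rewrite !mul0r.
have h2 : (l.+1).*2%:R = 2 * l.+1%:R :> R by rewrite -muln2 natrM mulrC.
have h3 : l.+1%:R != 0 :> R by [].
rewrite h2; move: (l.+1%:R : R) h3 (_.*2.+1%:R : R) h => x hx y hy.
by field; rewrite hx hy.
Qed.

Lemma jacobi2_odd l : jacobi R 2 l.*2.+1 = l.+1%:R / (2 * (l.*2.+1)%:R).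
Proof.
rewrite /jacobi cfac2 rho2 /= doubleK.
have h : l.*2.+1%:R != 0 :> R by [].
have h2 : (l.*2).+2%:R = 2 * l.+1%:R :> R by rewrite -doubleS -muln2 natrM mulrC.
have h3 : l.+1%:R != 0 :> R by [].
rewrite h2; move: (l.+1%:R : R) h3 (_.*2.+1%:R : R) h => x hx y hy.
by field; rewrite hx hy.
Qed.

(** Under |x| dx on [-1, 1] the variable x^2 is uniform on [0, 1], so P_{2l} is the monic shifted
    Legendre polynomial in x^2. Its integral against x^{2j} is a falling factorial of j over a
    rising one, up to a constant [a l]; the zeros of the falling factorial at j < l express
    orthogonality. *)
Let P l (x : R) := \prod_(i < l) (x - i%:R).
Let Q l (x : R) := \prod_(i < l.+1) (x + 1 + i%:R).
Let a l := \prod_(i < l) jacobi R 2 i.*2.+1.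

Lemma Q_shift l x : Q l (x + 1) * (x + 1) = Q l x * (x + l%:R + 2).
Proof.
rewrite /Q; elim: l => [|l IHl].
  by rewrite !big_ord_recl !big_ord0 /=; ring.
rewrite big_ord_recr mulrAC [LHS]/= IHl [in RHS]big_ord_recr /= -natr1.
by ring.
Qed.

Lemma P_shift l x : P l.+1 (x + 1) = (x + 1) * P l x.
Proof.
rewrite /P big_ord_recl subr0; congr (_ * _); apply: eq_bigr => i _.
by rewrite /= -natr1; ring.
Qed.

Lemma Q_neq0 l (j : nat) : Q l j%:R != 0.
Proof.
by apply/prodf_neq0 => i _; rewrite natr1 -natrD.
Qed.

Lemma jmom2_even j l :
  jmom (jacobi R 2) j.*2 l.*2 = a l * P l j%:R / Q l j%:R /\
  jmom (jacobi R 2) j.*2.+1 l.*2.+1 = (l.+1%:R / l.*2.+1%:R) * a l * P l j%:R / Q l (j%:R + 1).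
Proof.
have odd_of_even i m : 
    (forall l, jmom (jacobi R 2) m.*2 l.*2 = a l * P l m%:R / Q l m%:R) ->
    jmom (jacobi R 2) m.*2.+1 i.*2.+1 =
    (i.+1%:R / i.*2.+1%:R) * a i * P i m%:R / Q i (m%:R + 1).
  move=> E; rewrite [LHS]/= -doubleS !E.
  have aS : a i.+1 = a i * (i.+1%:R / (2 * i.*2.+1%:R)).
    by rewrite /a big_ord_recr /= jacobi2_odd.
  have PS : P i.+1 m%:R = P i m%:R * (m%:R - i%:R) by rewrite /P big_ord_recr.
  have QS : Q i.+1 m%:R = Q i m%:R * (m%:R + 1 + i.+1%:R) by rewrite /Q big_ord_recr.
  rewrite jacobi2_odd aS PS QS.
  have q0 := Q_neq0 i m; have := Q_shift i m%:R.
  have m1 : m%:R + 1 != 0 :> R by rewrite natr1.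
  have q1 : Q i (m%:R + 1) != 0 by rewrite natr1 Q_neq0.
  have mi : m%:R + i%:R + 2 != 0 :> R by rewrite -!natrD addn2.
  move=> /(canRL (mulfK m1)) ->.
  have i2 : i.*2.+1%:R = 2 * i%:R + 1 :> R by rewrite -natr1 -muln2 natrM mulrC.
  have h2 : i.*2.+1%:R != 0 :> R by [].
  rewrite i2 in h2 *; rewrite -!natr1.
  move: (P _ _) (a _) => x y.
  by field; rewrite q0 m1 h2 mi.
have even_of_odd i m : 
    (forall l, jmom (jacobi R 2) m.*2.+1 l.*2.+1 =
      (l.+1%:R / l.*2.+1%:R) * a l * P l m%:R / Q l (m%:R + 1)) ->
    jmom (jacobi R 2) m.+1.*2 i.*2 = a i * P i m.+1%:R / Q i m.+1%:R.
  move=> O; rewrite doubleS [LHS]/= -/(jmom _ m.*2.+1 i.*2.+1) O jacobi2_even.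
  case: i => [|i].
    have -> : 1%:R / (0.*2.+1)%:R = 1 :> R by rewrite divr1.
    by rewrite !mul0r addr0 /a /P !big_ord0 -natr1 !mul1r.
  rewrite [X in jmom _ _ X]/= -/(jmom _ m.*2.+1 i.*2.+1) O.
  have aS : a i.+1 = a i * (i.+1%:R / (2 * i.*2.+1%:R)).
    by rewrite /a big_ord_recr /= jacobi2_odd.
  have PS : P i.+1 m%:R = P i m%:R * (m%:R - i%:R) by rewrite /P big_ord_recr.
  have QS : Q i.+1 (m%:R + 1) = Q i (m%:R + 1) * (m%:R + 1 + 1 + i.+1%:R).
    by rewrite /Q big_ord_recr.
  rewrite -[m.+1%:R]natr1 P_shift aS PS QS.
  have q1 : Q i (m%:R + 1) != 0 by rewrite natr1 Q_neq0.
  have mi : m%:R + 1 + 1 + (i%:R + 1) != 0 :> R by rewrite !natr1 -natrD.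
  have i2 : i.*2.+1%:R = 2 * i%:R + 1 :> R by rewrite -natr1 -muln2 natrM mulrC.
  have i3 : i.+1.*2.+1%:R = 2 * i%:R + 3 :> R.
    by rewrite doubleS -!natr1 -muln2 natrM mulrC; ring.
  have h2 : i.*2.+1%:R != 0 :> R by [].
  have h3 : i.+1.*2.+1%:R != 0 :> R by [].
  rewrite i2 in h2 *; rewrite i3 in h3 *; rewrite -!natr1.
  move: (P _ _) (a _) => x y.
  by field; rewrite q1 mi h2 h3.
have main m : (forall l, jmom (jacobi R 2) m.*2 l.*2 = a l * P l m%:R / Q l m%:R).
  elim: m => [|m IHm] i; last by apply: even_of_odd => k; apply: odd_of_even.
  case: i => [|i] /=.
    by rewrite /a /P /Q !big_ord_recl !big_ord0 !mulr1 add0r addr0 divr1.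
  by rewrite /P big_ord_recl subr0 mul0r mulr0 mul0r.
by split; [apply: main | apply: odd_of_even].
Qed.

Lemma jmom2 m : jmom (jacobi R 2) m 0 = if odd m then 0 else 2 / (m%:R + 2).
Proof.
have [mo|me] := boolP (odd m); first by rewrite jmom_odd ?addn0 // /jacobi /= mul0r.
rewrite -[m in LHS]odd_double_half (negbTE me) add0n.
have [-> _] := jmom2_even m./2 0.
rewrite /a /P /Q big_ord_recl !big_ord0 addr0 !mulr1 mul1r.
rewrite -[in RHS](odd_double_half m) (negbTE me) add0n -muln2 natrM.
have h : m./2%:R + 1 != 0 :> R by rewrite natr1.
have h2 : m./2%:R * 2 + 2 != 0 :> R by rewrite -natrM -natrD addn2.
by field; rewrite h h2.
Qed.

End JacobiTwo.

(** * Moments determine a compactly supported density *)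

(* [(1 - t^N)^(2^N)] tends to 1 for t < 1/2 and to 0 for 1/2 < t <= 1. *)
Lemma step_poly (R : realType) (K a d e : R) : 0 < K -> 0 < d -> 0 < e ->
  exists P : {poly R}, forall x, `|x| <= K ->
    [/\ 0 <= P.[x] <= 1, (a + d <= x -> 1 - e <= P.[x]) & (x <= a - d -> P.[x] <= e)].
Proof.
move=> K0 d0 e0.
(* [L] keeps t = 1/2 + (x - a) / L within [1/4, 3/4]; [r] and [s] are the values of 2t at a - d and
   at a + d. *)
pose L := 4 * (K + `|a| + d).
have L0 : 0 < L by rewrite mulr_gt0 // addr_gt0 // ltr_pwDl.
pose r := 1 - 2 * (d / L); pose s := 1 + 2 * (d / L).
have dL : 0 < d / L by rewrite divr_gt0.
have dL4 : d / L <= 4^-1.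
  rewrite ler_pdivrMr // /L mulrA mulVf // mul1r.
  by have := normr_ge0 a; lra.
have r0 : 0 < r by rewrite /r; lra.
have r1 : r < 1 by rewrite /r; lra.
have s0 : 0 < s by rewrite /s; lra.
have sr : s^-1 < 1 by rewrite invf_lt1 // /s; lra.
have [N1 _ hN1] : \forall N \near \oo, r ^+ N < e.
  have h : (GRing.exp r) @ \oo --> (0 : R) by apply: cvg_expr; rewrite gtr0_norm.
  exact: (cvgr_lt _ h).
have [N2 _ hN2] : \forall N \near \oo, s^-1 ^+ N < e.
  have h : (GRing.exp s^-1) @ \oo --> (0 : R).
    by apply: cvg_expr; rewrite gtr0_norm // invr_gt0.
  exact: (cvgr_lt _ h).
pose N := maxn N1 N2.
have rN : r ^+ N < e by apply: hN1; rewrite /= leq_maxl.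
have sN : s^-1 ^+ N < e by apply: hN2; rewrite /= leq_maxr.
have [T hT] : exists T : {poly R}, forall x, T.[x] = 2^-1 + (x - a) / L.
  exists ((2^-1 - a / L)%:P + L^-1 *: 'X) => x.
  by rewrite !hornerE; field; exact: lt0r_neq0.
exists (1 - (1 - T ^+ N) ^+ (2 ^ N)) => x xK.
rewrite !hornerE hT.
set t := 2^-1 + (x - a) / L.
have xa : `|(x - a) / L| <= 4^-1.
  rewrite normrM normfV (gtr0_norm L0) ler_pdivrMr // /L mulrA mulVf // mul1r.
  apply: le_trans (ler_normB _ _) _; lra.
have /andP[t0 t1] : 0 <= t <= 1.
  by move: xa; rewrite /t ler_norml => /andP[? ?]; apply/andP; split; lra.
have tN0 : 0 <= t ^+ N by rewrite exprn_ge0.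
have tN1 : t ^+ N <= 1 by rewrite exprn_ile1.
split.
- rewrite subr_ge0 exprn_ile1 /= ?subr_ge0 // ?gerBl //.
  by rewrite exprn_ge0 // subr_ge0.
- move=> xd; rewrite lerB //; apply: le_trans (ltW sN).
  have ts : s <= 2 * t.
    have : d / L <= (x - a) / L by rewrite ler_pM2r ?invr_gt0 //; lra.
    by rewrite /s /t; lra.
  (* The quantity to bound times (1 + t^N)^(2^N) is at most 1, and by Bernoulli's inequality this
     second factor is at least (2t)^N, hence at least s^N. *)
  have bern (u : R) m : 0 <= u -> u * m%:R <= (1 + u) ^+ m.
    move=> u0; elim: m => [|m IHm]; first by rewrite mulr0 expr0.
    have h1 : 1 <= (1 + u) ^+ m by rewrite exprn_ege1 // lerDl.
    rewrite exprS -natr1; apply: (@le_trans _ _ ((1 + u) ^+ m + u * (1 + u) ^+ m)); last by lra.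
    rewrite mulrDr mulr1 lerD // ler_peMr //.
  rewrite -(@ler_pM2r _ (s ^+ N)) ?exprn_gt0 // -exprMn mulVf ?lt0r_neq0 // expr1n.
  apply: (@le_trans _ _ ((1 - t ^+ N) ^+ (2 ^ N) * (1 + t ^+ N) ^+ (2 ^ N))).
    rewrite ler_wpM2l ?exprn_ge0 ?subr_ge0 //.
    apply: le_trans (bern _ (2 ^ N)%N tN0).
    have -> : t ^+ N * (2 ^ N)%N%:R = (2 * t) ^+ N by rewrite natrX mulrC -exprMn.
    by rewrite lerXn2r ?nnegrE ?(ltW s0) // (le_trans (ltW s0)).
  have hq : (1 - t ^+ N) * (1 + t ^+ N) = 1 - (t ^+ N) ^+ 2.
    by rewrite -subr_sqr expr1n.
  by rewrite -exprMn hq exprn_ile1 ?subr_ge0 ?exprn_ile1 // gerBl sqr_ge0.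
- move=> xd; have tr : 2 * t <= r.
    have : (x - a) / L <= - d / L by rewrite ler_pM2r ?invr_gt0 //; lra.
    by rewrite /r /t mulNr; lra.
  have bern (u : R) m : 0 <= u <= 1 -> 1 - u * m%:R <= (1 - u) ^+ m.
    move=> /andP[u0 u1]; elim: m => [|m IHm]; first by rewrite mulr0 expr0 subr0.
    have h1 : (1 - u) ^+ m <= 1 by rewrite exprn_ile1 // ?subr_ge0 // gerBl.
    rewrite exprS -natr1; have : u * (1 - u) ^+ m <= u by rewrite ler_piMr.
    by lra.
  have := bern (t ^+ N) (2 ^ N)%N; rewrite tN0 tN1 => /(_ isT).
  rewrite natrX -exprMn => h; apply: le_trans (ltW rN).
  have : (t * 2) ^+ N <= r ^+ N.
    by rewrite lerXn2r ?nnegrE ?mulr_ge0 ?(ltW r0) // mulrC.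
  by lra.
Qed.

Section Determinacy.
Context (R : realType) (K : R).
Hypothesis K0 : 0 < K.
Let T := measurableTypeR R.

Definition ray (b x : R) : R := (b < x)%R%:R.

Definition bdd (g : R -> R) : Prop :=
  measurable_fun setT (g : T -> R) /\ exists M : R, forall x, `|x| <= K -> `|g x| <= M.

(** Additivity is asked for constants only, which includes total mass 1; comparison with step
    polynomials takes no more. *)
Definition positive_functional (I : (R -> R) -> R) : Prop :=
  (forall g h, bdd g -> bdd h -> (forall x, `|x| <= K -> g x <= h x) -> I g <= I h) /\
  (forall c d g, bdd g -> I (fun x => c * g x + d) = c * I g + d).

Lemma bdd_ray b : bdd (ray b).
Proof.
split; last by exists 1 => x _; rewrite /ray; case: (b < x); rewrite ?normr1 ?normr0.
have -> : ray b = \1_(`]b, +oo[%classic : set T) :> (T -> R).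
  by apply/funext => x; rewrite indicE mem_setE in_itv /= andbT.
exact/measurable_indicP.
Qed.

Lemma bdd_horner (P : {poly R}) : bdd (fun x => P.[x]).
Proof.
have Pc : continuous (fun x => P.[x]) by exact: continuous_horner.
split; first exact: continuous_measurable_fun.
exists (\sum_(i < size P) `|P`_i| * K ^+ i) => x xK.
rewrite horner_coef; apply: le_trans (ler_norm_sum _ _ _) _.
apply: ler_sum => i _; rewrite normrM normrX ler_wpM2l //.
by rewrite lerXn2r ?nnegrE ?(ltW K0).
Qed.

Lemma bdd_affine c d g : bdd g -> bdd (fun x => c * g x + d).
Proof.
move=> [mg [M hM]]; split.
  by apply: measurable_funD => //; apply: measurable_funM.
exists (`|c| * M + `|d|) => x xK; apply: le_trans (ler_normD _ _) _.
by rewrite lerD // normrM ler_wpM2l // hM.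
Qed.

Lemma bddZ c g : bdd g -> bdd (fun x => c * g x).
Proof. by move=> /(bdd_affine c 0); under eq_fun do rewrite addr0. Qed.

(** On [-K, K] a step polynomial at [a] lies, up to e/2, between the indicators of the rays starting
    at a + d and at a - d. *)
Lemma ray_le (I J : (R -> R) -> R) : positive_functional I -> positive_functional J ->
  (forall P : {poly R}, I (fun x => P.[x]) = J (fun x => P.[x])) ->
  forall a d, 0 < d -> I (ray (a + d)) <= J (ray (a - d)).
Proof.
move=> [Im Il] [Jm Jl] IJ a d d0; apply/ler_addgt0Pr => e e0.
have [P hP] := step_poly a K0 d0 (divr_gt0 e0 (ltr0Sn _ 1)).
have h1 : I (fun x => 1 * ray (a + d) x + (- (e / 2))) <= I (fun x => P.[x]).
  apply: Im; [exact/bdd_affine/bdd_ray|exact: bdd_horner|] => x xK.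
  have [/andP[P0 P1] Pa _] := hP x xK; rewrite mul1r /ray.
  case: ltP => [/ltW /Pa //|_]; apply: le_trans P0; rewrite mulr0n; lra.
have h2 : J (fun x => P.[x]) <= J (fun x => 1 * ray (a - d) x + e / 2).
  apply: Jm; [exact: bdd_horner|exact/bdd_affine/bdd_ray|] => x xK.
  have [/andP[P0 P1] _ Pa] := hP x xK; rewrite mul1r /ray.
  case: ltP => [_|/Pa]; last by rewrite add0r.
  by apply: le_trans P1 _; rewrite mulr1n; lra.
rewrite Il in h1; last exact: bdd_ray.
rewrite Jl in h2; last exact: bdd_ray.
by rewrite IJ in h1; lra.
Qed.

(* Two finite functionals with the same moments have the same distribution
   function as soon as one of them has no atoms, here [J g = \int g f dx]. *)
Lemma ray_eq (I J : (R -> R) -> R) (M : R) :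
  positive_functional I -> positive_functional J ->
  (forall P : {poly R}, I (fun x => P.[x]) = J (fun x => P.[x])) ->
  (forall a d, 0 < d -> J (ray (a - d)) <= J (ray a) + M * d) ->
  forall a, I (ray a) = J (ray a).
Proof.
move=> Ip Jp IJ JM a.
have small (e : R) : 0 < e -> exists2 d, 0 < d & M * d <= e.
  move=> e0; exists (e / (`|M| + 1)); first by rewrite divr_gt0 // ltr_wpDl.
  rewrite mulrA ler_pdivrMr ?ltr_wpDl // mulrC ler_pM2l //.
  by apply: le_trans (ler_norm _) _; rewrite lerDl.
apply/eqP; rewrite eq_le; apply/andP; split; apply/ler_addgt0Pr => e e0;
    have [d d0 Md] := small e e0.
  have := ray_le Ip Jp IJ (a - d / 2) (divr_gt0 d0 (ltr0Sn _ 1)).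
  have -> : a - d / 2 + d / 2 = a by ring.
  have -> : a - d / 2 - d / 2 = a - d by field.
  by have := JM a d d0; lra.
have := ray_le Jp Ip (fun P => esym (IJ P)) (a + d / 2) (divr_gt0 d0 (ltr0Sn _ 1)).
have -> : a + d / 2 + d / 2 = a + d by field.
have -> : a + d / 2 - d / 2 = a by ring.
have := JM (a + d) d d0; have -> : a + d - d = a by ring.
lra.
Qed.

Let D : set T := `[- K, K]%classic.
Let mD : measurable D. Proof. exact: measurable_itv. Qed.
Let DP x : D x <-> `|x| <= K.
Proof. by rewrite /D /= in_itv /= ler_norml. Qed.

Section Integrals.
Variable m : {measure set T -> \bar R}.
Hypothesis finm : (m D < +oo)%E.

Lemma bdd_integrable g : bdd g -> m.-integrable D (EFin \o g).
Proof.
move=> [mg [M hM]]; apply: measurable_bounded_integrable => //.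
  exact: measurable_funTS.
exists M; split; first exact: num_real.
by move=> N MN x /DP xK /=; apply: le_trans (hM x xK) (ltW MN).
Qed.

Variable f : R -> R.
Hypothesis f0 : forall x, 0 <= f x.
Hypothesis fb : bdd f.
Hypothesis f1 : (\int[m]_(x in D) f x = 1)%R.

Lemma bddM g : bdd g -> bdd (fun x => g x * f x).
Proof.
move=> [mg [M hM]]; have [mf [N hN]] := fb; split; first exact: measurable_funM.
exists (`|M| * `|N|) => x xK; rewrite normrM ler_pM //.
  by apply: le_trans (hM x xK) (ler_norm _).
by apply: le_trans (hN x xK) (ler_norm _).
Qed.

(** The density factor lets one statement cover both sides of the comparison: [mu] with density 1
    and Lebesgue measure with density [f]. *)
Lemma integral_functional :
  positive_functional (fun g => (\int[m]_(x in D) (g x * f x))%R).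
Proof.
split=> [g h gb hb gh|c d g gb].
  apply: le_Rintegral => //; [exact/bdd_integrable/bddM..|].
  by move=> x /DP xK; rewrite ler_wpM2r // gh.
under eq_Rintegral do rewrite mulrDl -mulrA.
have gfb := bddM gb.
rewrite RintegralD //.
- rewrite RintegralZl //; last exact: bdd_integrable.
  by rewrite RintegralZl ?f1 ?mulr1 //; exact: bdd_integrable.
- exact/bdd_integrable/bddZ.
- exact/bdd_integrable/bddZ.
Qed.

Lemma functional_horner (P : {poly R}) :
  (\int[m]_(x in D) (P.[x] * f x) =
   \sum_(i < size P) P`_i * \int[m]_(x in D) (x ^+ i * f x))%R.
Proof.
have bX i : bdd (fun x => x ^+ i * f x).
  apply: bddM; have := bdd_horner ('X^i); by under eq_fun do rewrite hornerXn.
transitivity (\int[m]_(x in D) (\sum_(i < size P) P`_i * (x ^+ i * f x)))%R.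
  apply: eq_Rintegral => x _; rewrite horner_coef mulr_suml.
  by apply: eq_bigr => i _; rewrite mulrA.
elim: (size P) => [|k IHk].
  under eq_Rintegral do rewrite big_ord0; rewrite big_ord0.
  by rewrite Rintegral_cst // mul0r.
under eq_Rintegral do rewrite big_ord_recr /=.
rewrite RintegralD //; first by rewrite IHk RintegralZl ?[in RHS]big_ord_recr //; exact: bdd_integrable.
  have hsum : bdd (fun x => \sum_(i < k) P`_i * (x ^+ i * f x)).
    elim: k {IHk} => [|k [mk [M hM]]].
      split; first by under eq_fun do rewrite big_ord0; exact: measurable_cst.
      by exists 0 => x _; rewrite big_ord0 normr0.
    have [ma [N hN]] := bddZ P`_k (bX k).
    split.
      by under eq_fun do rewrite big_ord_recr /=; apply: measurable_funD.
    exists (M + N) => x xK; rewrite big_ord_recr /=.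
    exact: le_trans (ler_normD _ _) (lerD (hM x xK) (hN x xK)).
  exact: bdd_integrable.
exact/bdd_integrable/bddZ.
Qed.

End Integrals.

End Determinacy.

Section DensityMeasure.
Context (R : realType) (f : R -> R).
Let T := measurableTypeR R.
Hypothesis mf : measurable_fun setT (f : T -> R).
Hypothesis f0 : forall x, 0 <= f x.
Local Open Scope ereal_scope.

Definition density_measure (B : set T) : \bar R :=
  \int[@lebesgue_measure R]_(x in B) (f x)%:E.

Let density_measure0 : density_measure set0 = 0.
Proof. exact: integral_set0. Qed.

Let density_measure_ge0 B : 0 <= density_measure B.
Proof. by apply: integral_ge0 => x _; rewrite lee_fin. Qed.

Let density_measure_sigma : semi_sigma_additive density_measure.
Proof.
apply: semi_sigma_additive_nng_induced => [|x]; last by rewrite lee_fin.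
exact/measurable_EFinP.
Qed.

HB.instance Definition _ := isMeasure.Build _ _ _ density_measure
  density_measure0 density_measure_ge0 density_measure_sigma.

(** Open right rays are stable under intersection and generate the Borel sets. *)
Lemma measure_eq_density (mu : probability T R) :
  (forall a, mu `]a, +oo[%classic = density_measure `]a, +oo[%classic) ->
  forall B, measurable B -> mu B = density_measure B.
Proof.
move=> h B mB.
apply: (@measure_unique _ R T (@RGenOInfty.G R) (fun k => `](- k%:R)%R, +oo[%classic)).
- exact: RGenOInfty.measurableE.
- move=> _ _ [x ->] [y ->]; exists (Num.max x y).
  by apply/seteqP; split => z /=; rewrite !in_itv /= !andbT gt_max => /andP.
- by move=> k; exists (- k%:R)%R.
- rewrite -subTset => x _; exists (Num.truncn `|x|).+1 => //=.
  rewrite in_itv /= andbT ltrNl; apply: le_lt_trans (ler_norm _) _.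
  by rewrite normrN truncnS_gt.
- by move=> _ [a ->]; apply: h.
- by move=> k; apply: (le_lt_trans (probability_le1 _ _)); rewrite ?ltry.
- exact: mB.
Qed.

End DensityMeasure.

Section MomentDensity.
Context (R : realType) (mu : probability (measurableTypeR R) R) (f : R -> R) (K M : R).
Let T := measurableTypeR R.
Hypothesis K0 : 0 < K.
Hypothesis mf : measurable_fun setT (f : T -> R).
Hypothesis f0 : forall x, 0 <= f x.
Hypothesis fM : forall x, f x <= M.
Hypothesis fK : forall x, K < `|x| -> f x = 0.
Hypothesis imu : forall i, mu.-integrable setT (EFin \o (fun x => x ^+ i)).
Hypothesis moments : forall i,
  (\int[mu]_x (x ^+ i) = \int[@lebesgue_measure R]_(x in `[(- K)%R, K]) (x ^+ i * f x))%R.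

Let K1 := K + 1.
Let K1p : 0 < K1. Proof. by rewrite addr_gt0. Qed.
Let D : set T := `[- K1, K1]%classic.
Let leb := @lebesgue_measure R.

Let DP x : D x <-> `|x| <= K1.
Proof. by rewrite /D /= in_itv /= ler_norml. Qed.

Let mD : measurable D. Proof. exact: measurable_itv. Qed.

Let leb_fin : (leb D < +oo)%E.
Proof. by rewrite /leb /D lebesgue_measure_itv /=; case: ifP => _; rewrite ?ltry. Qed.

Let fb : bdd K1 f.
Proof. by split => //; exists M => x _; rewrite ger0_norm. Qed.

Let extend g : (\int[leb]_(x in `[(- K)%R, K]) (g x * f x) = \int[leb]_(x in D) (g x * f x))%R.
Proof.
rewrite Rintegral_mkcond [RHS]Rintegral_mkcond; apply: eq_Rintegral => x _.
rewrite /restrict /=; case: ifPn; case: ifPn => // h1 h2.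
  have : D x.
    move: h2; rewrite inE /= in_itv /= => /andP[h2 h3]; rewrite DP /K1 ler_norml; lra.
  by move=> /mem_set; rewrite (negbTE h1).
rewrite fK ?mulr0 //; rewrite ltNge; apply: contra h2 => xK.
by rewrite inE /= in_itv /= -ler_norml.
Qed.

Let mass1 : (\int[leb]_(x in D) f x = 1)%R.
Proof.
have := moments 0; rewrite extend; under eq_Rintegral do rewrite expr0.
rewrite Rintegral_cst // mul1r [X in fine X](_ : _ = 1%E) /=; last exact: probability_setT.
move=> ->.
by apply: eq_Rintegral => x _; rewrite mul1r.
Qed.

Let mu_fin : (mu D < +oo)%E.
Proof. by apply: le_lt_trans (probability_le1 mu mD) _; rewrite ltry. Qed.

Let indic_integral (m : {measure set T -> \bar R}) (A B : set T) :
  measurable A -> measurable B ->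
  (\int[m]_(x in A) \1_B x)%R = fine (m (B `&` A)).
Proof. by move=> mA mB; rewrite /Rintegral integral_indic. Qed.

(** Nothing places [mu] on a segment beforehand. Its moment of order 2i is at most K^(2i), so
    Markov's inequality bounds the mass outside [-K1, K1] by (K / K1)^(2i); the margin K1 = K + 1
    makes this tend to 0. *)
Let concentrated : mu (~` D) = 0%E.
Proof.
have mDc : measurable (~` D) by exact: measurableC.
have iDc : mu.-integrable setT (EFin \o (\1_(~` D) : T -> R)).
  by apply: integrable_indic.
have bound i : K1 ^+ i.*2 * fine (mu (~` D)) <= K ^+ i.*2.
  have -> : K1 ^+ i.*2 * fine (mu (~` D)) = (\int[mu]_x (K1 ^+ i.*2 * \1_(~` D) x))%R.
    by rewrite RintegralZl // indic_integral // setIT.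
  apply: (@le_trans _ _ (\int[mu]_x (x ^+ i.*2))%R).
    apply: le_Rintegral => //.
      by have := integrableZl measurableT (K1 ^+ i.*2) iDc; under eq_fun do rewrite -EFinM.
    move=> x _; rewrite indicE -!muln2 mulnC !exprM.
    have [|_] := boolP (x \in ~` D); last by rewrite mulr0 exprn_ge0 // sqr_ge0.
    rewrite inE => /DP /negP; rewrite -ltNge => xK; rewrite mulr1.
    by rewrite lerXn2r ?nnegrE ?sqr_ge0 // -[leRHS]real_normK ?num_real // lerXn2r ?nnegrE ?(ltW K1p) // ltW.
  rewrite moments extend -[leRHS]mulr1 -mass1 -RintegralZl //; last exact: (bdd_integrable leb_fin).
  have fXb : bdd K1 (fun x => x ^+ i.*2 * f x).
    apply: bddM => //; have := bdd_horner K1p ('X^(i.*2)).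
    by under eq_fun do rewrite hornerXn.
  apply: le_Rintegral => //; first exact: (bdd_integrable leb_fin).
    exact: (bdd_integrable leb_fin (bddZ (K ^+ i.*2) fb)).
  move=> x _; have [xK|/fK ->] := leP `|x| K; last by rewrite !mulr0.
  rewrite ler_wpM2r // -muln2 mulnC !exprM lerXn2r ?nnegrE ?sqr_ge0 //.
  by rewrite -[leLHS]real_normK ?num_real // lerXn2r ?nnegrE ?(ltW K0).
apply/eqP; rewrite -[mu _]fineK ?fin_num_measure // eqe eq_le fine_ge0 ?measure_ge0 // andbT.
apply/ler_addgt0Pr => e e0; rewrite add0r.
pose r := (K / K1) ^+ 2.
have r1 : `|r| < 1.
  rewrite ger0_norm ?sqr_ge0 // exprn_ilt1 // ?divr_ge0 ?ltW //.
  by rewrite ltr_pdivrMr // mul1r ltrDl.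
have h : (GRing.exp r) @ \oo --> (0 : R) by apply: cvg_expr.
have [N _ /(_ N (leqnn N)) /= hN] := cvgr_lt _ h _ e0.
apply: le_trans (ltW hN); rewrite /r -exprM mulnC muln2 exprMn exprVn.
by rewrite ler_pdivlMr ?exprn_gt0 // mulrC.
Qed.

Let ray_indic a x : ray a x = \1_(`]a, +oo[%classic : set T) x.
Proof. by rewrite indicE mem_setE in_itv /= andbT. Qed.

Let I g : R := (\int[mu]_(x in D) (g x * cst 1 x))%R.
Let J g : R := (\int[leb]_(x in D) (g x * f x))%R.

Let bdd1 : bdd K1 (cst 1).
Proof. by split => //; exists 1 => x _; rewrite normr1. Qed.

Let mu_ray a : mu `]a, +oo[%classic = (I (ray a))%:E.
Proof.
have mA : measurable (`]a, +oo[%classic : set T) by exact: measurable_itv.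
rewrite /I; under eq_Rintegral do rewrite mulr1 ray_indic.
rewrite indic_integral // fineK ?fin_num_measure //; last exact: measurableI.
rewrite (measureDI mu mA mD) [X in (X + _)%E = _](_ : _ = 0%E) ?add0e //.
apply/eqP; rewrite eq_le measure_ge0 andbT -concentrated le_measure ?inE //.
  exact: measurableD.
exact: measurableC.
Qed.

Let leb_ray a : density_measure f `]a, +oo[%classic = (J (ray a))%:E.
Proof.
have gb := bddM fb (bdd_ray K1 a).
have := integrable_fin_num mD (bdd_integrable leb_fin gb).
rewrite /J /Rintegral => /fineK ->; rewrite /density_measure.
rewrite [LHS]integral_mkcond [RHS]integral_mkcond; congr (integral _ _ _); apply/funext => x.
have axE : (x \in (`]a, +oo[%classic : set T)) = (a < x).
  by rewrite mem_setE in_itv /= andbT.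
rewrite /restrict /patch axE /ray /=.
case: (boolP (a < x)) => ax; case: ifPn => // xD.
- by rewrite mul1r.
- rewrite fK //; rewrite ltNge; apply: contra xD => xK; rewrite inE DP.
  by apply: le_trans xK _; rewrite lerDl.
- by rewrite mul0r.
Qed.

Let J_step a d : 0 < d -> J (ray (a - d)) <= J (ray a) + M * d.
Proof.
move=> d0; have M0 : 0 <= M by apply: le_trans (f0 0) (fM 0).
have mB : measurable (`](a - d), a]%classic : set T) by exact: measurable_itv.
have bB : bdd K1 (\1_(`](a - d), a]%classic : set T) : T -> R).
  split; first exact/measurable_indicP.
  by exists 1 => x _; rewrite indicE; case: (_ \in _); rewrite ?normr1 ?normr0.
have iB := bdd_integrable leb_fin bB.
have iMB := bdd_integrable leb_fin (bddZ M bB).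
have := bdd_integrable leb_fin (bddM fb (bdd_ray K1 a)) => iF.
apply: (@le_trans _ _ (\int[leb]_(x in D) (ray a x * f x + M * \1_(`](a - d), a]%classic : set T) x))%R).
  apply: le_Rintegral => //.
  - exact: (bdd_integrable leb_fin (bddM fb (bdd_ray K1 (a - d)))).
  - by have := integrableD mD iF iMB; apply: eq_integrable => // x _ /=; rewrite EFinD.
  - move=> x _; rewrite /ray indicE mem_setE in_itv /=.
    have [ax|xa] := ltP a x.
      have -> : a - d < x by lra.
      by rewrite andbF mulr0 addr0.
    rewrite mul0r add0r andbT; case: ltP => _; last by rewrite mul0r mulr0.
    by rewrite mul1r mulr1.
rewrite RintegralD //.
rewrite lerD // RintegralZl // ler_wpM2l // indic_integral //.
rewrite -lee_fin fineK.
  apply: (@le_trans _ _ (leb `](a - d), a]%classic)).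
    by apply: le_measure; rewrite ?inE //; apply: measurableI.
  by rewrite /leb lebesgue_measure_itv /= lte_fin ltrBlDr ltrDl d0 -EFinB opprB addrC subrK.
rewrite ge0_fin_numE ?measure_ge0 //; apply: le_lt_trans leb_fin.
by apply: le_measure; rewrite ?inE //; apply: measurableI.
Qed.

Theorem moment_density : is_density mu f.
Proof.
split => // B mB; apply: measure_eq_density => // a; rewrite mu_ray leb_ray.
congr (_%:E); apply: (@ray_eq R K1 K1p I J M); last exact: J_step.
- apply: integral_functional => //.
  rewrite Rintegral_cst // mul1r.
  have e : mu setT = (mu (~` D) + mu D)%E.
    rewrite -[X in (mu X + _)%E]setTD -[X in (_ + mu X)%E]setTI.
    exact: measureDI.
  rewrite concentrated add0e in e; rewrite [X in fine X](_ : _ = 1%E) //.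
  by rewrite -[RHS](probability_setT mu) e.
- exact: integral_functional.
move=> P; rewrite /I /J !functional_horner //; apply: eq_bigr => i _; congr (_ * _).
rewrite -extend -moments.
have -> : (\int[mu]_x (x ^+ i) = \int[mu]_(x in D `|` ~` D) (x ^+ i))%R by rewrite setUv.
rewrite Rintegral_setU //; first last.
- by apply/disj_setPS => x [].
- by rewrite setUv.
- exact: measurableC.
rewrite [X in _ = _ + X](_ : _ = 0) ?addr0; first by apply: eq_Rintegral => x _; rewrite mulr1.
rewrite /Rintegral null_set_integral //; first exact: measurableC.
by apply: measurable_funTS; apply: (measurable_int mu (imu i)).
Qed.

End MomentDensity.

(** * Atoms and support of a measure with a density *)

Section Support.
Context (R : realType) (mu : probability (measurableTypeR R) R) (f : R -> R).
Hypothesis df : is_density mu f.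

Lemma density_no_atom x : mu [set x] = 0%E.
Proof.
have [_ _ h] := df; rewrite h; last exact: measurable_set1.
exact: integral_set1.
Qed.

Lemma density_open_gt0 (U : set R) y : open U -> U y -> 0 < f y ->
  {for y, continuous f} -> (0 < mu U)%E.
Proof.
move=> oU Uy fy cf; have [mf f0 h] := df.
have f2 : f y / 2 < f y by rewrite ltr_pdivrMr // mulr_natr mulr2n ltrDl.
have n1 : \forall x \near y, f y / 2 < f x by apply: (cvgr_gt _ cf).
have n2 : \forall x \near y, U x by apply: open_nbhs_nbhs.
have [r /= r0 hr] : nbhs y (fun x => f y / 2 < f x /\ U x).
  by apply: filterS2 n1 n2 => x ? ?; split.
pose V : set (measurableTypeR R) := `](y - r), (y + r)[%classic.
have mV : measurable V by exact: measurable_itv.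
have VP x : V x -> f y / 2 < f x /\ U x.
  by rewrite /V /= in_itv /= => /andP[a b]; apply: hr; rewrite /= ltr_norml; apply/andP; split; lra.
have mU : measurable (U : set (measurableTypeR R)) by exact: open_measurable.
apply: (@lt_le_trans _ _ (mu V)); last first.
  by apply: le_measure; rewrite ?inE // => x /VP[].
rewrite h //; apply: (@lt_le_trans _ _ (\int[lebesgue_measure]_(x in V) (f y / 2)%:E)%E).
  have yr : y - r < y + r by lra.
  have eV := @lebesgue_measure_itv R `](y - r), (y + r)[.
  rewrite /= lte_fin yr in eV; rewrite integral_cst // [X in (_ * X)%E]eV.
  by rewrite -EFinB -EFinM lte_fin mulr_gt0 ?divr_gt0 //; lra.
apply: ge0_le_integral => //.
- by move=> x _; rewrite lee_fin divr_ge0 // ltW.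
- by apply/measurable_EFinP; apply: measurable_funTS.
- by move=> x /VP[/ltW + _]; rewrite lee_fin.
Qed.

(** The point 0 is exempt because the density for n = 2 vanishes there; it still lies in the support
    as a limit of points of positive density. *)
Lemma msupport_density (K : R) : 0 < K ->
  (forall x, K < `|x| -> f x = 0) ->
  (forall x, `|x| < K -> x != 0 -> 0 < f x /\ {for x, continuous f}) ->
  msupport mu = [set x : R | - K <= x <= K].
Proof.
move=> K0 fK fpos; have [mf f0 h] := df.
apply/seteqP; split => x /=.
  move=> sx; rewrite -ler_norml leNgt; apply/negP => xK.
  have oV : open [set y : R | K < `|y|].
    have -> : [set y : R | K < `|y|] = Num.norm @^-1` [set y | K < y] by [].
    by apply: open_comp => [y _|]; [exact: norm_continuous | exact: open_gt].
  have := sx _ oV xK; rewrite h; last exact: open_measurable.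
  by rewrite (eq_integral (cst 0%E)) ?integral0 ?ltxx // => y; rewrite inE /= => /fK ->.
rewrite -ler_norml => xK U oU Ux.
have [r /= r0 hr] : nbhs x U by apply: open_nbhs_nbhs.
have [y [yx yK y0]] : exists y, [/\ `|x - y| < r, `|y| < K & y != 0].
  have [->|x0] := eqVneq x 0.
    exists (Num.min r K / 2).
    have m0 : 0 < Num.min r K by rewrite lt_min r0.
    have mr : Num.min r K <= r by rewrite ge_min lexx.
    have mK : Num.min r K <= K by rewrite ge_min lexx orbT.
    rewrite sub0r normrN gtr0_norm ?divr_gt0 //; split; [lra|lra|].
    by rewrite lt0r_neq0 // divr_gt0.
  (* Moving [x] towards 0 by the factor 1 - t enters the open segment; t <= 1/2 keeps the point
     nonzero, and 2Kt <= r keeps it within distance r. *)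
  pose t := Num.min (1 / 2) (r / (2 * K)).
  have K2 : 0 < 2 * K by lra.
  have t0 : 0 < t by rewrite lt_min divr_gt0 //= divr_gt0.
  have t2 : t <= 1 / 2 by rewrite ge_min lexx.
  have tr : t * (2 * K) <= r by rewrite -ler_pdivlMr // ge_min lexx orbT.
  exists (x * (1 - t)); split.
  - have -> : x - x * (1 - t) = x * t by ring.
    rewrite normrM (gtr0_norm t0).
    have : `|x| * t <= K * t by rewrite ler_pM2r.
    by have : 0 < t * K; [rewrite mulr_gt0 | lra].
  - rewrite normrM (@ger0_norm _ (1 - t)); last by lra.
    by apply: lt_le_trans xK; rewrite gtr_pMr ?normr_gt0 //; lra.
  - by rewrite mulf_neq0 // lt0r_neq0 //; lra.
have [fy cy] := fpos y yK y0.
exact: density_open_gt0 (hr y yx) fy cy.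
Qed.

End Support.

(** * Geometrically convergent series *)

Section GeometricSeries.
Context (R : realType).
Implicit Types (u v : nat -> R).

Definition geo_by (C r : R) u := [/\ 0 <= r, r < 1 & forall s, `|u s| <= C * r ^+ s].
Definition geo u := exists C r, geo_by C r u.
Definition gsum u : R := lim ((fun N => \sum_(s < N) u s) @ \oo).

Lemma geo_by_ge0 C r u : geo_by C r u -> 0 <= C.
Proof. by case=> _ _ /(_ 0%N); rewrite expr0 mulr1; apply: le_trans. Qed.

Lemma geo_by_tail C r u N M : geo_by C r u -> (N <= M)%N ->
  `|\sum_(s < M) u s - \sum_(s < N) u s| <= C * r ^+ N / (1 - r).
Proof.
move=> gu NM; have C0 := geo_by_ge0 gu; have [r0 r1 h] := gu.
have r1p : 0 < 1 - r by rewrite subr_gt0.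
suff main k : `|\sum_(s < N + k) u s - \sum_(s < N) u s| <= C * r ^+ N * ((1 - r ^+ k) / (1 - r)).
  rewrite -(subnKC NM); apply: le_trans (main _) _.
  apply: ler_wpM2l; first by rewrite mulr_ge0 ?exprn_ge0.
  by rewrite ler_pdivrMr // mulVf ?lt0r_neq0 // gerBl exprn_ge0.
elim: k => [|k IHk]; first by rewrite addn0 subrr normr0 expr0 subrr mul0r mulr0.
rewrite addnS big_ord_recr /= addrAC.
apply: le_trans (ler_normD _ _) _; apply: le_trans (lerD IHk (h _)) _.
rewrite exprD mulrA -mulrDr ler_wpM2l ?mulr_ge0 ?exprn_ge0 //.
by rewrite exprS le_eqVlt; apply/orP; left; apply/eqP; field; exact: lt0r_neq0.
Qed.

Lemma geo_cvg u : geo u -> (fun N => \sum_(s < N) u s) @ \oo --> gsum u.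
Proof.
move=> [C [r gu]]; suff [l hl] : exists l : R, (fun N => \sum_(s < N) u s) @ \oo --> l.
  by have -> : gsum u = l by exact: (cvg_lim (@Rhausdorff R) hl).
have C0 := geo_by_ge0 gu; have [r0 r1 _] := gu.
have r1p : 0 < 1 - r by rewrite subr_gt0.
apply: real_complete => e e0.
have h : (GRing.exp r) @ \oo --> (0 : R) by apply: cvg_expr; rewrite ger0_norm.
have d0 : 0 < e / 2 * (1 - r) / (C + 1) by rewrite !(mulr_gt0, invr_gt0) // ltr_wpDl.
have [N _ /(_ N (leqnn N)) /= hN] := cvgr_lt _ h _ d0.
have small M : (N <= M)%N -> `|\sum_(s < M) u s - \sum_(s < N) u s| < e / 2.
  move=> NM; apply: le_lt_trans (geo_by_tail gu NM) _.
  rewrite ltr_pdivrMr //; apply: le_lt_trans (_ : (C + 1) * r ^+ N < _).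
    by rewrite ler_wpM2r ?exprn_ge0 // lerDl.
  by rewrite mulrC -ltr_pdivlMr // ltr_wpDl.
exists N => m n mN nN.
rewrite -[X in `|X|](subrKA (\sum_(s < N) u s)) [e]splitr.
apply: le_lt_trans (ler_normD _ _) _; apply: ltrD; first exact: small.
by rewrite distrC small.
Qed.

Lemma gsum_tail C r u N : geo_by C r u ->
  `|gsum u - \sum_(s < N) u s| <= C * r ^+ N / (1 - r).
Proof.
move=> gu; have h := @geo_cvg u (ex_intro _ C (ex_intro _ r gu)).
have h2 : (fun M => `|\sum_(s < M) u s - \sum_(s < N) u s|) @ \oo -->
    `|gsum u - \sum_(s < N) u s|.
  by apply: cvg_norm; apply: cvgB => //; apply: cvg_cst.
apply: (cvgr_to_le h2); exists N => // M /= NM; exact: geo_by_tail.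
Qed.

Lemma gsum_bound C r u : geo_by C r u -> `|gsum u| <= C / (1 - r).
Proof. by move=> /(gsum_tail 0); rewrite big_ord0 subr0 expr0 mulr1. Qed.

Lemma geoZ (c : R) u : geo u -> geo (fun s => c * u s).
Proof.
move=> [C [r [r0 r1 h]]]; exists (`|c| * C), r; split => // s.
by rewrite normrM -mulrA ler_wpM2l.
Qed.

Lemma geoS u : geo u -> geo (fun s => u s.+1).
Proof.
move=> [C [r gu]]; have C0 := geo_by_ge0 gu; have [r0 r1 h] := gu.
exists C, r; split => // s; apply: le_trans (h _) _.
by rewrite ler_wpM2l // exprS ler_piMl ?exprn_ge0 // ltW.
Qed.

Lemma gsumD u v : geo u -> geo v -> gsum (fun s => u s + v s) = gsum u + gsum v.
Proof.
move=> gu gv; apply: (cvg_lim (@Rhausdorff R)).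
by under eq_fun do rewrite big_split /=; apply: cvgD; apply: geo_cvg.
Qed.

Lemma gsumZ (c : R) u : geo u -> gsum (fun s => c * u s) = c * gsum u.
Proof.
move=> gu; apply: (cvg_lim (@Rhausdorff R)).
by under eq_fun do rewrite -mulr_sumr; apply: cvgMl_tmp; apply: geo_cvg.
Qed.

Lemma gsumS u : geo u -> gsum u = u 0%N + gsum (fun s => u s.+1).
Proof.
move=> gu; apply: (cvg_lim (@Rhausdorff R)); rewrite -cvg_shiftS.
rewrite [X in X @ _ --> _](_ : _ = fun N => u 0%N + \sum_(s < N) u s.+1); last first.
  by apply/funext => N; rewrite /= big_ord_recl.
by apply: cvgD; [apply: cvg_cst | apply/geo_cvg/geoS].
Qed.

Lemma eq_gsum u v : u =1 v -> gsum u = gsum v.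
Proof. by move=> uv; congr gsum; apply/funext. Qed.

End GeometricSeries.

(** * The density in the Chebyshev basis *)

Section Chebyshev.
Context (R : realType).
Implicit Type x : R.

Fixpoint chebV k x : R :=
  match k with
  | 0 => 1
  | k1.+1 => match k1 with 0 => x | k2.+1 => x * chebV k1 x - chebV k2 x end
  end.

Lemma chebVS k x : chebV k.+2 x = x * chebV k.+1 x - chebV k x.
Proof. by []. Qed.

Definition chebE s x : R := chebV s.*2 x.

Lemma chebES s x : chebE s.+2 x = (x ^+ 2 - 2) * chebE s.+1 x - chebE s x.
Proof.
rewrite /chebE !doubleS (chebVS s.*2.+2) (chebVS s.*2.+1).
have -> : chebV s.*2 x = x * chebV s.*2.+1 x - chebV s.*2.+2 x by rewrite chebVS; ring.
ring.
Qed.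

(** Since |x^2 - 2| <= 2, the rate 5/2 propagates through the recursion because 2 (5/2) + 1 <=
    (5/2)^2. It is far from the linear truth, but still below 1/p. *)
Lemma chebE_bound s x : `|x| <= 2 -> `|chebE s x| <= 3 * (5 / 2) ^+ s.
Proof.
move=> x2; have x4 : x ^+ 2 <= 4.
  rewrite -real_normK ?num_real //; have -> : 4 = 2 ^+ 2 :> R by rewrite expr2; ring.
  by rewrite lerXn2r ?nnegrE.
have x0 := sqr_ge0 x.
suff : `|chebE s x| <= 3 * (5 / 2) ^+ s /\ `|chebE s.+1 x| <= 3 * (5 / 2) ^+ s.+1 by case.
elim: s => [|s [IH1 IH2]].
  rewrite /chebE /= expr0 expr1 normr1; split; first lra.
  by rewrite -expr2 ler_norml; apply/andP; split; lra.
split=> //; rewrite chebES; apply: le_trans (ler_normB _ _) _.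
rewrite normrM; have h : `|x ^+ 2 - 2| <= 2 by rewrite ler_norml; apply/andP; split; lra.
have h2 : `|x ^+ 2 - 2| * `|chebE s.+1 x| <= 2 * (3 * (5 / 2) ^+ s.+1).
  by rewrite ler_pM.
apply: le_trans (lerD h2 IH1) _; rewrite !exprS.
by have := exprn_ge0 s (_ : 0 <= 5 / 2 :> R) => /(_ ltac:(lra)); lra.
Qed.

Variable p : R.
Hypothesis p0 : 0 < p.
Hypothesis p25 : p < 2 / 5.
Let q := - p.
Let p1 : p < 1. Proof. by move: p25; lra. Qed.
Local Notation gc := (cheb_coef p).

Lemma subp_le k : 1 - p <= 1 + q ^+ k.+1.
Proof.
have : - q ^+ k.+1 <= p.
  apply: le_trans (ler_norm _) _; rewrite normrN (normqX p0).
  by rewrite exprS ler_piMr ?(ltW p0) // exprn_ile1 // ltW.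
lra.
Qed.

(** As q < 0, one of two consecutive factors has an even exponent and is at least 1; the other is
    bounded by [subp_le], or is also at least 1 when its exponent is 0. *)
Lemma subp_le_prod k : 1 - p <= (1 + q ^+ k) * (1 + q ^+ k.+1).
Proof.
have even_ge1 m : ~~ odd m -> 1 <= 1 + q ^+ m.
  by move=> me; rewrite lerDl exprn_even_ge0.
have [ko|ke] := boolP (odd k).
  have h : 1 <= 1 + q ^+ k.+1 by apply: even_ge1; rewrite /= negbK.
  case: k ko h => // k _ h; apply: le_trans (subp_le k) _.
  by rewrite ler_peMr // ltW // addqX_gt0.
have h := even_ge1 k ke; apply: le_trans (subp_le k) _.
by rewrite ler_peMl // ltW // addqX_gt0.
Qed.

Lemma cheb_coef_bound s : 0 < gc s <= 2 * p ^+ s.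
Proof.
have d0 : 0 < (1 + q ^+ s) * (1 + q ^+ s.+1) by rewrite mulr_gt0 // addqX_gt0.
have num0 : 0 < 2 * p ^+ s by rewrite mulr_gt0 // exprn_gt0.
apply/andP; split; first by rewrite divr_gt0 // mulr_gt0 // subr_gt0.
by rewrite ler_pdivrMr // ler_wpM2l ?subp_le_prod // ltW.
Qed.

Definition gterm x s := gc s * chebE s x.
Definition gfun x : R := gsum (gterm x).

Let r := p * (5 / 2).
Let r0 : 0 <= r. Proof. by rewrite /r mulr_ge0 ?ltW //; lra. Qed.
Let r1 : r < 1. Proof. by rewrite /r; move: p25; lra. Qed.

Lemma gterm_geo x : `|x| <= 2 -> geo_by 6 r (gterm x).
Proof.
move=> x2; split => // s; have /andP[g0 g1] := cheb_coef_bound s.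
rewrite /gterm normrM (gtr0_norm g0) exprMn.
have -> : 6 * (p ^+ s * (5 / 2) ^+ s) = (2 * p ^+ s) * (3 * (5 / 2) ^+ s) by ring.
by rewrite ler_pM ?chebE_bound // ltW.
Qed.

Lemma gterm0 x : gterm x 0 = 1.
Proof.
rewrite /gterm /chebE /= mulr1 /cheb_coef !expr0 expr1 mulr1.
have h : 1 - p != 0 by rewrite lt0r_neq0 // subr_gt0.
by field; rewrite h.
Qed.

Section Positivity.
Variable x : R.
Hypothesis x2 : `|x| <= 2.

Let W s := chebE s.+1 x + chebE s x.

Let WS s : W s.+2 = (x ^+ 2 - 2) * W s.+1 - W s.
Proof. by rewrite /W chebES (chebES s); ring. Qed.

Let W_bound s : `|W s| <= 11 * (5 / 2) ^+ s.
Proof.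
apply: le_trans (ler_normD _ _) _.
apply: le_trans (lerD (chebE_bound _ x2) (chebE_bound _ x2)) _.
have : 0 <= (5 / 2) ^+ s :> R by rewrite exprn_ge0 //; lra.
by rewrite exprS; lra.
Qed.

Let W_geo (c : nat -> R) C : (forall s, `|c s| <= C * p ^+ s) ->
  geo_by (C * 11) r (fun s => c s * W s).
Proof.
move=> hc; split => // s; rewrite normrM exprMn mulrACA.
by rewrite ler_pM.
Qed.

(** For negative c, the bound x^2 <= 4 makes (1 + c)^2 a lower bound of the denominator. *)
Let theta_den (c : R) : `|c| < 1 -> 0 < (1 - c) ^+ 2 + c * x ^+ 2.
Proof.
rewrite ltr_norml => /andP[c0 c1].
have x4 : x ^+ 2 <= 4.
  rewrite -real_normK ?num_real //; have -> : 4 = 2 ^+ 2 :> R by rewrite expr2; ring.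
  by rewrite lerXn2r ?nnegrE.
have [cp|cn] := leP 0 c.
  apply: ltr_wpDr; first by rewrite mulr_ge0 ?sqr_ge0.
  by rewrite exprn_even_gt0 //= subr_eq0 gt_eqF.
have h : c * 4 <= c * x ^+ 2 by rewrite ler_wnM2l // ltW.
have : 0 < (1 + c) ^+ 2 by rewrite exprn_even_gt0 //= lt0r_neq0 //; lra.
have -> : (1 + c) ^+ 2 = (1 - c) ^+ 2 + c * 4 by ring.
lra.
Qed.

(** The two-step recursion of [W] gives a linear equation for the sum, whose coefficient 1 + c (x^2
    - 2) + c^2 is the denominator. *)
Let theta_sum (c : R) : `|c| <= p ->
  gsum (fun s => (-1) ^+ s * c ^+ s.+1 * W s) = c * x ^+ 2 / ((1 - c) ^+ 2 + c * x ^+ 2).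
Proof.
move=> cp; pose t s := (-1) ^+ s * c ^+ s.+1 * W s.
have gt : geo t.
  exists (p * 11), r; apply: W_geo => s.
  rewrite normrM normrX normrN1 expr1n mul1r normrX exprS.
  by rewrite ler_pM ?exprn_ge0 // lerXn2r ?nnegrE // ltW.
have h := lt0r_neq0 (theta_den (le_lt_trans cp p1)).
have tS s : t s.+2 = - c * (x ^+ 2 - 2) * t s.+1 + - c ^+ 2 * t s.
  by rewrite /t WS !exprS; ring.
have e1 := gsumS gt; have e2 := gsumS (geoS gt).
have e3 : gsum (fun s => t s.+2) = - c * (x ^+ 2 - 2) * gsum (fun s => t s.+1) + - c ^+ 2 * gsum t.
  by rewrite (eq_gsum tS) gsumD ?gsumZ //; try apply: geoZ => //; exact: geoS.
rewrite e3 in e2.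
have t0 : t 0%N = c * x ^+ 2.
  by rewrite /t /W /chebE /= expr0 expr1; ring.
have t1 : t 1%N = - c ^+ 2 * (x ^+ 2 - 2) * x ^+ 2.
  by rewrite /t /W /chebE /= expr1 !exprS expr0; ring.
rewrite -/t; apply: (mulIf h); rewrite divfK //.
have e4 : gsum (fun s => t s.+1) = gsum t - t 0%N by rewrite e1 addrC addKr.
rewrite e4 t0 t1 in e2.
have -> : gsum t * ((1 - c) ^+ 2 + c * x ^+ 2) =
  c * x ^+ 2 + (gsum t - c * x ^+ 2 - (- c ^+ 2 * (x ^+ 2 - 2) * x ^+ 2 +
     (- c * (x ^+ 2 - 2) * (gsum t - c * x ^+ 2) + - c ^+ 2 * gsum t))) by ring.
by rewrite -e2 subrr addr0.
Qed.

(* U_j + U_{j+1} = theta (q^j), and g x is an affine function of U_1. *)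
Let U j := gsum (fun s => (-1) ^+ s * (q ^+ s.+1) ^+ j / (1 + q ^+ s.+1) * W s).

Let U_geo j : geo_by (p ^+ j * (p / (1 - p)) * 11) r
  (fun s => (-1) ^+ s * (q ^+ s.+1) ^+ j.+1 / (1 + q ^+ s.+1) * W s).
Proof.
have p1p : 0 < 1 - p by rewrite subr_gt0.
apply: W_geo => s; rewrite normrM normfV normrM normrX normrN1 expr1n mul1r.
rewrite normrX (normqX p0) (gtr0_norm (addqX_gt0 p0 p1 _)) -exprM.
rewrite ler_pdivrMr ?addqX_gt0 //.
apply: (@le_trans _ _ (p ^+ j * (p / (1 - p)) * p ^+ s * (1 - p))); last first.
  rewrite ler_wpM2l ?subp_le // mulr_ge0 ?exprn_ge0 ?(ltW p0) // mulr_ge0 ?exprn_ge0 ?(ltW p0) //.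
  by rewrite divr_ge0 // ltW.
have -> : p ^+ j * (p / (1 - p)) * p ^+ s * (1 - p) = p ^+ (j + s.+1).
  rewrite exprD exprS; field; exact: lt0r_neq0.
apply: ler_wiXn2l; rewrite ?(ltW p0) ?(ltW p1) //.
by rewrite mulSn -addSnnS leq_add2l leq_pmulr.
Qed.

(** Consecutive [U] differ by a factor q^(s+1) in each term, so their sum cancels the denominators 1
    + q^(s+1) and leaves [theta_sum] at c = q^(j+1). *)
Let U_step j : U j.+1 + U j.+2 = q ^+ j.+1 * x ^+ 2 / ((1 - q ^+ j.+1) ^+ 2 + q ^+ j.+1 * x ^+ 2).
Proof.
rewrite -theta_sum; last first.
  rewrite (normqX p0) exprS ler_piMr ?(ltW p0) // exprn_ile1 // ltW //.
rewrite /U -gsumD; try by eexists; eexists; exact: U_geo.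
apply: eq_gsum => s; rewrite -!exprM.
have h := lt0r_neq0 (addqX_gt0 p0 p1 s.+1).
rewrite -mulrDl; congr (_ * _); rewrite (mulnC j.+1) (mulnS s.+1 j.+1) (exprD q s.+1).
by field; rewrite -/q h.
Qed.

(** Unrolling [U_step] gives the alternating sum of the theta (q^(N+1)). The sign of theta (q^(N+1))
    is that of q^(N+1) and (-1)^N q^(N+1) = - p^(N+1), so no term is positive; the remainder decays
    geometrically. *)
Let U1_le0 : U 1 <= 0.
Proof.
have alt N : exists2 b, b <= 0 & U 1 = b + (-1) ^+ N * U N.+1.
  elim: N => [|N [b b0 IH]]; first by exists 0; rewrite // expr0 mul1r add0r.
  have := U_step N; set th := (X in _ = X) => e.
  exists (b + (-1) ^+ N * th); last by rewrite IH -e exprS; ring.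
  rewrite -[leRHS]addr0 lerD // /th 2!mulrA.
  have -> : (-1) ^+ N * q ^+ N.+1 = - p ^+ N.+1.
    by rewrite /q -[X in X ^+ N.+1]mulN1r exprMn mulrA -exprD addnS addnn exprS -mul2n exprM sqrrN !expr1n mulr1 mulN1r.
  have qN1 : `|q ^+ N.+1| < 1 by rewrite (normqX p0) exprn_ilt1 // ltW.
  rewrite 2!mulNr oppr_le0 divr_ge0 ?(ltW (theta_den qN1)) //.
  by rewrite mulr_ge0 ?sqr_ge0 // exprn_ge0 // ltW.
have {}alt N : U 1 <= p ^+ N * (p / (1 - p) * 11 / (1 - r)).
  have [b b0 ->] := alt N; rewrite -[leRHS]add0r lerD //.
  apply: le_trans (ler_norm _) _; rewrite normrM normrX normrN1 expr1n mul1r.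
  by apply: le_trans (gsum_bound (U_geo N)) _; rewrite !mulrA.
have h : (fun N => p ^+ N * (p / (1 - p) * 11 / (1 - r))) @ \oo --> (0 : R).
  rewrite -[X in _ --> X](mul0r (p / (1 - p) * 11 / (1 - r))).
  by apply: cvgMr_tmp; apply: cvg_expr; rewrite gtr0_norm.
by apply: (cvgr_to_ge h); exists 0%N.
Qed.

(** Up to the factor tau_1, g_s is 2 (-1)^s (b_s - b_{s+1}) with b_s = q^s / (1 + q^s). Adding 2
    U_1, whose terms are 2 (-1)^s b_{s+1} (V_{2s} + V_{2s+2}), makes the series telescope to a_0 =
    1: this is [key], and U_1 <= 0 concludes. *)
Lemma gfun_gt0 : 0 < gfun x.
Proof.
pose b s := q ^+ s / (1 + q ^+ s).
pose a s := 2 * (-1) ^+ s * b s * chebE s x.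
have p1p : 0 < 1 - p by rewrite subr_gt0.
have ga : geo a.
  exists (6 / (1 - p)), r; split => // s.
  have den0 := addqX_gt0 p0 p1 s.
  rewrite /a /b !normrM normfV normrX normrN1 expr1n mulr1 (normqX p0) gtr0_norm // (gtr0_norm den0).
  have -> : 6 / (1 - p) * r ^+ s = (2 * (p ^+ s / (1 - p))) * (3 * (5 / 2) ^+ s).
    by rewrite /r exprMn; field; exact: lt0r_neq0.
  apply: ler_pM; rewrite ?chebE_bound // ?mulr_ge0 ?invr_ge0 ?exprn_ge0 ?(ltW p0) ?(ltW den0) //.
  rewrite ler_wpM2l // ler_wpM2l ?exprn_ge0 ?(ltW p0) // lef_pV2 ?posrE //.
  case: (s) => [|s']; last exact: subp_le.
  by rewrite expr0; have := p0; lra.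
have gU : geo (fun s => (-1) ^+ s * (q ^+ s.+1) ^+ 1 / (1 + q ^+ s.+1) * W s).
  by do 2!eexists; exact: U_geo.
have gG : geo (gterm x) by do 2!eexists; exact: gterm_geo.
have t1 : 0 < tau p 1.
  by rewrite /tau divr_gt0 // ?subqX_gt0 // addqX_gt0.
have key : tau p 1 * gfun x + 2 * U 1 = 1.
  rewrite /gfun /U -!gsumZ // -gsumD; try exact: geoZ.
  transitivity (gsum a + (-1) * gsum (fun s => a s.+1)); last first.
    rewrite (gsumS ga) mulN1r addrK /a /b /chebE /= !expr0 !mulr1 mul1r.
    by rewrite divff // pnatr_eq0.
  rewrite -gsumZ -?gsumD //; [|exact/geoZ/geoS | exact: geoS].
  apply: eq_gsum => s; rewrite /gterm /a /b /W /tau /cheb_coef -/q.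
  have h0 := lt0r_neq0 (addqX_gt0 p0 p1 s).
  have h1 := lt0r_neq0 (addqX_gt0 p0 p1 s.+1).
  have h2 := lt0r_neq0 (addqX_gt0 p0 p1 1).
  have -> : p ^+ s = (-1) ^+ s * q ^+ s by rewrite -exprMn mulN1r opprK.
  move: h0 h1 h2; rewrite -/q !exprS !expr0.
  move: (q ^+ s) ((-1) ^+ s) => y z h0 h1; rewrite !mulr1 => h2.
  by field; rewrite h0 h1 h2.
by rewrite -(pmulr_rgt0 _ t1); have := U1_le0; lra.
Qed.

End Positivity.
End Chebyshev.

(** * Integration on segments and orthonormality of the Chebyshev polynomials *)

Section SegmentIntegral.
Context (R : realType).
Implicit Types (f F G : R -> R).
Local Notation mu := lebesgue_measure.

Lemma continuous_integrable f (a b : R) : continuous f ->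
  mu.-integrable `[a, b] (EFin \o f).
Proof.
move=> cf; apply: continuous_compact_integrable; first exact: segment_compact.
exact: continuous_subspaceT.
Qed.

Lemma continuous_ftc f F (a b : R) : a < b -> continuous f ->
  (forall x : R, is_derive x 1 F (f x)) ->
  (\int[mu]_(x in `[a, b]) f x = F b - F a)%R.
Proof.
move=> ab cf dF; rewrite /Rintegral (@continuous_FTC2 _ f F) //.
- exact: continuous_subspaceT.
- have cF : continuous F.
    by move=> x; apply/differentiable_continuous/derivable1_diffP/ex_derive.
  split; first by move=> x _; apply: ex_derive.
    exact/cvg_at_right_filter/cF.
  exact/cvg_at_left_filter/cF.
- by move=> x _; rewrite derive1E; apply: derive_val.
Qed.

End SegmentIntegral.

Section Orthogonality.
Context (R : realType).
Local Notation mu := (@lebesgue_measure R).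

Lemma sin_natr_pi k : sin (k%:R * pi) = 0 :> R.
Proof.
elim: k => [|k IHk]; first by rewrite mul0r sin0.
by rewrite mulrSr mulrDl mul1r sinDpi IHk oppr0.
Qed.

Lemma chebV_sin k (t : R) : chebV k (2 * cos t) * sin t = sin (k.+1%:R * t).
Proof.
suff : chebV k (2 * cos t) * sin t = sin (k.+1%:R * t) /\
  chebV k.+1 (2 * cos t) * sin t = sin (k.+2%:R * t) by case.
elim: k => [|k [IH1 IH2]].
  by rewrite /= !mul1r [in sin (2 * t)]mulr_natl mulr2n sinD; split=> //; ring.
split=> //; rewrite chebVS mulrBl -(mulrA _ (chebV _ _)) IH2 IH1.
have -> : k.+3%:R * t = k.+2%:R * t + t by rewrite (mulrSr 1 k.+2) mulrDl mul1r.
have -> : k.+1%:R * t = k.+2%:R * t - t by rewrite (mulrSr 1 k.+1) mulrDl mul1r addrK.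
by rewrite sinB sinD; ring.
Qed.

(* A primitive of [cos (c t)]. *)
Let S (c t : R) := if c == 0 then t else sin (c * t) / c.

Let is_derive_S c (t : R) : is_derive t 1 (S c) (cos (c * t)).
Proof.
rewrite /S; case: eqVneq => [->|c0].
  by rewrite mul0r cos0; apply: is_derive_id.
have -> : (fun t => sin (c * t) / c) = c^-1 \*: (@sin R \o (c \*: (@id R))).
  by apply/funext => y; rewrite /= mulrC.
apply: is_derive_eq; rewrite /GRing.scale /=.
by rewrite mulr1 mulrCA mulVf // mulr1.
Qed.

Lemma sin_orthogonal j k :
  (\int[mu]_(t in `[0, pi]) (2 / pi * (sin (j.+1%:R * t) * sin (k.+1%:R * t))) =
  (j == k)%:R)%R.
Proof.
pose A : R := j.+1%:R; pose B : R := k.+1%:R.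
have cf : continuous (fun t : R => 2 / pi * (sin (A * t) * sin (B * t))).
  have cs (c : R) : continuous (fun t : R => sin (c * t)).
    move=> y; apply: (@continuous_comp _ _ _ (fun t => c * t) (@sin R)).
      exact: mulrl_continuous.
    exact: continuous_sin.
  by move=> t; apply: cvgM; [exact: cvg_cst | apply: cvgM; exact: cs].
have dF (t : R) : is_derive t 1 (fun t => pi^-1 * (S (A - B) t - S (A + B) t))
    (2 / pi * (sin (A * t) * sin (B * t))).
  have h1 := is_derive_S (A - B) t; have h2 := is_derive_S (A + B) t.
  have -> : 2 / pi * (sin (A * t) * sin (B * t)) =
      pi^-1 *: (cos ((A - B) * t) - cos ((A + B) * t)).
    by rewrite (mulrBl t A B) (mulrDl A B) cosB cosD /GRing.scale /=; ring.
  exact: (is_deriveZ pi^-1 (is_deriveB h1 h2)).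
have S0 c : S c 0 = 0 by rewrite /S mulr0 sin0 mul0r; case: ifP.
rewrite (continuous_ftc (pi_gt0 R) cf dF) !S0 subrr mulr0 subr0.
have -> : S (A + B) pi = 0.
  rewrite /S ifN; last by rewrite lt0r_neq0 // addr_gt0 // ltr0Sn.
  by rewrite mulrDl sinD !sin_natr_pi mulr0 mul0r addr0 mul0r.
rewrite subr0 /S subr_eq0 eqr_nat eqSS; case: eqP => _.
  by rewrite mulVf // lt0r_neq0 // pi_gt0.
by rewrite mulrBl sinB !sin_natr_pi mulr0 mul0r subrr mul0r mulr0.
Qed.

(** The semicircle law of radius 2a; outside the segment [Num.sqrt] makes it 0. *)
Definition semicircle_density (a x : R) := Num.sqrt (1 - (x / (2 * a)) ^+ 2) / (pi * a).

Variable a : R.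
Hypothesis a0 : 0 < a.
Local Notation sc := (semicircle_density a).

Lemma continuous_semicircle_density : continuous sc.
Proof.
move=> x; apply: cvgM; last exact: cvg_cst.
apply: (@continuous_comp R R R (fun x : R => 1 - (x / (2 * a)) ^+ 2) (@Num.sqrt R)).
  apply: cvgB; first exact: cvg_cst.
  by apply: (@cvgM _ _ _ _ (fun x => x / (2 * a)) (fun x => x / (2 * a))); exact: mulrr_continuous.
exact: sqrt_continuous.
Qed.

Lemma semicircle_integral (G : R -> R) : continuous G ->
  (\int[mu]_(x in `[- (2 * a), 2 * a]) (sc x * G x) =
   \int[mu]_(t in `[0, pi]) (2 / pi * (sin t ^+ 2 * G (2 * a * cos t))))%R.
Proof.
move=> cG; pose F (t : R) := 2 * a * cos t.
have F0 : F 0 = 2 * a by rewrite /F cos0 mulr1.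
have Fpi : F pi = - (2 * a) by rewrite /F cospi mulrN1.
have a20 : 0 < 2 * a by rewrite mulr_gt0.
have dF (t : R) : is_derive t 1 F (- (2 * a * sin t)).
  rewrite -mulrN; exact: (is_deriveZ (2 * a)).
have F' t : derive1 F t = - (2 * a * sin t) by rewrite derive1E; apply: derive_val.
have cF : continuous F.
  by move=> x; apply/differentiable_continuous/derivable1_diffP/ex_derive.
have cF' : continuous (derive1 F).
  rewrite (_ : derive1 F = fun t => - (2 * a * sin t)); last exact/funext.
  by move=> x; apply: cvgN; apply: cvgM; [exact: cvg_cst | exact: continuous_sin].
rewrite -Fpi -[X in `[_, X]]F0 /Rintegral integration_by_substitution_decreasing.
- congr fine; apply: eq_integral => t; rewrite inE /= in_itv /= => /andP[t0 tpi].
  rewrite !fctE F' opprK /semicircle_density /F (_ : 2 * a * cos t / (2 * a) = cos t); last first.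
    by rewrite mulrAC divff ?mul1r // lt0r_neq0.
  rewrite -sin2cos2 sqrtr_sqr ger0_norm; last by rewrite sin_ge0_pi // t0.
  congr EFin; have := lt0r_neq0 (pi_gt0 R); have := lt0r_neq0 a0.
  by move: (@pi R) => P h1 h2; field; rewrite h1 h2.
- exact: pi_ge0.
- move=> x y xI yI xy; rewrite /F ltr_pM2l //; exact: (etrans (ltr_cos _ _)).
- by move=> x _; exact: cF'.
- by apply: cvgP; apply: cvg_at_right_filter; exact: cF'.
- by apply: cvgP; apply: cvg_at_left_filter; exact: cF'.
- split; first by move=> x _; apply: ex_derive.
    exact/cvg_at_right_filter/cF.
  exact/cvg_at_left_filter/cF.
apply: continuous_subspaceT => x; apply: cvgM; last exact: cG.
exact: continuous_semicircle_density.
Qed.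

Lemma continuous_chebV k : continuous (@chebV R k).
Proof.
suff : continuous (@chebV R k) /\ continuous (@chebV R k.+1) by case.
elim: k => [|k [IH1 IH2]]; first by split=> x /=; [apply: cvg_cst | apply: cvg_id].
split=> // x; apply: cvgB; last exact: IH1.
by apply: cvgM; [exact: cvg_id | exact: IH2].
Qed.

Lemma continuous_chebV_scaled k : continuous (fun x : R => chebV k (x / a)).
Proof.
move=> x; apply: (@continuous_comp R R R (fun x : R => x / a) (chebV k)).
  exact: mulrr_continuous.
exact: continuous_chebV.
Qed.

Lemma chebV_orthonormal j k :
  (\int[mu]_(x in `[- (2 * a), 2 * a]) (sc x * (chebV j (x / a) * chebV k (x / a))) =
  (j == k)%:R)%R.
Proof.
rewrite (@semicircle_integral (fun x => chebV j (x / a) * chebV k (x / a))); last first.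
  by move=> x; apply: cvgM; exact: continuous_chebV_scaled.
rewrite -sin_orthogonal; apply: eq_Rintegral => t _.
have -> : 2 * a * cos t / a = 2 * cos t by field; exact: lt0r_neq0.
by rewrite -!chebV_sin; ring.
Qed.

End Orthogonality.

(** * Continuity, positivity and moments of the density *)

Section Density.
Context (R : realType) (p a : R).
Hypotheses (p0 : 0 < p) (p25 : p < 2 / 5) (a0 : 0 < a).
Local Notation mu := (@lebesgue_measure R).
Local Notation sc := (semicircle_density a).
Let r := p * (5 / 2).
Let r0 : 0 <= r. Proof. by rewrite /r mulr_ge0 // ltW. Qed.
Let r1 : r < 1. Proof. by rewrite /r; move: p25; lra. Qed.
Let pia : 0 < pi * a. Proof. by rewrite mulr_gt0 // pi_gt0. Qed.

Lemma semicircle_density_out x : 2 * a <= `|x| -> sc x = 0.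
Proof.
move=> xa; rewrite /semicircle_density ler0_sqrtr ?mul0r // subr_le0.
have a20 : 0 < 2 * a by rewrite mulr_gt0.
rewrite -real_normK ?num_real // normrM normfV (gtr0_norm a20).
by rewrite -[leLHS](expr1n _ 2) lerXn2r ?nnegrE // ?divr_ge0 ?(ltW a20) // ler_pdivlMr // mul1r.
Qed.

Lemma semicircle_density_le x : 0 <= sc x <= (pi * a)^-1.
Proof.
rewrite /semicircle_density divr_ge0 ?sqrtr_ge0 ?(ltW pia) //=.
rewrite -[leRHS]mul1r ler_wpM2r ?invr_ge0 ?(ltW pia) // -[leRHS]sqrtr1.
by rewrite ler_wsqrtr // lerBlDl lerDr sqr_ge0.
Qed.

(** Outside [-2a, 2a] the geometric bound on the series in [gfun] is lost; there the vanishing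
    semicircle factor alone fixes the value. *)
Definition cheb_density x := sc x * gfun p (x / a).
Local Notation dens := cheb_density.
Let approx N x := sc x * \sum_(s < N) gterm p (x / a) s.
Let C := (pi * a)^-1 * (6 / (1 - r)).

Lemma cheb_density_out x : 2 * a <= `|x| -> dens x = 0.
Proof. by move=> /semicircle_density_out; rewrite /dens => ->; rewrite mul0r. Qed.

Let scaled_le x : `|x| < 2 * a -> `|x / a| <= 2.
Proof. by move=> /ltW xa; rewrite normrM normfV (gtr0_norm a0) ler_pdivrMr. Qed.

Lemma cheb_density_ge0 x : 0 <= dens x.
Proof.
have [xa|xa] := ltP `|x| (2 * a); last by rewrite cheb_density_out.
have /andP[s0 _] := semicircle_density_le x.
by rewrite mulr_ge0 // ltW // gfun_gt0 // scaled_le.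
Qed.

Lemma cheb_density_gt0 x : `|x| < 2 * a -> 0 < dens x.
Proof.
move=> xa; rewrite mulr_gt0 //; last by rewrite gfun_gt0 // scaled_le.
rewrite divr_gt0 // sqrtr_gt0 subr_gt0 -real_normK ?num_real //.
have a20 : 0 < 2 * a by rewrite mulr_gt0.
rewrite normrM normfV (gtr0_norm a20) exprn_ilt1 // ?divr_ge0 ?(ltW a20) //.
by rewrite ltr_pdivrMr // mul1r.
Qed.

(** Uniform on the whole line: the geometric tail inside the segment, the common factor 0 outside.
    Continuity, integrals against V_k and closeness to the semicircle all follow from this
    estimate. *)
Let approx_tail N x : `|dens x - approx N x| <= C * r ^+ N.
Proof.
have C0 : 0 <= C * r ^+ N.
  by rewrite mulr_ge0 ?exprn_ge0 // mulr_ge0 ?invr_ge0 ?(ltW pia) // divr_ge0 // subr_ge0 ltW.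
have [xa|xa] := ltP `|x| (2 * a); last first.
  by rewrite cheb_density_out // /approx semicircle_density_out // mul0r subrr normr0.
have /andP[s0 s1] := semicircle_density_le x.
rewrite -mulrBr normrM (ger0_norm s0) /C -mulrA.
apply: ler_pM => //; apply: le_trans (gsum_tail _ (gterm_geo p0 p25 (scaled_le xa))) _.
by rewrite mulrAC.
Qed.

Lemma cheb_density_le x : dens x <= C.
Proof.
have := approx_tail 0 x; rewrite /approx big_ord0 mulr0 subr0 expr0 mulr1.
exact: le_trans (ler_norm _).
Qed.

(** The first term of the series is 1, so the semicircle is the approximation of order one, and r is
    proportional to p. *)
Lemma cheb_density_near x : `|dens x - sc x| <= C * r.
Proof.
have := approx_tail 1 x.
by rewrite /approx big_ord1 gterm0 // mulr1 expr1.
Qed.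

Let r_small e : 0 < e -> exists N, C * r ^+ N < e.
Proof.
move=> e0; have h : (fun N => C * r ^+ N) @ \oo --> (0 : R).
  by rewrite -(mulr0 C); apply: cvgMl_tmp; apply: cvg_expr; rewrite ger0_norm.
by have [N _ /(_ N (leqnn N))] := cvgr_lt _ h _ e0; exists N.
Qed.

Let continuous_approx N : continuous (approx N).
Proof.
move=> x; apply: cvgM; first exact: continuous_semicircle_density.
apply: cvg_sumr => s; apply: cvgM; [exact: cvg_cst | exact: continuous_chebV_scaled].
Qed.

Lemma continuous_cheb_density : continuous dens.
Proof.
move=> x; apply/cvgrPdist_lt => e e0; have e3 : 0 < e / 3 by rewrite divr_gt0.
have [N hN] := r_small e3.
have /cvgrPdist_lt/(_ _ e3) := @continuous_approx N x.
apply: filterS => y hy.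
have -> : dens x - dens y = (dens x - approx N x) + (approx N x - approx N y) - (dens y - approx N y).
  by ring.
apply: le_lt_trans (ler_normB _ _) _.
apply: le_lt_trans (lerD (ler_normD _ _) (lexx _)) _.
have h1 := le_lt_trans (approx_tail N x) hN; have h2 := le_lt_trans (approx_tail N y) hN.
by move: h1 h2 hy; lra.
Qed.

Local Notation I G := (\int[mu]_(x in `[- (2 * a), 2 * a]) G x)%R.

Let segD (F G : R -> R) : continuous F -> continuous G ->
  I (fun x => F x + G x) = I F + I G.
Proof. by move=> cF cG; rewrite RintegralD //; exact: continuous_integrable. Qed.

Let segZ (c : R) (G : R -> R) : continuous G -> I (fun x => c * G x) = c * I G.
Proof. by move=> cG; rewrite RintegralZl //; exact: continuous_integrable. Qed.

Let approx_cheb k N : I (fun x => approx N x * chebV k (x / a)) =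
  \sum_(s < N) cheb_coef p s * (s.*2 == k)%:R.
Proof.
have cV j := @continuous_chebV_scaled R a j.
elim: N => [|N IHN].
  rewrite big_ord0; under eq_Rintegral do rewrite /approx big_ord0 mulr0 mul0r.
  by rewrite Rintegral_cst // mul0r.
rewrite big_ord_recr /= -IHN.
rewrite -(chebV_orthonormal a0) -segZ; last first.
  move=> x; apply: cvgM; first exact: continuous_semicircle_density.
  by apply: cvgM; exact: cV.
rewrite -segD; last 2 first.
- by move=> x; apply: cvgM; [exact: continuous_approx | exact: cV].
- move=> x; apply: cvgM; first exact: cvg_cst.
  by apply: cvgM; [exact: continuous_semicircle_density | apply: cvgM; exact: cV].
by apply: eq_Rintegral => x _; rewrite /approx big_ord_recr /= /gterm /chebE; ring.
Qed.

Lemma cheb_density_cheb k : I (fun x => dens x * chebV k (x / a)) = cheb_seq p k.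
Proof.
have cV j := @continuous_chebV_scaled R a j.
have cdV : continuous (fun x => dens x * chebV k (x / a)).
  by move=> x; apply: cvgM; [exact: continuous_cheb_density | exact: cV].
have caV N : continuous (fun x => approx N x * chebV k (x / a)).
  by move=> x; apply: cvgM; [exact: continuous_approx | exact: cV].
pose B := I (fun x => `|chebV k (x / a)|).
have caV' N : continuous (fun x => dens x * chebV k (x / a) - approx N x * chebV k (x / a)).
  by move=> x; apply: cvgB; [exact: cdV | exact: caV].
have cN (G : R -> R) : continuous G -> continuous (fun x => `|G x|).
  by move=> cG x; apply: cvg_norm; exact: cG.
have bound N : `|I (fun x => dens x * chebV k (x / a)) - I (fun x => approx N x * chebV k (x / a))|
    <= C * r ^+ N * B.
  rewrite -RintegralB //; try exact: continuous_integrable.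
  apply: le_trans (le_normr_Rintegral _ _) _ => //; first exact: continuous_integrable.
  rewrite /B -segZ; last exact/cN/cV.
  apply: le_Rintegral => //.
  - exact/continuous_integrable/cN/caV'.
  - by apply: continuous_integrable => x; apply: cvgM; [exact: cvg_cst | exact: (cN _ (cV k))].
  move=> x _; rewrite -mulrBl normrM ler_wpM2r //; exact: approx_tail.
have approxE N : (k < N)%N -> I (fun x => approx N x * chebV k (x / a)) = cheb_seq p k.
  move=> kN; rewrite approx_cheb /cheb_seq; case: ifPn => ko.
    by rewrite big1 // => s _; case: eqP ko => [<-|_]; rewrite ?odd_double // mulr0.
  have k2 : (k./2 < N)%N by apply: leq_ltn_trans kN; rewrite -divn2 leq_div.
  rewrite (bigD1 (Ordinal k2)) //= big1 ?addr0.
    by rewrite even_halfK // eqxx mulr1.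
  move=> s sk; case: eqP => [e|_]; last by rewrite mulr0.
  by move: sk; rewrite -val_eqE /= -e doubleK eqxx.
have h : (fun N => C * r ^+ N * B) @ \oo --> (0 : R).
  rewrite -[X in _ --> X](mul0r B); apply: cvgMr_tmp; rewrite -(mulr0 C).
  by apply: cvgMl_tmp; apply: cvg_expr; rewrite ger0_norm.
apply/eqP; rewrite -subr_eq0 -normr_le0; apply: (cvgr_to_ge h).
exists k.+1 => // N /= kN; rewrite -(approxE N) //; exact: bound.
Qed.

(** Each factor x is absorbed by x V_{k+1} = V_{k+2} + V_k, that is, by one [cheb_mul]; keeping V_k
    in the statement is what lets the induction run. *)
Lemma cheb_density_moment m k : I (fun x => dens x * (x ^+ m * chebV k (x / a))) =
  a ^+ m * iter m (@cheb_mul R) (cheb_seq p) k.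
Proof.
have cdV n j : continuous (fun x : R => dens x * (x ^+ n * chebV j (x / a))).
  move=> x; apply: cvgM; first exact: continuous_cheb_density.
  by apply: cvgM; [exact: exprn_continuous | exact: continuous_chebV_scaled].
elim: m k => [|m IHm] k.
  rewrite expr0 mul1r /= -cheb_density_cheb; apply: eq_Rintegral => x _.
  by rewrite expr0 mul1r.
case: k => [|k].
  rewrite [X in _ = _ * X]/= /cheb_mul addr0 exprS -mulrA -IHm -segZ //.
  by apply: eq_Rintegral => x _; rewrite exprS /=; field; rewrite lt0r_neq0.
rewrite [X in _ = _ * X]/= {2}/cheb_mul exprS -mulrA mulrDr -!IHm -segD // -segZ.
  apply: eq_Rintegral => x _; rewrite exprS chebVS; field; rewrite lt0r_neq0 //.
by move=> x; apply: cvgD; exact: cdV.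
Qed.

End Density.

(** * Analyticity *)

Section WienerSeries.
Context (R : realType).
Implicit Types (c u v : nat -> R) (f g : R -> R) (t B D rho : R).

(** [B] bounds the weighted l1 norm of the Taylor coefficients at radius rho. These norms are
    submultiplicative and allow geometric sums, so analyticity of a composition reduces to numerical
    bounds on real series. *)
Definition wser rho B c f :=
  (forall N, \sum_(k < N) `|c k| * rho ^+ k <= B) /\
  forall t, `|t| < rho -> (fun N => \sum_(k < N) c k * t ^+ k) @ \oo --> f t.

Definition wiener rho B f := exists c, wser rho B c f.

Definition conv u v k := \sum_(i < k.+1) u i * v (k - i)%N.

Lemma wser_ge0 rho B c f : wser rho B c f -> 0 <= B.
Proof. by case=> /(_ 0%N); rewrite big_ord0. Qed.

Lemma wser_analytic f x rho B c : 0 < rho -> wser rho B c (fun t => f (x + t)) ->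
  analytic_at f x.
Proof.
move=> rho0 [_ h]; exists c, rho; split=> // y hy.
have := h _ hy; rewrite subrKC; apply: cvg_trans; apply: near_eq_cvg.
by near=> N; rewrite /pseries /series /= big_mkord.
Unshelve. all: by end_near. Qed.

Lemma le_wser rho B D c f : B <= D -> wser rho B c f -> wser rho D c f.
Proof. by move=> BD [h h']; split=> // N; apply: le_trans BD. Qed.

Lemma eq_wser rho B c f g : (forall t, `|t| < rho -> f t = g t) ->
  wser rho B c f -> wser rho B c g.
Proof. by move=> fg [h h']; split=> // t tr; rewrite -fg //; exact: h'. Qed.

Section Fixed.
Variable rho : R.
Hypothesis rho0 : 0 < rho.

(** Beyond index K the weight |t|^k falls short of rho^k by at least the factor (|t| / rho)^K. *)
Let tail_le c t K N : `|t| < rho -> (K <= N)%N ->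
  `|\sum_(k < N) c k * t ^+ k - \sum_(k < K) c k * t ^+ k| <=
  (`|t| / rho) ^+ K * \sum_(k < N) `|c k| * rho ^+ k.
Proof.
move=> tr KN; have tr0 : 0 <= `|t| / rho by rewrite divr_ge0 // ltW.
have tr1 : `|t| / rho <= 1 by rewrite ler_pdivrMr // mul1r ltW.
rewrite -(big_mkord xpredT (fun k => c k * t ^+ k)) (big_cat_nat (n := K)) //= big_mkord addrAC subrr add0r.
apply: le_trans (ler_norm_sum _ _ _) _; rewrite mulr_sumr.
rewrite -(big_mkord xpredT (fun k => (`|t| / rho) ^+ K * (`|c k| * rho ^+ k))).
rewrite [leRHS](big_cat_nat (n := K)) //= -[leLHS]add0r lerD //.
  by apply: sumr_ge0 => k _; rewrite !mulr_ge0 ?exprn_ge0 // ltW.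
rewrite !big_nat; apply: ler_sum => k /andP[Kk _].
rewrite normrM normrX mulrCA ler_wpM2l //.
have -> : `|t| ^+ k = (`|t| / rho) ^+ k * rho ^+ k.
  by rewrite -exprMn divfK // lt0r_neq0.
by rewrite ler_wpM2r ?exprn_ge0 ?(ltW rho0) // ler_wiXn2l.
Qed.

Lemma wser_tail B c f t K : wser rho B c f -> `|t| < rho ->
  `|f t - \sum_(k < K) c k * t ^+ k| <= (`|t| / rho) ^+ K * B.
Proof.
move=> [cB ct] tr; have h2 : (fun N => `|\sum_(k < N) c k * t ^+ k - \sum_(k < K) c k * t ^+ k|) @ \oo -->
    `|f t - \sum_(k < K) c k * t ^+ k|.
  by apply: cvg_norm; apply: cvgB; [exact: ct | exact: cvg_cst].
apply: (cvgr_to_le h2); exists K => // N /= KN.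
by apply: le_trans (tail_le c tr KN) _; rewrite ler_wpM2l ?cB // exprn_ge0 // divr_ge0 // ltW.
Qed.

Let ratio_cvg t B : `|t| < rho -> (fun N => (`|t| / rho) ^+ N * B) @ \oo --> (0 : R).
Proof.
move=> tr; rewrite -[X in _ --> X](mul0r B); apply: cvgMr_tmp; apply: cvg_expr.
by rewrite ger0_norm ?divr_ge0 ?(ltW rho0) // ltr_pdivrMr // mul1r.
Qed.

Lemma wser_of_tail B D c f : (forall N, \sum_(k < N) `|c k| * rho ^+ k <= B) ->
  (forall t K, `|t| < rho ->
    `|f t - \sum_(k < K) c k * t ^+ k| <= (`|t| / rho) ^+ K * D) ->
  wser rho B c f.
Proof.
move=> cB ct; split=> // t tr; apply/cvgrPdist_lt => e e0.
have [N _ hN] := cvgr_lt _ (ratio_cvg D tr) _ e0.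
by exists N => // K /= NK; apply: le_lt_trans (ct _ _ tr) (hN _ NK).
Qed.

Lemma wser_cst (a : R) : wser rho `|a| (fun k => if k is 0 then a else 0) (fun=> a).
Proof.
split=> [[|N]|t _]; first by rewrite big_ord0.
  by rewrite big_ord_recl big1 ?addr0 ?expr0 ?mulr1 // => k _; rewrite /= normr0 mul0r.
apply/cvgrPdist_lt => e e0; exists 1%N => // [[|N]] //= _.
by rewrite big_ord_recl big1 ?addr0 ?expr0 ?mulr1 ?subrr ?normr0 // => k _; rewrite /= mul0r.
Qed.

Lemma wser_id : wser rho rho (fun k => (k == 1%N)%:R) id.
Proof.
have E (F : nat -> R) N : \sum_(k < N) (k == 1%N :> nat)%:R * F k = (1 < N)%N%:R * F 1%N.
  case: ltnP => N1; last first.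
    rewrite mul0r big1 // => k _; case: eqP => e; last by rewrite mul0r.
    by have := ltn_ord k; rewrite e ltnNge N1.
  rewrite (bigD1 (Ordinal N1)) //= big1 ?addr0 ?mul1r // => k.
  by rewrite -val_eqE /= => /negbTE ->; rewrite mul0r.
split=> [N|t _].
  under eq_bigr do rewrite normr_nat.
  rewrite (E (fun k => rho ^+ k)) expr1; case: ltnP => _; rewrite ?mul1r // mul0r ltW //.
apply/cvgrPdist_lt => e e0; exists 2%N => // N /= N1.
by rewrite (E (fun k => t ^+ k)) N1 mul1r expr1 subrr normr0.
Qed.

Lemma wserD B D u v f g : wser rho B u f -> wser rho D v g ->
  wser rho (B + D) (fun k => u k + v k) (fun t => f t + g t).
Proof.
move=> [uB ut] [vD vt]; split=> [N|t tr].
  apply: le_trans (lerD (uB N) (vD N)); rewrite -big_split /=; apply: ler_sum => k _.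
  by rewrite -mulrDl ler_wpM2r ?ler_normD // exprn_ge0 // ltW.
under eq_fun do [under eq_bigr do rewrite mulrDl]; under eq_fun do rewrite big_split /=.
by apply: cvgD; [exact: ut | exact: vt].
Qed.

Let absmul_le (U V : {poly R}) k : `|(U * V)`_k| <=
  ((\poly_(i < size U) `|U`_i|) * (\poly_(i < size V) `|V`_i|))`_k.
Proof.
rewrite !coefM; apply: le_trans (ler_norm_sum _ _ _) _; apply: ler_sum => i _.
rewrite normrM !coef_poly.
by case: ltnP => [_|h]; case: ltnP => [_|h'] //; rewrite ?(nth_default _ h) ?(nth_default _ h') ?normr0 ?mulr0 ?mul0r.
Qed.

(** The product of two truncations is a polynomial whose coefficients below the cutoff are those of
    the Cauchy product. The others are controlled by evaluating at rho the product of the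
    polynomials of absolute values, and [tail_le] sends their contribution at t to 0. *)
Lemma wserM B D u v f g : wser rho B u f -> wser rho D v g ->
  wser rho (B * D) (conv u v) (fun t => f t * g t).
Proof.
move=> wu wv; have B0 := wser_ge0 wu; have D0 := wser_ge0 wv.
have [uB ut] := wu; have [vD vt] := wv.
pose U N := \poly_(i < N) u i; pose V N := \poly_(i < N) v i.
have UV N k : (k < N)%N -> (U N * V N)`_k = conv u v k.
  move=> kN; rewrite coefM; apply: eq_bigr => i _; rewrite !coef_poly.
  by rewrite (leq_ltn_trans (leq_ord i) kN) (leq_ltn_trans (leq_subr i k) kN).
have horn w N t : (\poly_(i < N) w i).[t] = \sum_(k < N) w k * t ^+ k by rewrite horner_poly.
have absP (w : nat -> R) (E : R) N : (forall M, \sum_(k < M) `|w k| * rho ^+ k <= E) ->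
    0 <= (\poly_(i < size (\poly_(i < N) w i)) `|(\poly_(i < N) w i)`_i|).[rho] <= E.
  move=> wE; rewrite horner_poly sumr_ge0 /=; last first.
    by move=> k _; rewrite mulr_ge0 // exprn_ge0 // ltW.
  apply: le_trans (wE (size (\poly_(i < N) w i))); apply: ler_sum => k _.
  by rewrite ler_wpM2r ?exprn_ge0 ?(ltW rho0) // coef_poly; case: ifP; rewrite ?normr0.
have bnd N M : \sum_(k < M) `|(U N * V N)`_k| * rho ^+ k <= B * D.
  pose U' := \poly_(i < size (U N)) `|(U N)`_i|.
  pose V' := \poly_(i < size (V N)) `|(V N)`_i|.
  have /andP[U0 UB] := absP u B N uB; have /andP[V0 VD] := absP v D N vD.
  apply: le_trans (ler_pM U0 V0 UB VD); rewrite -hornerM.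
  rewrite (@horner_coef_wide _ (M + size (U' * V'))) ?leq_addl // big_split_ord /=.
  rewrite -[leLHS]addr0 lerD //.
    by apply: ler_sum => k _; rewrite ler_wpM2r ?absmul_le // exprn_ge0 // ltW.
  apply: sumr_ge0 => k _; rewrite mulr_ge0 ?exprn_ge0 ?(ltW rho0) //.
  by apply: le_trans (absmul_le _ _ _).
split=> [N|t tr].
  by apply: le_trans (bnd N N); apply: ler_sum => k _; rewrite UV.
have hUV : (fun N => (U N).[t] * (V N).[t]) @ \oo --> f t * g t.
  by under eq_fun do rewrite !horn; apply: cvgM; [exact: ut | exact: vt].
rewrite -[f t * g t]subr0.
have -> : (fun N => \sum_(k < N) conv u v k * t ^+ k) = (fun N => (U N).[t] * (V N).[t] -
    ((U N).[t] * (V N).[t] - \sum_(k < N) conv u v k * t ^+ k)).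
  by apply/funext => N; rewrite opprB addrC subrK.
apply: cvgB => //; apply/cvgrPdist_lt => e e0.
have [N _ hN] := cvgr_lt _ (ratio_cvg (B * D) tr) _ e0.
exists N => // M /= NM; rewrite sub0r normrN; apply: le_lt_trans (hN _ NM).
rewrite -hornerM (@horner_coef_wide _ (M + size (U M * V M))) ?leq_addl //.
rewrite (_ : \sum_(k < M) conv u v k * t ^+ k = \sum_(k < M) (U M * V M)`_k * t ^+ k); last first.
  by apply: eq_bigr => k _; rewrite UV.
apply: le_trans (tail_le _ tr (leq_addr _ _)) _.
by rewrite ler_wpM2l ?bnd // exprn_ge0 // divr_ge0 // ltW.
Qed.

Lemma wser_gsum C theta (B : nat -> R) (c : nat -> nat -> R) (F : nat -> R -> R) :
  (forall s, wser rho (B s) (c s) (F s)) -> geo_by C theta B ->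
  wser rho (C / (1 - theta)) (fun k => gsum (fun s => c s k)) (fun t => gsum (fun s => F s t)).
Proof.
move=> wF gB; have [th0 th1 hB] := gB.
have sumB M : \sum_(s < M) B s <= C / (1 - theta).
  have := geo_by_tail gB (leq0n M); rewrite big_ord0 subr0 expr0 mulr1.
  exact: le_trans (ler_norm _).
have ck s k : `|c s k| * rho ^+ k <= B s.
  have [/(_ k.+1) h _] := wF s; apply: le_trans h; rewrite big_ord_recr /= lerDr.
  by apply: sumr_ge0 => i _; rewrite mulr_ge0 // exprn_ge0 // ltW.
have gc k : geo (fun s => c s k).
  exists (C / rho ^+ k), theta; split=> // s.
  rewrite mulrAC ler_pdivlMr ?exprn_gt0 //.
  by apply: le_trans (ck s k) _; apply: le_trans (ler_norm _) (hB s).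
have Fb s t : `|t| < rho -> `|F s t| <= B s.
  by move=> tr; have := wser_tail 0 (wF s) tr; rewrite big_ord0 subr0 expr0 mul1r.
apply: (@wser_of_tail _ (C / (1 - theta))) => [N|t K tr].
  have h : (fun M => \sum_(k < N) `|\sum_(s < M) c s k| * rho ^+ k) @ \oo -->
      \sum_(k < N) `|gsum (fun s => c s k)| * rho ^+ k.
    by apply: cvg_sumr => k; apply: cvgMr_tmp; apply: cvg_norm; exact: geo_cvg.
  apply: (cvgr_to_le h); exists 0%N => // M _ /=.
  apply: le_trans (sumB M); apply: (@le_trans _ _ (\sum_(s < M) \sum_(k < N) `|c s k| * rho ^+ k)).
    rewrite exchange_big /=; apply: ler_sum => k _; rewrite -mulr_suml.
    by rewrite ler_wpM2r ?ler_norm_sum // exprn_ge0 // ltW.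
  by apply: ler_sum => s _; have [/(_ N)] := wF s.
have gF : geo (fun s => F s t).
  exists C, theta; split=> // s; apply: le_trans (Fb s t tr) _.
  exact: le_trans (ler_norm _) (hB s).
have h : (fun M => `|\sum_(s < M) F s t - \sum_(k < K) (\sum_(s < M) c s k) * t ^+ k|) @ \oo -->
    `|gsum (fun s => F s t) - \sum_(k < K) gsum (fun s => c s k) * t ^+ k|.
  apply: cvg_norm; apply: cvgB; first exact: geo_cvg.
  by apply: cvg_sumr => k; apply: cvgMr_tmp; exact: geo_cvg.
apply: (cvgr_to_le h); exists 0%N => // M _ /=.
under [X in _ - X]eq_bigr do rewrite mulr_suml.
rewrite exchange_big /= -sumrB; apply: le_trans (ler_norm_sum _ _ _) _.
apply: (@le_trans _ _ (\sum_(s < M) (`|t| / rho) ^+ K * B s)).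
  by apply: ler_sum => s _; exact: wser_tail.
by rewrite -mulr_sumr ler_wpM2l ?sumB // exprn_ge0 // divr_ge0 // ltW.
Qed.

End Fixed.
End WienerSeries.

(** * The binomial series of the square root *)

Section SquareRoot.
Context (R : realType).

(* The coefficients of the binomial series of [(1 - v)^(1/2)]. *)
Fixpoint sqrt_coef k : R :=
  if k is k'.+1 then sqrt_coef k' * ((k'%:R - 1 / 2) / k'.+1%:R) else 1.
Local Notation b := sqrt_coef.

Lemma norm_sqrt_coef k : `|b k| <= 1.
Proof.
elim: k => [|k IHk] /=; first by rewrite normr1.
rewrite normrM -[leRHS]mulr1 ler_pM // normrM normfV normr_nat.
rewrite ler_pdivrMr ?ltr0Sn // mul1r ler_norml -natr1.
have := ler0n R k; lra.
Qed.

(** Coefficient form of (1 - v) (S^2)' = - S^2, where S is the series: [wt] symmetrizes the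
    derivative of the square, and [rec] is the resulting recursion, which leaves only 1 - v. *)
Lemma conv_sqrt_coef k :
  conv b b k = match k with 0 => 1 | 1 => -1 | _ => 0 end.
Proof.
have sym n : \sum_(i < n.+1) (n - i)%:R * (b i * b (n - i)%N) =
    \sum_(i < n.+1) i%:R * (b i * b (n - i)%N).
  rewrite (reindex_inj rev_ord_inj) /=; apply: eq_bigr => i _.
  by rewrite subSS subKn ?leq_ord // [b _ * b _]mulrC.
have wt n : n%:R * conv b b n = 2 * \sum_(i < n.+1) i%:R * (b i * b (n - i)%N).
  rewrite [RHS]mulr_natl mulr2n -{1}sym -big_split /= mulr_sumr.
  by apply: eq_bigr => i _; rewrite -mulrDl -natrD subnK // leq_ord.
have rec n : n.+1%:R * conv b b n.+1 = (n%:R - 1) * conv b b n.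
  rewrite wt mulrBl wt mul1r big_ord_recl /= mul0r add0r.
  rewrite mulr_sumr /conv mulr_sumr -sumrB; apply: eq_bigr => i _.
  rewrite /bump /= add1n subSS; set x := b (n - i)%N.
  have h : i.+1%:R != 0 :> R by rewrite pnatr_eq0.
  by move: (b i) => y; field; rewrite nat1r h.
case: k => [|k]; first by rewrite /conv big_ord1 /= mulr1.
elim: k => [|k IHk].
  by have := rec 0%N; rewrite mul1r sub0r mulN1r => ->; rewrite /conv big_ord1 /= mulr1.
apply: (@mulfI _ k.+2%:R); first by rewrite pnatr_eq0.
by rewrite rec IHk mulr0; case: k {IHk} => [|k]; rewrite ?subrr ?mul0r ?mulr0.
Qed.

(** The square of the series is 1 - v by [conv_sqrt_coef]; it is the nonnegative root because for
    |v| <= 1/4 the terms after the initial 1 add up to at most 1 in absolute value. *)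
Lemma sqrt_series v : `|v| <= 1 / 4 -> gsum (fun s => b s * v ^+ s) = Num.sqrt (1 - v).
Proof.
move=> v4; pose S (t : R) := gsum (fun s => b s * t ^+ s).
have gS (t : R) : `|t| < 1 -> geo_by 1 `|t| (fun s => b s * t ^+ s).
  by move=> t1; split=> // s; rewrite normrM normrX ler_wpM2r ?exprn_ge0 // norm_sqrt_coef.
have w : wser (1 / 2) 2 b S.
  split=> [N|t t2]; last by apply: geo_cvg; do 2!eexists; apply: gS; move: t2; lra.
  apply: (@le_trans _ _ (\sum_(k < N) (1 / 2 : R) ^+ k)).
    by apply: ler_sum => k _; rewrite ler_piMl ?norm_sqrt_coef // exprn_ge0 //; lra.
  have h : geo_by 1 (1 / 2 : R) (fun k => (1 / 2) ^+ k).
    by split=> [||k]; [lra | lra | rewrite mul1r ger0_norm // ?exprn_ge0 //; lra].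
  have := geo_by_tail h (leq0n N); rewrite big_ord0 subr0 expr0 mulr1.
  by move=> h2; apply: le_trans (ler_norm _) _; apply: le_trans h2 _; rewrite ler_pdivrMr; lra.
have half0 : 0 < 1 / 2 :> R by lra.
have [_ /(_ v) hv] := wserM half0 w w.
have S2 : S v ^+ 2 = 1 - v.
  have v2 : `|v| < 1 / 2 by move: v4; lra.
  rewrite expr2; apply: (cvg_unique _ (hv v2)); first exact: Rhausdorff.
  apply/cvgrPdist_lt => e e0; exists 2%N => // -[|[|N]] //= _.
  rewrite 2!big_ord_recl /= big1; last by move=> k _; rewrite conv_sqrt_coef mul0r.
  by rewrite !conv_sqrt_coef expr0 expr1 addr0 mulr1 mulN1r subrr normr0.
have S0 : 0 <= S v.
  have v1 : `|v| < 1 by move: v4; lra.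
  have := gsum_tail 1 (gS v v1); rewrite big_ord1 /= expr0 mulr1 expr1 mul1r -/(S v).
  have h : `|v| / (1 - `|v|) <= 1 by rewrite ler_pdivrMr; move: v4 v1; lra.
  by move=> h2; have := le_trans h2 h; rewrite ler_norml => /andP[]; lra.
by rewrite -S2 sqrtr_sqr ger0_norm.
Qed.

End SquareRoot.

(** * Analyticity of the density inside the support *)

Section DensityAnalytic.
Context (R : realType).

Section Wiener.
Variable rho : R.
Hypothesis rho0 : 0 < rho.

Lemma wiener_cst (c : R) : wiener rho `|c| (fun=> c).
Proof. by eexists; exact: wser_cst. Qed.

Lemma wiener_id : wiener rho rho id.
Proof. by eexists; exact: wser_id. Qed.

Lemma wienerD (B D : R) f g : wiener rho B f -> wiener rho D g ->
  wiener rho (B + D) (fun t => f t + g t).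
Proof. by move=> [u hu] [v hv]; eexists; exact: wserD hu hv. Qed.

Lemma wienerM (B D : R) f g : wiener rho B f -> wiener rho D g ->
  wiener rho (B * D) (fun t => f t * g t).
Proof. by move=> [u hu] [v hv]; eexists; exact: wserM hu hv. Qed.

Lemma wienerZ (B c : R) f : wiener rho B f -> wiener rho (`|c| * B) (fun t => c * f t).
Proof. by move=> h; apply: wienerM => //; exact: wiener_cst. Qed.

Lemma wienerX (B : R) f s : wiener rho B f -> wiener rho (B ^+ s) (fun t => f t ^+ s).
Proof.
move=> h; elim: s => [|s IHs].
  by under eq_fun do rewrite expr0; rewrite -[B ^+ 0]normr1; exact: wiener_cst.
by under eq_fun do rewrite exprS; rewrite exprS; exact: wienerM.
Qed.

Lemma le_wiener (B D : R) f : B <= D -> wiener rho B f -> wiener rho D f.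
Proof. by move=> BD [c h]; exists c; exact: le_wser h. Qed.

Lemma wiener_gsum (C theta : R) (B : nat -> R) (F : nat -> R -> R) :
  (forall s, wiener rho (B s) (F s)) -> geo_by C theta B ->
  wiener rho (C / (1 - theta)) (fun t => gsum (fun s => F s t)).
Proof. by move=> /choice[c hc] gB; eexists; exact: wser_gsum hc gB. Qed.

Lemma wiener_quad (c0 c1 c2 : R) :
  wiener rho (`|c0| + (`|c1| * rho + `|c2| * rho ^+ 2)) (fun t => c0 + (c1 * t + c2 * t ^+ 2)).
Proof.
apply: wienerD; first exact: wiener_cst.
by apply: wienerD; apply: wienerZ; [exact: wiener_id | apply: wienerX; exact: wiener_id].
Qed.

(** The bound 21/10 is the largest for which the rate 5/2 still propagates: (21/10) (5/2) + 1 =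
    (5/2)^2. *)
Lemma wiener_chebE (y : R -> R) : wiener rho (21 / 10) (fun t => y t ^+ 2 - 2) ->
  forall s, wiener rho (4 * (5 / 2) ^+ s) (fun t => chebE s (y t)).
Proof.
move=> wy s.
suff : wiener rho (4 * (5 / 2) ^+ s) (fun t => chebE s (y t)) /\
  wiener rho (4 * (5 / 2) ^+ s.+1) (fun t => chebE s.+1 (y t)) by case.
have w1 := wiener_cst 1; rewrite normr1 in w1.
elim: s => [|s [IH1 IH2]].
  split; first by rewrite expr0 mulr1; apply: le_wiener w1; lra.
  have -> : (fun t => chebE 1 (y t)) = fun t => (y t ^+ 2 - 2) + 1.
    by apply/funext => t; rewrite /chebE /=; ring.
  by apply: le_wiener (wienerD wy w1); rewrite expr1; lra.
split=> //.
have -> : (fun t => chebE s.+2 (y t)) =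
    fun t => (y t ^+ 2 - 2) * chebE s.+1 (y t) + (-1) * chebE s (y t).
  by apply/funext => t; rewrite chebES mulN1r.
apply: le_wiener (wienerD (wienerM wy IH2) (wienerZ (-1) IH1)).
by rewrite normrN normr1 !exprS; move: ((5 / 2 : R) ^+ s) => z; lra.
Qed.

End Wiener.

Variables (p a : R).
Hypotheses (p0 : 0 < p) (p25 : p < 2 / 5) (a0 : 0 < a).

Lemma cheb_density_analytic x : `|x| < 2 * a -> analytic_at (cheb_density p a) x.
Proof.
move=> xa; have a20 : 0 < 2 * a by rewrite mulr_gt0.
have [z zE] : {z : R | z = x / (2 * a)} by exists (x / (2 * a)).
have [w wE] : {w : R | w = 1 - z ^+ 2} by exists (1 - z ^+ 2).
have z1 : `|z| < 1 by rewrite zE normrM normfV (gtr0_norm a20) ltr_pdivrMr // mul1r.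
have w0 : 0 < w by rewrite wE subr_gt0 -real_normK ?num_real // exprn_ilt1.
have w1 : w <= 1 by rewrite wE lerBlDl lerDr sqr_ge0.
(* The radius shrinks with [w], which measures the distance to the endpoints. The factor 50 gives 2
   + 4/50 + 1/50 = 21/10, the bound that [wiener_chebE] takes, and leaves [v] below 1/4, as
   [sqrt_series] asks. *)
pose rho := a * w / 50.
have rho0 : 0 < rho by rewrite /rho !mulr_gt0.
have {}zE : x = 2 * a * z by rewrite zE mulrC divfK // lt0r_neq0.
have an0 := lt0r_neq0 a0; have wn0 := lt0r_neq0 w0.
have nz : 0 <= `|z| by [].
have wcheb : wiener rho (21 / 10) (fun t => ((x + t) / a) ^+ 2 - 2).
  have -> : (fun t => ((x + t) / a) ^+ 2 - 2) =
      fun t => (4 * z ^+ 2 - 2) + (4 * z / a * t + a^-1 ^+ 2 * t ^+ 2).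
    by apply/funext => t; rewrite zE; field.
  apply: le_wiener (wiener_quad rho0 _ _ _).
  have h1 : `|4 * z ^+ 2 - 2| <= 2.
    by rewrite ler_norml; move: w0 w1; rewrite wE; move: (z ^+ 2) => zz; lra.
  have h2 : `|4 * z / a| * rho = `|z| * (4 * w / 50).
    by rewrite !normrM normfV (gtr0_norm a0) ger0_norm // /rho; field.
  have h3 : `|a^-1 ^+ 2| * rho ^+ 2 = (w / 50) ^+ 2.
    by rewrite ger0_norm ?sqr_ge0 // /rho; field.
  have h4 : `|z| * (4 * w / 50) <= 4 / 50.
    have := ler_pM nz (ltW w0) (ltW z1) w1; lra.
  have h5 : (w / 50) ^+ 2 <= 1 / 50.
    have := ler_pM (ltW w0) (ltW w0) w1 w1; rewrite expr2; lra.
  rewrite h2 h3; lra.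
have wg : exists B, wiener rho B (fun t => gfun p ((x + t) / a)).
  eexists; apply: (wiener_gsum rho0 (B := fun s => cheb_coef p s * (4 * (5 / 2) ^+ s)) (C := 8) (theta := p * (5 / 2))).
    move=> s; have /andP[g0 _] := cheb_coef_bound p0 p25 s.
    by rewrite -{1}(gtr0_norm g0); apply: wienerZ => //; exact: wiener_chebE.
  split; [by move: p0; lra | by move: p25; lra | move=> s].
  have /andP[g0 g1] := cheb_coef_bound p0 p25 s.
  have h : 0 <= (5 / 2 : R) ^+ s by rewrite exprn_ge0 //; lra.
  rewrite ger0_norm; last by rewrite mulr_ge0 ?(ltW g0) // mulr_ge0.
  have -> : 8 * (p * (5 / 2)) ^+ s = (2 * p ^+ s) * (4 * (5 / 2) ^+ s) by rewrite exprMn; ring.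
  by rewrite ler_wpM2r // mulr_ge0.
(* Chosen so that 1 - ((x + t) / (2a))^2 = w (1 - v t). *)
pose v t := z / (a * w) * t + (4 * a ^+ 2 * w)^-1 * t ^+ 2.
have wv : wiener rho (1 / 4) v.
  have -> : v = fun t => 0 + (z / (a * w) * t + (4 * a ^+ 2 * w)^-1 * t ^+ 2).
    by apply/funext => t; rewrite add0r.
  apply: le_wiener (wiener_quad rho0 _ _ _); rewrite normr0 add0r.
  have h2 : `|z / (a * w)| * rho = `|z| / 50.
    by rewrite normrM normfV (gtr0_norm (mulr_gt0 a0 w0)) /rho; field; rewrite wn0 an0.
  have h3 : `|(4 * a ^+ 2 * w)^-1| * rho ^+ 2 = w / 10000.
    have d0 : 0 < 4 * a ^+ 2 * w by rewrite !mulr_gt0 // exprn_gt0.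
    by rewrite normfV (gtr0_norm d0) /rho; field; rewrite wn0 an0.
  by rewrite h2 h3; move: z1 w1; lra.
have wS : exists B, wiener rho B (fun t => gsum (fun s => sqrt_coef R s * v t ^+ s)).
  eexists; apply: (wiener_gsum rho0 (B := fun s => `|sqrt_coef R s| * (1 / 4) ^+ s) (C := 1) (theta := 1 / 4)).
    by move=> s; apply: wienerZ => //; exact: wienerX.
  split; [lra | lra | move=> s].
  have h : 0 <= (1 / 4 : R) ^+ s by rewrite exprn_ge0 //; lra.
  by rewrite ger0_norm ?mulr_ge0 // ler_wpM2r // norm_sqrt_coef.
have [B hB] := wg; have [D hD] := wS; have [cv hcv] := wv.
have [c hc] := wienerM rho0 (wienerZ rho0 (Num.sqrt w / (pi * a)) hD) hB.
apply: (wser_analytic rho0 (B := `|Num.sqrt w / (pi * a)| * D * B) (c := c)).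
apply: eq_wser hc => t tr.
rewrite /cheb_density /semicircle_density; congr (_ * _).
have vt : `|v t| <= 1 / 4.
  by have := wser_tail rho0 0 hcv tr; rewrite big_ord0 subr0 expr0 mul1r.
rewrite sqrt_series // mulrAC -sqrtrM ?(ltW w0) //; congr (Num.sqrt _ / _).
by rewrite /v zE; move: wn0; rewrite wE => wn0; field; rewrite an0 wn0.
Qed.

End DensityAnalytic.

Lemma abs_analytic (R : realType) (x : R) : x != 0 -> `|x| < 1 ->
  analytic_at (fun y : R => if `|y| <= 1 then `|y| else 0) x.
Proof.
move=> x0 x1; pose rho := Num.min `|x| (1 - `|x|).
have rho0 : 0 < rho by rewrite lt_min normr_gt0 x0 subr_gt0.
have [c hc] := wiener_quad rho0 `|x| (Num.sg x) 0.
apply: (wser_analytic rho0); apply: eq_wser hc => t; rewrite lt_min => /andP[tx t1].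
rewrite mul0r addr0 ifT; last by apply: le_trans (ler_normD _ _) _; move: t1; lra.
have [xp|xn|xe] := ltrgt0P x; last by rewrite xe eqxx in x0.
  move: tx; rewrite gtr0_sg // mul1r (gtr0_norm xp) ltr_norml => /andP[h _].
  by rewrite ger0_norm //; move: h; lra.
move: tx; rewrite ltr0_sg // mulN1r (ltr0_norm xn) ltr_norml => /andP[_ h].
by rewrite ler0_norm; move: h; lra.
Qed.

(** * The density for n = 2 *)

Section AbsDensity.
Context (R : realType).
Local Notation mu := (@lebesgue_measure R).

Lemma power_integral (a b : R) m : a < b ->
  (\int[mu]_(x in `[a, b]) (x ^+ m) = (b ^+ m.+1 - a ^+ m.+1) / m.+1%:R)%R.
Proof.
move=> ab; have m0 : m.+1%:R != 0 :> R by rewrite pnatr_eq0.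
have dF (x : R) : is_derive x 1 (fun x => m.+1%:R^-1 * x ^+ m.+1) (x ^+ m).
  have h : is_derive x 1 (fun x : R => x ^+ m.+1) (m.+1%:R * x ^+ m).
    have -> : (fun x : R => x ^+ m.+1) = (@id R) ^+ m.+1 by rewrite exprfctE.
    have h := @is_deriveX R R id m.+1 x 1 1 (is_derive_id x 1).
    apply: is_derive_eq h _.
    by rewrite /GRing.scale /= mulr1.
  by apply: is_derive_eq (is_deriveZ m.+1%:R^-1 h) _; rewrite /GRing.scale /= mulrA mulVf // mul1r.
rewrite (continuous_ftc ab (@exprn_continuous R m) dF).
by rewrite -mulrBr mulrC.
Qed.

Definition abs_density (x : R) := if `|x| <= 1 then `|x| else 0.

Lemma abs_density_moment m :
  (\int[mu]_(x in `[-1, 1]) (x ^+ m * abs_density x) =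
  if odd m then 0 else 2 / (m%:R + 2))%R.
Proof.
rewrite (@eq_Rintegral _ _ _ mu _ (fun x => x ^+ m * `|x|)); last first.
  by move=> x; rewrite inE /= in_itv /= => hx; rewrite /abs_density ifT // ler_norml.
have ci : continuous (fun x : R => x ^+ m * `|x|).
  move=> x; apply: cvgM; first exact: exprn_continuous.
  exact: norm_continuous.
have cn : continuous (fun x : R => x ^+ m.+1) by exact: exprn_continuous.
have int01 : mu.-integrable `](0 : R), 1] (EFin \o (fun x => x ^+ m * `|x|)).
  by apply: integrableS (@continuous_integrable R _ 0 1 ci) => //; exact: subset_itv_oc_cc.
have := @Rintegral_itvB R (fun x => x ^+ m * `|x|) (BLeft (-1)) (BRight 1) 0
  (@continuous_integrable R _ (-1) 1 ci).
rewrite !bnd_simp oppr_le0 => /(_ ler01 ler01) /eqP.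
rewrite subr_eq Rintegral_itv_obnd_cbnd // => /eqP ->.
rewrite (@eq_Rintegral _ _ _ mu `[0, 1] (fun x => x ^+ m.+1)); last first.
  by move=> x; rewrite inE /= in_itv /= => /andP[x0 _]; rewrite ger0_norm // exprSr.
rewrite (@eq_Rintegral _ _ _ mu `[-1, 0] (fun x => -1 * x ^+ m.+1)); last first.
  move=> x; rewrite inE /= in_itv /= => /andP[_ x0]; rewrite ler0_norm // exprSr; ring.
rewrite RintegralZl //; last exact: continuous_integrable.
rewrite !power_integral ?ltrN10 // !expr1n !expr0n /= -signr_odd /= !negbK -natr1 -[m.+1%:R]natr1.
have h : m%:R + 1 + 1 != 0 :> R by rewrite !natr1 pnatr_eq0.
case: odd; rewrite ?expr1 ?expr0; field; rewrite ?h //.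
Qed.

Lemma measurable_abs_density : measurable_fun setT (abs_density : measurableTypeR R -> R).
Proof.
by apply: measurable_fun_ifT => //; apply: measurable_fun_ler.
Qed.

Lemma continuous_abs_density x : `|x| < 1 -> {for x, continuous abs_density}.
Proof.
have E y : `|y| < 1 -> abs_density y = `|y| by move=> /ltW y1; rewrite /abs_density y1.
move=> x1; suff : abs_density @ x --> `|x| by rewrite -[X in _ --> X](E x x1).
have h : Num.norm @ x --> `|x| by exact: norm_continuous.
apply: cvg_trans h; apply: near_eq_cvg.
have : \forall y \near x, `|y| < 1 by apply: (cvgr_lt _ (@norm_continuous _ R x)).
by apply: filterS => y /E ->.
Qed.

End AbsDensity.

(** * From the functional calculus to the densities of the laws *)

Lemma law_moment (R : realType) (A : cstarType R) (h : {scalar A}) (a : A)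
    (mu : probability (measurableTypeR R) R) (m : nat) :
  is_law h a mu -> mu.-integrable setT (EFin \o (fun x : R => x ^+ m)) /\
  h (a ^+ m) = (\int[mu]_x (x ^+ m))%R%:C.
Proof.
case=> Phi [_ _ PhiM _ [Phi1 Phix]] law.
have c0 (f : R -> R) : continuous f -> ccontinuous (fun x => (f x)%:C).
  by move=> cf; split=> //= x; exact: cvg_cst.
have cX k : ccontinuous (fun x : R => (x ^+ k)%:C) by apply/c0/exprn_continuous.
have cid : ccontinuous (fun x : R => x%:C) by apply: c0 => x; exact: cvg_id.
have PhiX : Phi (fun x => (x ^+ m)%:C) = a ^+ m.
  elim: m => [|m IHm]; first by rewrite expr0 -Phi1; congr Phi; apply/funext => x; rewrite expr0.
  rewrite exprS -IHm -Phix -PhiM //; congr Phi; apply/funext => x.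
  by rewrite exprS (rmorphM (real_complex R)).
have [i1 _] := law _ (cX m); rewrite PhiX => ->; split=> //.
by rewrite /= Rintegral_cst // mul0r.
Qed.

Lemma semicircle_densityE (R : realType) : semicircle_density 1 = @semicircle R.
Proof.
apply/funext => x; rewrite /semicircle_density /semicircle !mulr1.
have -> : 4 - x ^+ 2 = 2 ^+ 2 * (1 - (x / 2) ^+ 2) by field.
by rewrite sqrtrM ?sqr_ge0 // sqrtr_sqr ger0_norm // -mulf_div divff // mul1r.
Qed.

(** The smaller root of p^2 - n p + 1, written as 2 / (n + s) rather than (n - s) / 2 so that the
    bounds can be read off: n >= 3 gives s > 2, hence n + s > 5. *)
Lemma deformation_exists (R : realType) n : (3 <= n)%N ->
  exists p : R, [/\ 0 < p, p < 2 / 5, p <= 2 / n%:R & n%:R = p + p^-1].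
Proof.
move=> n3; have n3' : 3 <= n%:R :> R by rewrite ler_nat.
pose s : R := Num.sqrt (n%:R ^+ 2 - 4).
have n9 : 3 ^+ 2 <= n%:R ^+ 2 :> R by rewrite lerXn2r ?nnegrE // (le_trans _ n3').
have s2 : s ^+ 2 = n%:R ^+ 2 - 4 by rewrite sqr_sqrtr //; move: n9; lra.
have s0 : 2 < s.
  rewrite -(@ltr_pXn2r _ 2) ?nnegrE ?sqrtr_ge0 // s2; move: n9; lra.
have d0 : 0 < n%:R + s by move: n3' s0; lra.
exists (2 / (n%:R + s)); split.
- by rewrite divr_gt0.
- by rewrite ltr_pdivrMr //; move: n3' s0; lra.
- by rewrite ler_pM2l // lef_pV2 ?posrE //; move: n3' s0; lra.
rewrite invf_div; apply: (mulfI (lt0r_neq0 d0)).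
have -> : (n%:R + s) * (2 / (n%:R + s) + (n%:R + s) / 2) = 2 + (n%:R + s) ^+ 2 / 2.
  by field; exact: lt0r_neq0.
have -> : (n%:R + s) ^+ 2 = n%:R ^+ 2 + 2 * n%:R * s + s ^+ 2 by ring.
by rewrite s2; field.
Qed.

Section Densities.
Context (R : realType) (n : nat) (A : cstarType R) (u : 'M[A]_n) (h : {scalar A}).
Hypothesis Au : is_Ao u.
Hypothesis hu : is_haar u h.

Lemma scaled_law_moment (l : R) (i j : 'I_n) (mu : probability (measurableTypeR R) R) m :
  (2 <= n)%N -> is_law h (l%:C *: u i j) mu ->
  mu.-integrable setT (EFin \o (fun x : R => x ^+ m)) /\
  (\int[mu]_x (x ^+ m) = l ^+ m * jmom (jacobi R n) m 0)%R.
Proof.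
move=> n2 /(law_moment m)[im hm]; split=> //; apply: complexI.
rewrite -hm exprZn [LHS]linearZ /= (haar_moment n2 Au hu).
by rewrite (rmorphM (real_complex R)) (rmorphXn (real_complex R)).
Qed.

(** The factor [l] serves both parts of the theorem: l = 1 for u_ij, and l = sqrt (n + 2) for the
    rescaled entry, whose density then has a = 1. *)
Lemma scaled_law_density (p l : R) (i j : 'I_n) (mu : probability (measurableTypeR R) R) :
  (3 <= n)%N -> 0 < p -> p < 2 / 5 -> n%:R = p + p^-1 -> 0 < l ->
  is_law h (l%:C *: u i j) mu ->
  is_density mu (cheb_density p (l / Num.sqrt (n%:R + 2))).
Proof.
move=> n3 p0 p25 np l0 law; have n20 : 0 < n%:R + 2 :> R by rewrite ltr_wpDl.
pose s : R := Num.sqrt (n%:R + 2).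
have s0 : 0 < s by rewrite sqrtr_gt0.
have a0 : 0 < l / s by rewrite divr_gt0.
have p1 : p < 1 by move: p25; lra.
apply: (@moment_density R mu _ (2 * (l / s)) ((pi * (l / s))^-1 * (6 / (1 - p * (5 / 2))))).
- by rewrite mulr_gt0.
- apply: continuous_measurable_fun; exact: continuous_cheb_density.
- exact: cheb_density_ge0.
- exact: cheb_density_le.
- by move=> x /ltW; exact: cheb_density_out.
- by move=> m; have [] := scaled_law_moment m (ltnW n3) law.
move=> m; have [_ ->] := scaled_law_moment m (ltnW n3) law.
have -> : jacobi R n = fun k => s^-1 ^+ 2 * (tau p k * tau p k.+1).
  by apply/funext => k; rewrite (jacobi_q p0 p1 np) exprVn sqr_sqrtr // ltW.
rewrite jmom_scale; last by rewrite /tau expr0 subrr !mul0r.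
rewrite addn0 jmom_tau // (mulrA (l ^+ m)) -exprMn.
have := cheb_density_moment p0 p25 a0 m 0; rewrite /= => <-.
by apply: eq_Rintegral => x _; rewrite mulr1 mulrC.
Qed.

Lemma law_density_two (i j : 'I_n) (mu : probability (measurableTypeR R) R) :
  n = 2%N -> is_law h (u i j) mu -> is_density mu (@abs_density R).
Proof.
move=> n2 law; have law1 : is_law h (1%:C *: u i j) mu by rewrite scale1r.
have n2' : (2 <= n)%N by rewrite n2.
apply: (@moment_density R mu _ 1 1) => //.
- exact: measurable_abs_density.
- by move=> x; rewrite /abs_density; case: ifP.
- by move=> x; rewrite /abs_density; case: ifP.
- by move=> x; rewrite /abs_density ltNge => /negbTE ->.
- by move=> m; have [] := scaled_law_moment m n2' law1.
move=> m; have [_ ->] := scaled_law_moment m n2' law1.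
by rewrite n2 jmom2 expr1n mul1r abs_density_moment.
Qed.

End Densities.

Theorem theorem5p3 (R : realType)
    (A : nat -> cstarType R) (u : forall n : nat, 'M[A n]_n)
    (h : forall n : nat, {scalar A n})
    (hA : forall n : nat, (2 <= n)%N -> is_Ao (u n))
    (hh : forall n : nat, (2 <= n)%N -> is_haar (u n) (h n)) :
  (forall n : nat, (2 <= n)%N -> forall (i j : 'I_n)
      (mu : probability (measurableTypeR R) R),
    is_law (h n) (u n i j) mu ->
    [/\ msupport mu = [set x : R | - (2 / Num.sqrt (n%:R + 2)) <= x
                                     <= 2 / Num.sqrt (n%:R + 2)],
        forall x : R, mu [set x] = 0%E
      & exists f : R -> R, is_density mu f /\
          forall x : R, `|x| < 2 / Num.sqrt (n%:R + 2) ->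
            (n = 2%N -> x != 0) -> analytic_at f x])
  /\
  (forall e : R, 0 < e -> exists N : nat,
    forall n : nat, (2 <= n)%N -> (N <= n)%N -> forall (i j : 'I_n)
      (mu : probability (measurableTypeR R) R),
    is_law (h n) ((Num.sqrt (n%:R + 2))%:C *: u n i j) mu ->
    exists f : R -> R, [/\ is_density mu f, continuous f
      & forall x : R, `|f x - semicircle x| <= e]).
Proof.
split=> [n n2 i j mu law|e e0].
  have n20 : 0 < n%:R + 2 :> R by rewrite ltr_wpDl.
  have s0 : 0 < Num.sqrt (n%:R + 2) :> R by rewrite sqrtr_gt0.
  suff [f [df fout fpos fan]] : exists f : R -> R, [/\ is_density mu f,
      forall x, 2 / Num.sqrt (n%:R + 2) < `|x| -> f x = 0,
      forall x, `|x| < 2 / Num.sqrt (n%:R + 2) -> x != 0 -> 0 < f x /\ {for x, continuous f}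
    & forall x, `|x| < 2 / Num.sqrt (n%:R + 2) -> (n = 2%N -> x != 0) -> analytic_at f x].
    split; last by exists f.
      by apply: (msupport_density df) => //; rewrite divr_gt0.
    exact: density_no_atom df.
  have [n3|] := ltnP 2 n.
    have [p [p0 p25 _ np]] := deformation_exists R n3.
    have a0 : 0 < 1 / Num.sqrt (n%:R + 2) :> R by rewrite divr_gt0.
    have E : 2 / Num.sqrt (n%:R + 2) = 2 * (1 / Num.sqrt (n%:R + 2)) :> R by rewrite mul1r.
    exists (cheb_density p (1 / Num.sqrt (n%:R + 2))); rewrite E; split.
    - have law1 : is_law (h n) (1%:C *: u n i j) mu by rewrite scale1r.
      exact: (scaled_law_density (hA n n2) (hh n n2) n3 p0 p25 np ltr01 law1).
    - by move=> x /ltW; exact: cheb_density_out.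
    - by move=> x xa _; split; [exact: cheb_density_gt0 | exact: continuous_cheb_density].
    - by move=> x xa _; exact: cheb_density_analytic.
  move=> n2'; have ne2 : n = 2%N by apply/eqP; rewrite eqn_leq n2' n2.
  have -> : 2 / Num.sqrt (n%:R + 2) = 1 :> R.
    have -> : n%:R + 2 = 2 ^+ 2 :> R by rewrite ne2; ring.
    by rewrite sqrtr_sqr ger0_norm // divff.
  exists (@abs_density R); split.
  - exact: law_density_two (hA n n2) (hh n n2) i j mu ne2 law.
  - by move=> x; rewrite /abs_density ltNge => /negbTE ->.
  - move=> x x1 x0; split; last exact: continuous_abs_density.
    by rewrite /abs_density ltW ?normr_gt0.
  - by move=> x x1 /(_ ne2) x0; exact: abs_analytic.
(* For n >= 10 one has p <= 1/5, so the constant in [cheb_density_near] is at most (1/2) 12 = 6.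
   Since p <= 2/n, the ratio (5/2) p is at most 5/n, which is below e/6 as soon as n >= 30/e. *)
have [N hN] : exists N : nat, 30 / e < N%:R by exists (Num.truncn (30 / e)).+1; exact: truncnS_gt.
exists (maxn 10 N) => n n2; rewrite geq_max => /andP[n10 Nn] i j mu law.
have n3 : (3 <= n)%N by apply: leq_trans n10.
have [p [p0 p25 pn np]] := deformation_exists R n3.
have s0 : 0 < Num.sqrt (n%:R + 2) :> R by rewrite sqrtr_gt0 ltr_wpDl.
have := scaled_law_density (hA n n2) (hh n n2) n3 p0 p25 np s0 law.
rewrite divff ?lt0r_neq0 // => df; exists (cheb_density p 1); split=> //.
  exact: continuous_cheb_density.
move=> x; rewrite -semicircle_densityE.
apply: le_trans (cheb_density_near p0 p25 ltr01 x) _.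
have n10' : 10 <= n%:R :> R by rewrite ler_nat.
have p5 : p <= 1 / 5.
  by apply: le_trans pn _; rewrite ler_pdivrMr //; move: n10'; lra.
have d0 : 0 < 1 - p * (5 / 2) by move: p5; lra.
have pi1 : (pi * 1)^-1 <= 1 / 2 :> R.
  by rewrite mulr1 mul1r lef_pV2 ?posrE ?pi_gt0 // pi_ge2.
have b1 : 6 / (1 - p * (5 / 2)) <= 12 by rewrite ler_pdivrMr //; move: p5; lra.
have b2 : (pi * 1)^-1 * (6 / (1 - p * (5 / 2))) <= 1 / 2 * 12.
  by apply: ler_pM => //; rewrite ?divr_ge0 ?invr_ge0 ?mulr1 ?(ltW (pi_gt0 R)) ?(ltW d0).
have pe : p * (5 / 2) <= e / 6.
  have ne : 30 / e <= n%:R by apply: ltW; apply: lt_le_trans hN _; rewrite ler_nat.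
  have n0 : 0 < n%:R :> R by move: n10'; lra.
  have h30 : 30 <= n%:R * e by rewrite -ler_pdivrMr.
  have pn' : p * n%:R <= 2 by rewrite -ler_pdivlMr.
  rewrite -(ler_pM2r n0); move: h30 pn'; rewrite (mulrAC p) (mulrAC e) (mulrC e); lra.
apply: le_trans (ler_pM _ _ b2 pe) _; last lra.
- by rewrite mulr_ge0 ?divr_ge0 ?invr_ge0 ?mulr1 ?(ltW (pi_gt0 R)) ?(ltW d0).
- by rewrite mulr_ge0 // ltW.
Qed.
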